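(* (Direct part) Let $f\colon M^n=\prod_{i=0}^rM_i\to\mathbb{R}^N$ be the partial tube determined by the data $(\tilde f_0,\tilde f,\phi)$ constructed in the context. Then the metric $g$ induced by $f$ is the quasi-warped product of the metrics $g_0,\dots,g_r$ induced by $f_0,\dots,f_r$, respectively, with warping functions $\rho_a\colon M_0\times M_a\to\mathbb{R}_+$ given by $$\rho_a(p_0,p_a)=\rho_a(p_0)=\frac1{R_a}\langle f_0(p_0),e_a\rangle\quad\text{for }1\le a\le k,$$ $$\rho_a(p_0,p_a)=1-\langle f_a''(p_a),\phi^a_{p_a}(\pi_a(f_0(p_0)))\rangle\quad\text{for }k+1\le a\le\ell,\qquad\rho_a=1\quad\text{for }\ell+1\le a\le r.$$ Moreover, the second fundamental form of $f$ is adapted to the product net of $M^n$. (Converse) Any isometric immersion $f\colon M^n\to\mathbb{R}^N$ of a quasi-warped product manifold $M^n=\prod_{i=0}^rM_i$ whose second fundamental form is adapted to its product net is given in this way.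
   Context: With $\pi_i$ and $\pi_{0,a}$ the projections of $M=\prod_{i=0}^rM_i$ onto $M_i$ and $M_0\times M_a$, the quasi-warped product of Riemannian metrics $g_0,\dots,g_r$ on $M_0,\dots,M_r$ with warping functions $\rho_a\colon M_0\times M_a\to\mathbb{R}_+$, $1\le a\le r$, is the metric $g=\pi_0^*g_0+\sum_{a=1}^r(\rho_a\circ\pi_{0,a})^2\pi_a^*g_a$. The product net of $M$ is $(E_i)_{i=0,\dots,r}$, with $E_i$ the tangent subbundle to the factor $M_i$; the second fundamental form $\alpha$ of $f$ is adapted to it if $\alpha(E_i,E_j)=0$ for $i\ne j$. For an immersion $h\colon L\to\mathbb{R}^N$, $N_hL$ is the normal bundle with its normal connection and $A^h_\xi$ denotes the shape operator, $\langle A^h_\xi X,Y\rangle=\langle\alpha_h(X,Y),\xi\rangle$. A parallel vector bundle isometry $\phi\colon L\times\mathbb{R}^s\to E$ onto a flat parallel subbundle $E\subset N_hL$ is a smooth bundle map such that each $\phi_x=\phi(x,\cdot)\colon\mathbb{R}^s\to E(x)$ is a linear isometry and $x\mapsto\phi_x(y)$ is parallel in the normal connection for each fixed $y$. Set $\Omega(h;\phi)=\{Y\in\mathbb{R}^s:\ I-A^h_{\phi_x(Y)}\text{ is nonsingular for all }x\in L\}$. For an immersion $h_0\colon M_0\to\Omega(h;\phi)$, the partial tube determined by $(h_0,h,\phi)$ is the immersion $(p_0,x)\mapsto h(x)+\phi_x(h_0(p_0))$ of $M_0\times L$. Construction. Let $\tilde M=\prod_{a=1}^rM_a$ be a product manifold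 and let $f_a\colon M_a\to\mathbb{R}^{N_a}$, $1\le a\le r$, be isometric immersions. Suppose that there exist $1\le k\le\ell\le r$ such that $f_a(M_a)$ is contained in a hypersphere $\mathbb{S}^{N_a-1}(R_a)$ of radius $R_a$ centered at the origin for $1\le a\le k$, and $M_a$ is one-dimensional for $k+1\le a\le\ell$ (for these $a$, $f_a$ is a unit speed curve and $f_a''$ is its second derivative with respect to arc length). For $1\le a\le k$ let $E_a(p_a)$ be the line spanned by the position vector $f_a(p_a)$; for $k+1\le a\le\ell$ let $E_a$ be any flat parallel subbundle of $N_{f_a}M_a$, and choose parallel vector bundle isometries $\phi^a\colon M_a\times\mathbb{R}^{n_a}\to E_a$. (These subbundles $E_a$ are not to be confused with those of the product net.) Define $$\tilde f=f_1\times\cdots\times f_r\colon\prod_{a=1}^rM_a\to\prod_{a=1}^r\mathbb{R}^{N_a}=\mathbb{R}^{N-m}\subset\mathbb{R}^m\times\mathbb{R}^{N-m}=\mathbb{R}^N,\quad (p_1,\dots,p_r)\mapsto(f_1(p_1),\dots,f_r(p_r)),$$ and let $E$ be the flat parallel subbundle of the normal bundle of $\tilde f$ in $\mathbb{R}^N$ whose fibre at $\tilde p=(p_1,\dots,p_r)$ is $\bigl(\bigoplus_{a=1}^\ell E_a(p_a)\bigr)\oplus\mathbb{R}^m$. Set $\mathbb{R}^s=\mathbb{R}^k\times\prod_{a=k+1}^\ell\mathbb{R}^{n_a}\times\mathbb{R}^m$, choose an orthonormal basis $e_1,\dots,e_k$ of $\mathbb{R}^k$, and for $k+1\le a\le\ell$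 let $\pi_a\colon\mathbb{R}^s\to\mathbb{R}^{n_a}$ also denote the projection. Define a parallel vector bundle isometry $\phi\colon\tilde M\times\mathbb{R}^s\to E$ by requiring that $\phi_{\tilde p}(e_a)=f_a(p_a)/R_a$ for $1\le a\le k$, $\phi_{\tilde p}|_{\mathbb{R}^{n_a}}=\phi^a_{p_a}$ for $k+1\le a\le\ell$, and $\phi_{\tilde p}|_{\mathbb{R}^m}$ be any (fixed) linear isometry of $\mathbb{R}^m$. Given an immersion $f_0\colon M_0\to\sum_{a=1}^kR_ae_a+\Omega(\tilde f;\phi)\subset\mathbb{R}^s$, the immersion $\tilde f_0=f_0-\sum_{a=1}^kR_ae_a$ satisfies $\tilde f_0(M_0)\subset\Omega(\tilde f;\phi)$. Let $f\colon M^n=\prod_{i=0}^rM_i=M_0\times\tilde M\to\mathbb{R}^N$ be the partial tube determined by $(\tilde f_0,\tilde f,\phi)$, i.e. $f(p_0,\tilde p)=\tilde f(\tilde p)+\phi_{\tilde p}(\tilde f_0(p_0))$.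
   Formalization: As Ω allows negative ρ_a, the direct part gives warping functions |ρ_a|, and ρ_a itself when all are positive; k=0 is allowed (R×R²→R³ needs it); M_a, a≥1, have positive dimension; the converse assumes connected factors and holds up to relabelling and rigid motion. *)

(* Defs.v *)
From HB Require Import structures.
From mathcomp Require Import all_boot all_order all_algebra perm.
From mathcomp Require Import all_classical all_reals all_analysis.

Set Implicit Arguments.
Unset Strict Implicit.
Unset Printing Implicit Defensive.

Import Order.TTheory GRing.Theory Num.Theory.
Import numFieldNormedType.Exports.

Local Open Scope classical_set_scope.
Local Open Scope ring_scope.

(* All iterated directional derivatives of order at most [k] exist and are
   continuous on [U]; only meaningful when [U] is open. *)
Fixpoint Ck (R : realType) (V W : normedModType R) (k : nat)
    (U : set V) (f : V -> W) : Prop :=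
  (forall x, U x -> {for x, continuous f}) /\
  (if k is k'.+1 then
     forall v, (forall x, U x -> derivable f x v) /\
               Ck k' U (fun x => 'D_v f x)
   else True).

Definition smooth_on (R : realType) (V W : normedModType R)
    (U : set V) (f : V -> W) : Prop := forall k, Ck k U f.

Section SmoothLemmas.
Variable R : realType.

Lemma eq_Ck (V W : normedModType R) k (U : set V) (f g : V -> W) :
  open U -> (forall x, U x -> f x = g x) -> Ck k U f -> Ck k U g.
Proof.
move=> oU; elim: k f g => [|k IH] f g fg [cf df].
all: have fgU x : U x -> \forall y \near x, f y = g y by
  move=> Ux; apply: filterS (open_nbhs_nbhs (conj oU Ux)) => y /fg.
all: have cg x : U x -> {for x, continuous g} by
  move=> Ux; have -> : {for x, continuous g} = (g @ x --> g x) by [];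
  rewrite -(fg _ Ux); apply: cvg_trans (cf x Ux); exact: near_eq_cvg (fgU x Ux).
all: split=> // v; have [dfv Cf] := df v.
split; first by move=> x Ux; apply: near_eq_derivable (fgU x Ux) (dfv x Ux).
by apply: IH Cf => x Ux; apply: near_eq_derive; exact: fgU.
Qed.

Lemma Ck_coord (V : normedModType R) m n k (U : set V) (f : V -> 'M[R]_(m, n))
    i j : open U -> Ck k U f -> Ck k U (fun x => f x i j).
Proof.
move=> oU; elim: k f => [|k IH] f [cf df]; split=> //.
- move=> x Ux; apply: (@continuous_comp _ _ _ f (fun M => M i j)).
    exact: cf.
  exact: coord_continuous.
- move=> x Ux; apply: (@continuous_comp _ _ _ f (fun M => M i j)).
    exact: cf.
  exact: coord_continuous.
move=> v; have [dfv Cf] := df v; split.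
  by move=> x /dfv /derivable_mxP.
apply: eq_Ck (IH _ Cf) => // x Ux.
by rewrite (derive_mx (dfv x Ux)) mxE.
Qed.

Lemma mx_continuous (T : topologicalType) m n (x : T) (g : T -> 'M[R]_(m, n)) :
  (forall i j, {for x, continuous (fun x => g x i j)}) -> {for x, continuous g}.
Proof.
move=> cg; apply/cvgrPdist_le => e e0; near=> y.
rewrite /Num.Def.normr/= mx_normrE (bigmax_le _ (ltW e0))//= => ij _.
rewrite !mxE/=; move: ij; near: y; apply: filter_forall => -[i j] /=.
by move/cvgrPdist_le: (cg i j) => /(_ _ e0).
Unshelve. all: by end_near. Qed.

Lemma Ck_mx (V : normedModType R) m n k (U : set V) (f : V -> 'M[R]_(m, n)) :
  open U -> (forall i j, Ck k U (fun x => f x i j)) -> Ck k U f.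
Proof.
move=> oU; elim: k f => [|k IH] f Cf.
  by split=> // x Ux; apply: mx_continuous => i j; case: (Cf i j) => /(_ x Ux).
split; first by move=> x Ux; apply: mx_continuous => i j; case: (Cf i j) => /(_ x Ux).
move=> v.
have dfv x : U x -> derivable f x v.
  by move=> Ux; apply/derivable_mxP => i j; case: (Cf i j) => _ /(_ v)[/(_ x Ux)].
split=> //; apply: IH => i j; case: (Cf i j) => _ /(_ v)[_] Cij.
by apply: eq_Ck Cij => // x Ux; rewrite (derive_mx (dfv x Ux)) mxE.
Qed.

Lemma Ck_comp_linear (V V' W : normedModType R) k (U : set V') (g : V' -> W)
    (P : V -> V') :
  (forall (a : R) u v, P (a *: u + v) = a *: P u + P v) -> continuous P ->
  Ck k U g -> Ck k (P @^-1` U) (g \o P).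
Proof.
move=> lP cP; elim: k g => [|k IH] g [cg dg]; split=> //.
- by move=> x Ux; apply: continuous_comp; [exact: cP|exact: cg].
- by move=> x Ux; apply: continuous_comp; [exact: cP|exact: cg].
move=> v; have [dgv Cg] := dg (P v).
have E x : (fun h : R => h^-1 *: (((g \o P) \o shift x) (h *: v) - (g \o P) x)) =
           (fun h : R => h^-1 *: ((g \o shift (P x)) (h *: P v) - g (P x))).
  by apply/funext => h; rewrite /= lP.
split; first by move=> x Ux; rewrite /derivable E; exact: dgv.
have -> : (fun x => 'D_v (g \o P) x) = (fun y => 'D_(P v) g y) \o P.
  by apply/funext => x; rewrite /derive E.
exact: IH.
Qed.

Lemma sub_Ck (V W : normedModType R) k (U U' : set V) (f : V -> W) :
  U' `<=` U -> Ck k U f -> Ck k U' f.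
Proof.
move=> sU; elim: k f => [|k IH] f [cf df]; split=> //; try by move=> x /sU /cf.
by move=> v; have [d1 d2] := df v; split; [move=> x /sU /d1 | exact: IH].
Qed.

End SmoothLemmas.

Section ProductTopology.
Variables (I : finType) (T : I -> topologicalType).

Lemma nbhs_prod (p : prod_topology T) (A : set (prod_topology T)) :
  nbhs p A -> exists2 F : forall i, set (T i), (forall i, nbhs (p i) (F i)) &
    [set q | forall i, F i (q i)] `<=` A.
Proof.
pose D := [set F : forall i, set (T i) | forall i, nbhs (p i) (F i)].
pose B (F : forall i, set (T i)) : set (prod_topology T) :=
  [set q | forall i, F i (q i)].
have FF : Filter (filter_from D B).
  apply: filter_from_filter; first by exists (fun=> setT) => i; exact: filterT.
  move=> F G DF DG; exists (fun i => F i `&` G i).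
    by move=> i; exact: filterI.
  by move=> q FG; split=> i; case: (FG i).
suff : filter_from D B --> p by move=> /(_ A) /[apply].
apply/cvg_sup => i S [_ [[W oW <-] Wp WS]].
exists (fun j => [set x : T j | forall e : j = i, W (ecast k (T k) e x)]).
  move=> j; have [e|] := pselect (j = i); last first.
    by move=> ne; apply: filterE => x e; case: ne.
  subst j; apply: filterS (open_nbhs_nbhs (conj oW Wp)) => x Wx e.
  by rewrite (eq_irrelevance e erefl).
move=> q /(_ i) /(_ erefl) Wq; exact: WS.
Qed.

Lemma open_prod_box (F : forall i, set (T i)) : (forall i, open (F i)) ->
  open [set q : prod_topology T | forall i, F i (q i)].
Proof.
move=> oF; rewrite openE => q Fq.
apply: (@filter_forall _ I (fun i => [set p : prod_topology T | F i (p i)])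
  (nbhs q)) => i; apply: (@proj_continuous _ T i q).
exact: open_nbhs_nbhs (conj (oF i) (Fq i)).
Qed.

Lemma prod_continuous (S : topologicalType) (x : S) (f : S -> prod_topology T) :
  (forall i, {for x, continuous (fun s => f s i)}) -> {for x, continuous f}.
Proof.
move=> cf A /= /nbhs_prod[F nF sA].
apply: (filterS (fun y => sA (f y))).
apply: (@filter_forall _ I (fun i => [set y | F i (f y i)]) (nbhs x)) => i.
by apply: (cf i); exact: nF.
Qed.

Lemma second_countable_prod :
  (forall i, @second_countable (T i)) -> @second_countable (prod_topology T).
Proof.
move=> sc; pose B i := projT1 (cid2 (sc i)).
have cB i : countable (B i) by rewrite /B; case: (cid2 (sc i)).
have bB i : basis (B i) by rewrite /B; case: (cid2 (sc i)).
pose D := [set F : forall i, set (T i) | forall i, B i (F i)].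
pose box (F : forall i, set (T i)) : set (prod_topology T) :=
  [set q | forall i, F i (q i)].
exists (box @` D).
  apply: sub_countable (card_image_le _ _) _.
  have E i : {e : set (T i) -> nat | {in B i &, injective e}}.
    by apply: cid; apply/countable_injP.
  pose e i := projT1 (E i).
  have einj i : {in B i &, injective (e i)} := projT2 (E i).
  apply/countable_injP.
  exists (fun F => choice.pickle [ffun i => e i (F i)]) => F G.
  rewrite !inE => DF DG /(pcan_inj choice.pickleK)/ffunP eFG.
  apply: functional_extensionality_dep => i; apply: (einj i).
  - by rewrite inE.
  - by rewrite inE.
  - by have := eFG i; rewrite !ffunE.
split.
  move=> _ [F DF <-]; apply: open_prod_box => i.
  by have [+ _] := bB i; apply; exact: DF.
move=> p A /nbhs_prod[F nF sA].
have H i : {G : set (T i) | (B i G /\ G (p i)) /\ G `<=` F i}.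
  by apply: cid; have [_ /(_ (p i) (F i) (nF i)) [G ? ?]] := bB i; exists G.
pose G i := projT1 (H i).
have GP i : (B i (G i) /\ G i (p i)) /\ G i `<=` F i := projT2 (H i).
exists (box G).
  by split=> [|i]; [exists G => // i|]; have [[]] := GP i.
by move=> q Gq; apply: sA => i; have [_] := GP i; apply; exact: Gq.
Qed.

End ProductTopology.

Record chart (R : realType) (T : topologicalType) (n : nat) := Chart {
  cdom : set T;
  cimg : set 'rV[R]_n;
  ccoord : T -> 'rV[R]_n;
  cpar : 'rV[R]_n -> T;
  cdom_open : open cdom;
  cimg_open : open cimg;
  ccoord_img : forall p, cdom p -> cimg (ccoord p);
  cpar_dom : forall x, cimg x -> cdom (cpar x);
  ccoordK : forall p, cdom p -> cpar (ccoord p) = p;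
  cparK : forall x, cimg x -> ccoord (cpar x) = x;
  ccoord_continuous : forall p, cdom p -> {for p, continuous ccoord};
  cpar_continuous : forall x, cimg x -> {for x, continuous cpar} }.

(* A smooth manifold, given by a (not necessarily maximal) indexed atlas.
   Indexing the atlas makes the charts of a product explicit products of
   charts. *)
Record manifold (R : realType) := Manifold {
  mdim : nat;
  mcar :> topologicalType;
  mindex : Type;
  mchart : mindex -> chart R mcar mdim;
  mchart_at : mcar -> mindex;
  mchart_atP : forall p, cdom (mchart (mchart_at p)) p;
  mhausdorff : hausdorff_space mcar;
  msecond_countable : @second_countable mcar;
  mtransition : forall c d : mindex,
    smooth_on
      [set x | cimg (mchart c) x /\ cdom (mchart d) (cpar (mchart c) x)]
      (ccoord (mchart d) \o cpar (mchart c)) }.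

Section ProductManifold.
Variables (R : realType) (n : nat) (M : 'I_n -> manifold R).

Local Notation d i := (mdim (M i)).
Local Notation car := (prod_topology (fun i => mcar (M i))).

Lemma overlap_open (X : manifold R) (c e : mindex X) :
  open [set x | cimg (mchart c) x /\ cdom (mchart e) (cpar (mchart c) x)].
Proof.
rewrite openE => x [cx ex]; apply: filterI.
  exact: open_nbhs_nbhs (conj (@cimg_open _ _ _ _) cx).
apply: (cpar_continuous cx).
exact: open_nbhs_nbhs (conj (@cdom_open _ _ _ _) ex).
Qed.

Lemma submxrow_linear i (a : R) (u v : 'rV[R]_(\sum_i d i)) :
  submxrow (a *: u + v) i = a *: submxrow u i + submxrow v i.
Proof. by apply/matrixP => k l; rewrite !mxE. Qed.

Lemma submxrow_continuous i :
  continuous (fun x : 'rV[R]_(\sum_i d i) => submxrow x i).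
Proof.
move=> x; apply: mx_continuous => k l.
have -> : (fun y : 'rV[R]_(\sum_i d i) => submxrow y i k l) =
  (fun y => y k (tagnat.Rank i l)) by apply/funext => y; rewrite mxE.
exact: coord_continuous.
Qed.

Lemma mxrow_continuous (S : topologicalType) (x : S)
    (f : forall i, S -> 'rV[R]_(d i)) :
  (forall i, {for x, continuous (f i)}) ->
  {for x, continuous (fun s => \mxrow_i f i s : 'rV[R]_(\sum_i d i))}.
Proof.
move=> cf; apply: mx_continuous => k l.
have -> : (fun s => (\mxrow_i f i s) k l) = (fun s => f (tagnat.sig1 l) s k (tagnat.sig2 l)).
  by apply/funext => s; rewrite mxE.
apply: (@continuous_comp _ _ _ (f (tagnat.sig1 l)) (fun N => N k (tagnat.sig2 l))).
  exact: cf.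
exact: coord_continuous.
Qed.

Section ProductChart.
Variable c : forall i, mindex (M i).

Definition pdom : set car := [set p | forall i, cdom (mchart (c i)) (p i)].
Definition pimg : set 'rV[R]_(\sum_i d i) :=
  [set x | forall i, cimg (mchart (c i)) (submxrow x i)].
Definition pcoord (p : car) : 'rV[R]_(\sum_i d i) :=
  \mxrow_i ccoord (mchart (c i)) (p i).
Definition ppar (x : 'rV[R]_(\sum_i d i)) : car :=
  fun i => cpar (mchart (c i)) (submxrow x i).

Lemma pdom_open : open pdom.
Proof.
apply: (@open_prod_box _ (fun i => mcar (M i)) (fun i => cdom (mchart (c i)))) => i.
exact: cdom_open.
Qed.

Lemma pimg_open : open pimg.
Proof.
rewrite openE => x cx.
apply: (@filter_forall _ _
  (fun i => [set y | cimg (mchart (c i)) (submxrow y i)]) (nbhs x)) => i.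
apply: (@submxrow_continuous i x).
exact: open_nbhs_nbhs (conj (@cimg_open _ _ _ _) (cx i)).
Qed.

Lemma pcoord_img p : pdom p -> pimg (pcoord p).
Proof. by move=> cp i; rewrite mxrowK; exact: ccoord_img. Qed.

Lemma ppar_dom x : pimg x -> pdom (ppar x).
Proof. by move=> cx i; exact: cpar_dom. Qed.

Lemma pcoordK p : pdom p -> ppar (pcoord p) = p.
Proof.
move=> cp; apply: functional_extensionality_dep => i.
by rewrite /ppar mxrowK ccoordK.
Qed.

Lemma pparK x : pimg x -> pcoord (ppar x) = x.
Proof.
by move=> cx; apply/mxrowP => i; rewrite mxrowK cparK //; exact: cx.
Qed.

Lemma pcoord_continuous p : pdom p -> {for p, continuous pcoord}.
Proof.
move=> cp; apply: mxrow_continuous => i.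
apply: (@continuous_comp _ _ _ (fun q : car => q i) (ccoord (mchart (c i)))).
  exact: proj_continuous.
by apply: ccoord_continuous; exact: cp.
Qed.

Lemma ppar_continuous x : pimg x -> {for x, continuous ppar}.
Proof.
move=> cx; apply: (@prod_continuous _ (fun i => mcar (M i))) => i.
apply: (@continuous_comp _ _ _ (fun y => submxrow y i) (cpar (mchart (c i)))).
  exact: submxrow_continuous.
by apply: cpar_continuous; exact: cx.
Qed.

Definition prod_chart : chart R car (\sum_i d i) :=
  Chart pdom_open pimg_open pcoord_img ppar_dom pcoordK pparK
    pcoord_continuous ppar_continuous.

End ProductChart.

Lemma prod_transition (c e : forall i, mindex (M i)) :
  smooth_on
    [set x | cimg (prod_chart c) x /\ cdom (prod_chart e) (cpar (prod_chart c) x)]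
    (ccoord (prod_chart e) \o cpar (prod_chart c)).
Proof.
move=> k; apply: Ck_mx.
  rewrite openE => x [cx ex]; apply: filterI.
    exact: open_nbhs_nbhs (conj (@cimg_open _ _ _ _) cx).
  apply: (cpar_continuous cx).
  exact: open_nbhs_nbhs (conj (@cdom_open _ _ _ _) ex).
move=> i j; set a := tagnat.sig1 j.
have -> : (fun x => (ccoord (prod_chart e) \o cpar (prod_chart c)) x i j) =
  (fun y => (ccoord (mchart (e a)) \o cpar (mchart (c a))) y i (tagnat.sig2 j)) \o
  (fun x => submxrow x a) by apply/funext => x; rewrite /= mxE.
have := Ck_comp_linear (@submxrow_linear a) (@submxrow_continuous a)
  (Ck_coord i (tagnat.sig2 j) (@overlap_open _ (c a) (e a)) (@mtransition _ _ (c a) (e a) k)).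
apply: sub_Ck => x [cx ex]; split; [exact: cx|exact: ex].
Qed.

Definition prod_manifold : manifold R := {|
  mdim := \sum_i d i;
  mcar := car;
  mindex := forall i, mindex (M i);
  mchart := prod_chart;
  mchart_at := fun p i => mchart_at (p i);
  mchart_atP := fun p i => mchart_atP (p i);
  mhausdorff := hausdorff_product (fun i => @mhausdorff _ (M i));
  msecond_countable := second_countable_prod (fun i => @msecond_countable _ (M i));
  mtransition := prod_transition |}.

End ProductManifold.

Section Geometry.
Variable R : realType.

Definition dot n (u v : 'rV[R]_n) : R := (u *m v^T) 0 0.

Definition linear_isometry s n (L : 'rV[R]_s -> 'rV[R]_n) : Prop :=
  linear L /\ forall u v, dot (L u) (L v) = dot u v.

Section OneManifold.
Variable M : manifold R.
Implicit Types (c d : mindex M) (p x : M).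

Definition msmooth_on (U : set M) (W : normedModType R) (F : M -> W) : Prop :=
  forall c, smooth_on (cimg (mchart c) `&` [set y | U (cpar (mchart c) y)])
                      (F \o cpar (mchart c)).

Definition msmooth (W : normedModType R) (F : M -> W) : Prop :=
  msmooth_on setT F.

(* Tangent vectors at [p] are given by their components in a chart [c] around
   [p]; [mdiff c F p v] is the differential of [F] at [p] applied to [v]. *)
Definition mdiff (W : normedModType R) c (F : M -> W) p (v : 'rV[R]_(mdim M)) : W :=
  'D_v (F \o cpar (mchart c)) (ccoord (mchart c) p).

Definition mdiff2 (W : normedModType R) c (F : M -> W) p
    (v w : 'rV[R]_(mdim M)) : W :=
  'D_v (fun y => 'D_w (F \o cpar (mchart c)) y) (ccoord (mchart c) p).

Definition immersion N (h : M -> 'rV[R]_N) : Prop :=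
  msmooth h /\
  forall c p, cdom (mchart c) p -> forall v, mdiff c h p v = 0 -> v = 0.

(* A covariant 2-tensor field, by its values on the components of tangent
   vectors in each chart. *)
Definition metric : Type :=
  mindex M -> M -> 'rV[R]_(mdim M) -> 'rV[R]_(mdim M) -> R.

Definition metric_eq (g g' : metric) : Prop :=
  forall c p, cdom (mchart c) p -> forall v w, g c p v w = g' c p v w.

Definition riemannian (g : metric) : Prop :=
  [/\ forall c p, cdom (mchart c) p ->
        (forall w, scalar (fun v => g c p v w)) /\
        (forall v w, g c p v w = g c p w v),
      forall c p, cdom (mchart c) p -> forall v, v != 0 -> 0 < g c p v v,
      forall c v w,
        smooth_on (cimg (mchart c)) (fun y => g c (cpar (mchart c) y) v w)
    & forall c d p, cdom (mchart c) p -> cdom (mchart d) p -> forall v w,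
        g c p v w = g d p (mdiff c (ccoord (mchart d)) p v)
                          (mdiff c (ccoord (mchart d)) p w)].

Definition induced_metric N (h : M -> 'rV[R]_N) : metric :=
  fun c p v w => dot (mdiff c h p v) (mdiff c h p w).

Section Immersed.
Variables (N : nat) (h : M -> 'rV[R]_N).

Definition jac c p : 'M[R]_(mdim M, N) :=
  \matrix_(i < mdim M) mdiff c h p (delta_mx 0 i).

Definition gram c p : 'M[R]_(mdim M) := jac c p *m (jac c p)^T.

(* [u] minus its orthogonal projection to the tangent space, which is the row
   space of [jac c p]. *)
Definition normal_part c p (u : 'rV[R]_N) : 'rV[R]_N :=
  u - u *m (jac c p)^T *m invmx (gram c p) *m jac c p.

Definition normal_vector c p (xi : 'rV[R]_N) : Prop :=
  forall v, dot (mdiff c h p v) xi = 0.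

Definition second_fundamental_form c p (v w : 'rV[R]_(mdim M)) : 'rV[R]_N :=
  normal_part c p (mdiff2 c h p v w).

(* The matrix [A] such that [v *m A] is the image of [v] under the shape
   operator in direction [xi]:
   [v *m A *m gram c p *m w^T] is the inner product of [xi] with the second
   fundamental form at [v], [w]. *)
Definition shape_operator c p (xi : 'rV[R]_N) : 'M[R]_(mdim M) :=
  (\matrix_(i, j) dot (second_fundamental_form c p (delta_mx 0 i) (delta_mx 0 j)) xi)
  *m invmx (gram c p).

Definition normal_derivative c (xi : M -> 'rV[R]_N) p v : 'rV[R]_N :=
  normal_part c p (mdiff c xi p v).

Definition parallel_on (U : set M) (xi : M -> 'rV[R]_N) : Prop :=
  msmooth_on U xi /\
  forall c p, cdom (mchart c) p -> U p ->
    normal_vector c p (xi p) /\ forall v, normal_derivative c xi p v = 0.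

(* [E p] stands for its row space.  A subbundle of the normal bundle is
   parallel and flat iff it is locally spanned by parallel normal sections. *)
Definition flat_parallel_subbundle (s : nat) (E : M -> 'M[R]_N) : Prop :=
  forall p, exists (U : set M) (xi : 'I_s -> M -> 'rV[R]_N),
    [/\ open U, U p, forall j, parallel_on U (xi j) &
        forall q, U q -> \rank (E q) = s /\ (E q :=: \matrix_(j < s) xi j q)%MS].

Definition parallel_bundle_isometry (s : nat) (E : M -> 'M[R]_N)
    (phi : M -> 'rV[R]_s -> 'rV[R]_N) : Prop :=
  [/\ forall p, linear_isometry (phi p),
      forall p u, (u <= E p)%MS <-> exists y, phi p y = u
    & forall y, parallel_on setT (fun p => phi p y)].

Definition Omega (s : nat) (phi : M -> 'rV[R]_s -> 'rV[R]_N) : set 'rV[R]_s :=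
  [set Y | forall c p, cdom (mchart c) p ->
     1%:M - shape_operator c p (phi p Y) \in unitmx].

Definition partial_tube (M0 : Type) (s : nat) (phi : M -> 'rV[R]_s -> 'rV[R]_N)
    (h0 : M0 -> 'rV[R]_s) (p0 : M0) (p : M) : 'rV[R]_N :=
  h p + phi p (h0 p0).

(* When [mdim M = 1]: [d/ds] is the derivative in the direction of the
   coordinate field divided by its length.  The result does not depend on the
   chart, nor on the orientation. *)
Definition arclength_derivative2 p : 'rV[R]_N :=
  let c := mchart (mchart_at p) in
  let e : 'rV[R]_(mdim M) := const_mx 1 in
  let speed y := Num.sqrt (dot ('D_e (h \o cpar c) y) ('D_e (h \o cpar c) y)) in
  let unit_tangent y := (speed y)^-1 *: 'D_e (h \o cpar c) y in
  (speed (ccoord c p))^-1 *: 'D_e unit_tangent (ccoord c p).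

End Immersed.
End OneManifold.

Section QuasiWarped.
Variables (r : nat) (M : 'I_r.+1 -> manifold R).
Local Notation fac a := (M (lift ord0 a)).

(* Component in the factor [i] of a tangent vector to the product. *)
Definition tangent_proj i (v : 'rV[R]_(mdim (prod_manifold M))) :
    'rV[R]_(mdim (M i)) :=
  @submxrow R r.+1 (fun j => mdim (M j)) 1 v i.

Definition in_product_net i (v : 'rV[R]_(mdim (prod_manifold M))) : Prop :=
  forall j, j != i -> tangent_proj j v = 0.

Definition adapted N (f : prod_manifold M -> 'rV[R]_N) : Prop :=
  forall i j, i != j -> forall (c : mindex (prod_manifold M)) p,
    cdom (mchart c) p -> forall v w,
    in_product_net i v -> in_product_net j w ->
    second_fundamental_form f c p v w = 0.

Definition quasi_warped_metric (g0 : metric (M ord0))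
    (g : forall a, metric (fac a)) (rho : forall a, M ord0 -> fac a -> R) :
    metric (prod_manifold M) :=
  fun c p v w =>
    g0 (c ord0) (p ord0) (tangent_proj ord0 v) (tangent_proj ord0 w) +
    \sum_(a < r)
      rho a (p ord0) (p (lift ord0 a)) ^+ 2 *
      g a (c (lift ord0 a)) (p (lift ord0 a))
        (tangent_proj (lift ord0 a) v) (tangent_proj (lift ord0 a) w).

Definition warping_function (M0 M1 : manifold R) (rho : M0 -> M1 -> R) : Prop :=
  (forall p0 p1, 0 < rho p0 p1) /\
  forall (c0 : mindex M0) (c1 : mindex M1),
    smooth_on (cimg (mchart c0) `*` cimg (mchart c1))
      (fun z : 'rV[R]_(mdim M0) * 'rV[R]_(mdim M1) =>
         rho (cpar (mchart c0) z.1) (cpar (mchart c1) z.2)).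

Definition is_quasi_warped (G : metric (prod_manifold M)) (g0 : metric (M ord0))
    (g : forall a, metric (fac a)) (rho : forall a, M ord0 -> fac a -> R) : Prop :=
  (forall a, warping_function (rho a)) /\
  metric_eq G (quasi_warped_metric g0 g rho).

End QuasiWarped.

(* The data defining [f~] and [phi].  The factor with index [a : 'I_r] is the
   [(a + 1)]-st one, so that the spherical factors are those with [a < k] and
   the designated curves those with [k <= a < l].  Either range may be empty.
   The values of [td_R] and [td_e] are irrelevant for [k <= a], those of [td_E]
   and [td_phi] outside [k <= a < l], where [td_n] is set to 0 so that the
   sum of the [R^(td_n a)] only involves the designated curves. *)
Record tube_data (r : nat) (M : 'I_r -> manifold R) := TubeData {
  td_k : nat;
  td_l : nat;
  td_m : nat;
  td_kl : (td_k <= td_l)%N;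
  td_lr : (td_l <= r)%N;
  td_N : 'I_r -> nat;
  td_f : forall a, M a -> 'rV[R]_(td_N a);
  td_f_immersion : forall a, immersion (@td_f a);
  td_R : 'I_r -> R;
  td_R_gt0 : forall a : 'I_r, (a < td_k)%N -> 0 < td_R a;
  td_sphere : forall a : 'I_r, (a < td_k)%N -> forall p : M a,
    dot (@td_f a p) (@td_f a p) = td_R a ^+ 2;
  td_curve : forall a : 'I_r, (td_k <= a < td_l)%N -> mdim (M a) = 1%N;
  td_e : 'I_r -> 'rV[R]_td_k;
  td_e_orthonormal : forall a b : 'I_r, (a < td_k)%N -> (b < td_k)%N ->
    dot (td_e a) (td_e b) = (a == b)%:R;
  td_n : 'I_r -> nat;
  td_n0 : forall a : 'I_r, ~~ (td_k <= a < td_l)%N -> td_n a = 0%N;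
  td_E : forall a, M a -> 'M[R]_(td_N a);
  td_phi : forall a, M a -> 'rV[R]_(td_n a) -> 'rV[R]_(td_N a);
  td_E_flat : forall a : 'I_r, (td_k <= a < td_l)%N ->
    flat_parallel_subbundle (@td_f a) (td_n a) (@td_E a);
  td_phi_isometry : forall a : 'I_r, (td_k <= a < td_l)%N ->
    parallel_bundle_isometry (@td_f a) (@td_E a) (@td_phi a);
  td_iso : 'rV[R]_td_m -> 'rV[R]_td_m;
  td_isoP : linear_isometry td_iso }.

#[local] Arguments td_f [r M] _ a _.
#[local] Arguments td_phi [r M] _ a _ _.
#[local] Arguments td_iso [r M] _ _.

Section TubeConstruction.
Variables (r : nat) (M : 'I_r -> manifold R) (D : tube_data M).

Definition td_dim : nat := td_m D + \sum_a td_N D a.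

Definition td_s : nat := td_k D + (\sum_a td_n D a + td_m D).

Definition td_ftilde (p : prod_manifold M) : 'rV[R]_td_dim :=
  row_mx 0 (\mxrow_a td_f D a (p a)).

Definition proj_k (y : 'rV[R]_td_s) : 'rV[R]_(td_k D) := lsubmx y.
Definition proj_a (a : 'I_r) (y : 'rV[R]_td_s) : 'rV[R]_(td_n D a) :=
  submxrow (lsubmx (rsubmx y)) a.
Definition proj_m (y : 'rV[R]_td_s) : 'rV[R]_(td_m D) := rsubmx (rsubmx y).

Definition td_es (a : 'I_r) : 'rV[R]_td_s := row_mx (td_e D a) 0.

Definition td_phitilde (p : prod_manifold M) (y : 'rV[R]_td_s) : 'rV[R]_td_dim :=
  row_mx (td_iso D (proj_m y))
    (\mxrow_a (if (a < td_k D)%N then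
                 dot (proj_k y) (td_e D a) *: ((td_R D a)^-1 *: td_f D a (p a))
               else if (a < td_l D)%N then td_phi D a (p a) (proj_a a y)
               else 0)).

Definition td_shift : 'rV[R]_td_s :=
  \sum_(a < r | (a < td_k D)%N) td_R D a *: td_es a.

Section WithF0.
Variables (M0 : manifold R) (f0 : M0 -> 'rV[R]_td_s).

Definition admissible_f0 : Prop :=
  immersion f0 /\ forall p0, Omega td_ftilde td_phitilde (f0 p0 - td_shift).

Definition td_tube (p0 : M0) (p : prod_manifold M) : 'rV[R]_td_dim :=
  partial_tube td_ftilde td_phitilde (fun q => f0 q - td_shift) p0 p.

Definition td_rho (a : 'I_r) (p0 : M0) (pa : M a) : R :=
  if (a < td_k D)%N then (td_R D a)^-1 * dot (f0 p0) (td_es a)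
  else if (a < td_l D)%N then
    1 - dot (arclength_derivative2 (td_f D a) pa)
            (td_phi D a pa (proj_a a (f0 p0)))
  else 1.

End WithF0.
End TubeConstruction.
End Geometry.

Arguments td_f [R r M] _ a _.
Arguments td_E [R r M] _ a _.
Arguments td_phi [R r M] _ a _ _.
Arguments td_iso [R r M] _ _.

(* Main.v *)
(** Direct part: moving the base point along a factor [a] changes the parallel
section [phi y] by [sig *: df_a], where [sig = <y, e_a> / R_a] on a sphere and
[sig = - <f_a'', phi y>] on a curve.  Hence
[df = phi (df_0) + \sum_a (1 + sig) *: df_a], an orthogonal sum, which gives the
metric; the same formula shows that mixed second derivatives are tangent.

Converse: by the Koszul formula, a mixed second derivative [D_u D_v f] with [v]
tangent to the factor [a] is [(D_u rho_a / rho_a) *: D_v f], so that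
[df(v) = lam_a *: dh_a(v)], where [h_a] is the restriction of [f] to a slice and
[lam_a] a function on [M_0 * M_a].  The spans of the tangent spaces of
the [h_a] are mutually orthogonal, and the component of [f] in the [a]-th one is a
family of immersions [X p_0] of [M_a] for which [X p_0 - h_a] is a parallel
normal section with shape operator [(1 - lam_a) I].  If [dim M_a = 1], such
sections span a flat parallel subbundle.  If [dim M_a > 1], then [lam_a] is constant
on [M_a] by the Codazzi equation, so [X p_0] is homothetic to [h_a], and
either [lam_a = 1] or [h_a] lies in a sphere. *)

Require Import Defs.
From mathcomp Require Import all_boot all_order all_algebra perm.
From mathcomp Require Import all_classical all_reals all_analysis.
From mathcomp Require Import ring lra.

Import Order.TTheory GRing.Theory Num.Theory.
Import numFieldNormedType.Exports.
Local Open Scope classical_set_scope.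
Local Open Scope ring_scope.

Set Implicit Arguments.
Unset Strict Implicit.
Unset Printing Implicit Defensive.

(** * Calculus with directional derivatives *)

(** Being [Ck] is a condition on iterated directional derivatives, so additivity in the direction
    and symmetry of second derivatives are drawn from the mean value theorem. A general chain rule
    is avoided: passing to a slice of a product or to a factor is affine in coordinates, a normal
    section with moving parameter is expanded into products of functions of separate variables, and
    charts are changed only on curves.

    Membership in [Omega] says only that [1 + sig] has no zero. The formula for [rho_a] may thus be
    negative; its absolute value is always a warping function, and the formula itself is one when
    positive.

    In the converse everything is normalized at one base point [o]: the slices through [o] yield the
    [f_a], and [lam_a = 1] there. Projecting to the span of the tangent spaces of a slice removes
    all motion orthogonal to it, so that one center of the sphere serves every [p_0]. The kind of a
    factor comes out of the analysis, whence the permutation that puts spheres first and curves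
    next; the centers make up the translation [b]. *)

Section Calculus.
Variable R : realType.

Section Lines.
Variable V : normedModType R.
Implicit Types (x u v : V) (U : set V).

Lemma nbhs_box u v x (A : set V) : nbhs x A ->
  exists2 e : R, 0 < e & forall s t, `|s| <= e -> `|t| <= e ->
    A (s *: u + (t *: v + x)).
Proof.
move=> /nbhs_ballP[d /= d0 sA].
(* The summand [1] keeps the quotient below meaningful when [u] and [v] are both zero. *)
have K0 : 0 < `|u| + `|v| + 1 by rewrite ltr_wpDl // addr_ge0.
exists (d / 2 / (`|u| + `|v| + 1)); first by rewrite divr_gt0 // divr_gt0.
move=> s t sd td; apply: sA; rewrite -ball_normE /ball_ /=.
have -> : x - (s *: u + (t *: v + x)) = - (s *: u + t *: v).
  by rewrite addrA opprD addrCA subrr addr0.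
rewrite normrN.
apply: le_lt_trans (ler_normD _ _) _; rewrite !normrZ.
have : `|s| * `|u| + `|t| * `|v| <= d / 2 / (`|u| + `|v| + 1) * (`|u| + `|v|).
  by rewrite mulrDr lerD // ler_wpM2r.
move=> /le_lt_trans; apply.
apply: (@le_lt_trans _ _ (d / 2)); last by rewrite ltr_pdivrMr // ltr_pMr // ltr1n.
rewrite -mulrA; apply: ler_piMr; first by rewrite divr_ge0 // ltW.
by rewrite mulrC ler_pdivrMr // mul1r lerDl.
Qed.

Lemma is_derive_line (W : normedModType R) (f : V -> W) x v (t : R) df :
  is_derive (t *: v + x) v f df -> is_derive t 1 (fun s : R => f (s *: v + x)) df.
Proof.
move=> [fd <-].
have E : (fun h : R => h^-1 *: (f (h *: v + (t *: v + x)) - f (t *: v + x))) =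
  (fun h : R => h^-1 *: (((fun s : R => f (s *: v + x)) \o shift t) (h *: 1) - f (t *: v + x))).
  by apply/funext => h /=; rewrite [h *: 1]mulr1 scalerDl addrA.
by apply: DeriveDef; [rewrite /derivable -E|rewrite [LHS]/derive -E].
Qed.

Lemma MVT_line (f : V -> R) x v (a : R) : 0 <= a ->
  (forall t, 0 <= t <= a -> derivable f (t *: v + x) v) ->
  exists2 c, 0 <= c <= a & f (a *: v + x) - f x = a * 'D_v f (c *: v + x).
Proof.
move=> a0 fd.
have dl t : 0 <= t <= a ->
    is_derive t 1 (fun s : R => f (s *: v + x)) ('D_v f (t *: v + x)).
  by move=> /fd dt; apply: is_derive_line; exact: derivableP.
have [||c] := @MVT_segment _ (fun s : R => f (s *: v + x)) (fun t => 'D_v f (t *: v + x)) 0 a a0.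
- by move=> t; rewrite in_itv /= => /andP[t0 t1]; apply: dl; rewrite !ltW.
- apply: derivable_within_continuous => t; rewrite in_itv /= => t01.
  by have [] := dl t t01.
rewrite in_itv /= scale0r add0r subr0 => c01 ->.
by exists c => //; rewrite mulrC.
Qed.

End Lines.

(** * Algebra of functions of class C^k *)

Section CkBasic.
Variables (V W : normedModType R).
Implicit Types (f : V -> W) (U : set V).

Lemma Ck_continuous k U f x : Ck k U f -> U x -> {for x, continuous f}.
Proof. by case: k => [|k] [cf _] /cf. Qed.

Lemma Ck_derivable k U f x v : Ck k.+1 U f -> U x -> derivable f x v.
Proof. by move=> [_ /(_ v)[+ _]]; apply. Qed.

Lemma Ck_derive k U f v : Ck k.+1 U f -> Ck k U (fun x => 'D_v f x).
Proof. by move=> [_ /(_ v)[]]. Qed.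

Lemma CkW k U f : Ck k.+1 U f -> Ck k U f.
Proof.
elim: k f => [|k IH] f [cf df]; split=> // v.
by have [d1 d2] := df v; split=> //; exact: IH.
Qed.

Lemma Ck_cst k U (a : W) : Ck k U (fun _ => a).
Proof.
elim: k a => [|k IH] a; split=> //; try by move=> x _; exact: cst_continuous.
move=> v; split; first by move=> x _; exact: derivable_cst.
have -> : (fun x => 'D_v (fun _ : V => a) x) = fun _ => 0; last exact: IH.
by apply/funext => x; exact: derive_cst.
Qed.

Lemma Ck_local k U f : (forall x, U x -> exists2 U', open U' & U' x /\ Ck k U' f) ->
  Ck k U f.
Proof.
elim: k f => [|k IH] f loc; split=> //.
- by move=> x /loc[U' _ [U'x [cf _]]]; exact: cf.
- by move=> x /loc[U' _ [U'x [cf _]]]; exact: cf.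
move=> v; split.
  by move=> x /loc[U' _ [U'x [_ /(_ v)[+ _]]]]; apply.
apply: IH => x /loc[U' oU' [U'x Cf]]; exists U' => //; split=> //.
exact: Ck_derive Cf.
Qed.

End CkBasic.

Section CkScalar.
Variable V : normedModType R.
Implicit Types (f g : V -> R) (U : set V).

Lemma CkD k U f g : open U -> Ck k U f -> Ck k U g -> Ck k U (fun x => f x + g x).
Proof.
move=> oU; elim: k f g => [|k IH] f g [cf df] [cg dg]; split=> //.
- by move=> x Ux; apply: continuousD; [exact: cf|exact: cg].
- by move=> x Ux; apply: continuousD; [exact: cf|exact: cg].
move=> v; have [df1 df2] := df v; have [dg1 dg2] := dg v; split.
  by move=> x Ux; apply: derivableD; [exact: df1|exact: dg1].
apply: eq_Ck (IH _ _ df2 dg2) => // x Ux.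
by rewrite [RHS](deriveD (df1 x Ux) (dg1 x Ux)).
Qed.

Lemma CkM k U f g : open U -> Ck k U f -> Ck k U g -> Ck k U (fun x => f x * g x).
Proof.
move=> oU; elim: k f g => [|k IH] f g Cf Cg.
  case: Cf Cg => cf _ [cg _]; split=> // x Ux.
  by apply: continuousM; [exact: cf|exact: cg].
split.
  move=> x Ux; apply: continuousM.
    exact: Ck_continuous Cf Ux.
  exact: Ck_continuous Cg Ux.
have [_ df] := Cf; have [_ dg] := Cg.
move=> v; have [df1 df2] := df v; have [dg1 dg2] := dg v; split.
  by move=> x Ux; apply: derivableM; [exact: df1|exact: dg1].
apply: eq_Ck (CkD oU (IH _ _ (CkW Cf) dg2) (IH _ _ (CkW Cg) df2)) => // x Ux.
by rewrite [RHS](deriveM (df1 x Ux) (dg1 x Ux)).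
Qed.

Lemma Ck_sum (I : Type) (s : seq I) k U (f : I -> V -> R) : open U ->
  (forall i, Ck k U (f i)) -> Ck k U (fun x => \sum_(i <- s) f i x).
Proof.
move=> oU Cf; elim: s => [|i s IH].
  by under eq_fun do rewrite big_nil; exact: Ck_cst.
by under eq_fun do rewrite big_cons; exact: CkD.
Qed.

Lemma CkN k U f : open U -> Ck k U f -> Ck k U (fun x => - f x).
Proof.
move=> oU Cf; under eq_fun do rewrite -mulN1r.
by apply: CkM => //; exact: Ck_cst.
Qed.

Lemma CkV k U f : open U -> (forall x, U x -> f x != 0) ->
  Ck k U f -> Ck k U (fun x => (f x)^-1).
Proof.
move=> oU f0; elim: k => [|k IH] Cf.
  case: Cf => cf _; split=> // x Ux.
  by apply: continuousV; [exact: f0|exact: cf].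
have CV := IH (CkW Cf); split.
  by move=> x Ux; apply: continuousV; [exact: f0|exact: Ck_continuous Cf Ux].
have [_ df] := Cf => v; have [df1 df2] := df v; split.
  by move=> x Ux; apply: derivableV; [exact: f0|exact: df1].
apply: eq_Ck (CkM oU (CkN oU (CkM oU CV CV)) df2) => // x Ux.
by rewrite [RHS](deriveV (f0 x Ux) (df1 x Ux)) expr2 invfM.
Qed.

(** A continuous function without zeros has locally constant sign, so near each point the absolute
    value is [f] or [- f]. This keeps the warping functions of a tube smooth when their sign is
    dropped. *)
Lemma Ck_norm k U f : open U -> (forall x, U x -> f x != 0) ->
  Ck k U f -> Ck k U (fun x => `|f x|).
Proof.
move=> oU f0 Cf; apply: Ck_local => x Ux.
have [s fs] : exists s : R, nbhs x [set y | `|f y| = s * f y].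
  have cf := Ck_continuous Cf Ux.
  have := f0 x Ux; rewrite neq_lt => /orP[fx|fx].
    exists (-1); have n0 : nbhs (f x) [set z : R | z < 0] by exact: lt_nbhsl.
    have nfx : nbhs x (f @^-1` [set z : R | z < 0]) := cf _ n0.
    by apply: filterS nfx => y /= fy; rewrite mulN1r ltr0_norm.
  exists 1; have n0 : nbhs (f x) [set z : R | 0 < z] by exact: lt_nbhsr.
  have nfx : nbhs x (f @^-1` [set z : R | 0 < z]) := cf _ n0.
  by apply: filterS nfx => y /= fy; rewrite mul1r gtr0_norm.
have oI : open (interior [set y | `|f y| = s * f y] `&` U).
  by apply: openI => //; exact: open_interior.
exists (interior [set y | `|f y| = s * f y] `&` U) => //; split=> //.
apply: (@eq_Ck _ _ _ _ _ (fun y => s * f y)) => //.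
  by move=> y [/nbhs_singleton /= -> _].
apply: CkM => //; first exact: Ck_cst.
by apply: sub_Ck Cf => y [].
Qed.

End CkScalar.


(** * Additivity in the direction and symmetry of second derivatives *)

Section Scalar.
Variable V : normedModType R.
Implicit Types (f : V -> R) (U : set V).

(* Unlike for Frechet derivatives, additivity in the direction needs the
   continuity of ['D_u f]: the increment is split along [v] and then [u]. *)
Lemma derive_dirD U f x u v : open U -> U x -> Ck 1 U f ->
  is_derive x (u + v) f ('D_u f x + 'D_v f x).
Proof.
move=> oU Ux Cf.
suff L : (fun h : R => h^-1 *: (f (h *: (u + v) + x) - f x)) @ 0^' -->
    'D_u f x + 'D_v f x.
  apply: DeriveDef; last exact: cvg_lim L.
  by apply/cvg_ex; exists ('D_u f x + 'D_v f x); exact: L.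
have E : (fun h : R => h^-1 *: (f (h *: (u + v) + x) - f x)) =
  (fun h : R => h^-1 *: (f (h *: u + (h *: v + x)) - f (h *: v + x))) +
  (fun h : R => h^-1 *: (f (h *: v + x) - f x)).
  apply/funext => h; rewrite [RHS]/GRing.add /= -scalerDr subrKA.
  by rewrite addrA -[h *: u + h *: v]scalerDr.
have dv : (fun h : R => h^-1 *: (f (h *: v + x) - f x)) @ 0^' --> 'D_v f x.
  exact: (Ck_derivable (v := v) Cf Ux).
rewrite E; apply: cvgD dv.
apply/cvgrPdist_le => e e0.
have cD : {for x, continuous (fun y => 'D_u f y)}.
  exact: Ck_continuous (Ck_derive u Cf) Ux.
have nA : nbhs x (U `&` [set y | `|'D_u f x - 'D_u f y| <= e]).
  apply: filterI; first exact: open_nbhs_nbhs.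
  by move/cvgrPdist_le: cD; apply.
have [d d0 box] := nbhs_box u v nA.
near=> h.
have hd : `|h| <= d.
  by near: h; exact: dnbhs0_le.
have h0 : h != 0 by near: h; exact: nbhs_dnbhs_neq.
(* [MVT_line] takes nonnegative increments; for [h < 0] it is applied from the other endpoint and
   the intermediate point is shifted back. *)
have [c [cd ->]] : exists c, `|c| <= d /\
  f (h *: u + (h *: v + x)) - f (h *: v + x) = h * 'D_u f (c *: u + (h *: v + x)).
  have [h_ge0|h_lt0] := leP 0 h.
    have [||c /andP[c0 ch] E'] := @MVT_line V f (h *: v + x) u h.
    - by [].
    - move=> t /andP[t0 th]; apply: Ck_derivable Cf _.
      apply: (box t h _ hd).1; apply: le_trans hd; rewrite !ger0_norm //.
    exists c; split=> //; apply: le_trans hd; rewrite !ger0_norm //.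
  have [||c /andP[c0 ch] E'] := @MVT_line V f (h *: u + (h *: v + x)) u (- h).
  - by rewrite oppr_ge0 ltW.
  - move=> t /andP[t0 th]; apply: Ck_derivable Cf _; rewrite addrA -scalerDl.
    apply: (box (t + h) h _ hd).1; apply: le_trans hd.
    by rewrite ler0_norm ?(ltr0_norm h_lt0) //; lra.
  exists (c + h); split.
    apply: le_trans hd.
    by rewrite ler0_norm ?(ltr0_norm h_lt0) //; lra.
  have E1 k y : k *: u + (h *: u + y) = (k + h) *: u + y by rewrite addrA -scalerDl.
  by move: E'; rewrite !E1 addNr scale0r add0r => E'; rewrite -opprB E' mulNr opprK.
by rewrite [_ *: _]mulKf //; exact: (box c h cd hd).2.
Unshelve. all: by end_near. Qed.

(** The second difference over the parallelogram with sides [h *: u] and [h *: v] is the increment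
    along [v] of [y |-> f (h *: u + y) - f y]. The mean value theorem applies to this function along
    [v], then to ['D_v f] along [u]. *)
Lemma increment2 U f x u v (h : R) : 0 <= h ->
  (forall s t, 0 <= s <= h -> 0 <= t <= h -> U (s *: u + (t *: v + x))) ->
  Ck 2 U f -> exists s t, [/\ 0 <= s <= h, 0 <= t <= h &
    f (h *: u + (h *: v + x)) - f (h *: u + x) - (f (h *: v + x) - f x) =
    h * (h * 'D_u (fun y => 'D_v f y) (s *: u + (t *: v + x)))].
Proof.
move=> h0 sU Cf.
have S0 : 0 <= (0 : R) <= h by rewrite lexx h0.
have Sh : 0 <= h <= h by rewrite h0 lexx.
have Uu s t : 0 <= s <= h -> 0 <= t <= h -> U (t *: v + (s *: u + x)).
  by move=> s1 t1; rewrite addrCA; exact: sU.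
pose g y := f (h *: u + y) - f y.
have dg y : U y -> U (h *: u + y) ->
    is_derive y v g ('D_v f (h *: u + y) - 'D_v f y).
  move=> Uy Uhy; apply: is_deriveB; last first.
    by apply: derivableP; exact: Ck_derivable Cf Uy.
  have := Ck_derivable (v := v) Cf Uhy.
  have E : (fun k : R => k^-1 *: (f (k *: v + (h *: u + y)) - f (h *: u + y))) =
    (fun k : R => k^-1 *: (f (h *: u + (k *: v + y)) - f (h *: u + y))).
    by apply/funext => k; rewrite addrCA.
  by move=> dE; apply: DeriveDef; [rewrite /derivable -E|rewrite /derive -E].
have dl t : 0 <= t <= h -> is_derive (t *: v + x) v g
    ('D_v f (h *: u + (t *: v + x)) - 'D_v f (t *: v + x)).
  move=> th; apply: dg; last exact: sU.
  by rewrite -[t *: v + x]add0r -(scale0r u); exact: sU.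
have [t th Et] : exists2 t, 0 <= t <= h & g (h *: v + x) - g x =
    h * 'D_v g (t *: v + x).
  by apply: (@MVT_line V g x v h h0) => t th; have [] := dl t th.
have [s sh Es] : exists2 s, 0 <= s <= h &
    'D_v f (h *: u + (t *: v + x)) - 'D_v f (t *: v + x) =
    h * 'D_u (fun y => 'D_v f y) (s *: u + (t *: v + x)).
  apply: (@MVT_line V (fun y => 'D_v f y) (t *: v + x) u h h0) => s sh.
  by apply: (Ck_derivable (Ck_derive v Cf)); exact: sU.
exists s, t; split=> //.
rewrite -Es; have [_ <-] := dl t th; rewrite -Et /g.
ring.
Qed.

Lemma dist_le_half (a b c e : R) :
  `|a - c| <= e / 2 -> `|b - c| <= e / 2 -> `|a - b| <= e.
Proof.
move=> ac bc; rewrite -(subrKA c) (splitr e); apply: le_trans (ler_normD _ _) _.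
by rewrite lerD // distrC.
Qed.

(** The second difference of [increment2] is symmetric in [u] and [v], so one iterated derivative at
    some point near [x] equals the other one at a second such point. Continuity moves both to [x] up
    to an arbitrary [e]. *)
Lemma derive_sym U f x u v : open U -> U x -> Ck 2 U f ->
  'D_u (fun y => 'D_v f y) x = 'D_v (fun y => 'D_u f y) x.
Proof.
move=> oU Ux Cf.
have cD w w' : {for x, continuous (fun y => 'D_w (fun z => 'D_w' f z) y)}.
  exact: Ck_continuous (Ck_derive w (Ck_derive w' Cf)) Ux.
apply/eqP; rewrite -subr_eq0 -normr_eq0; apply/eqP/le_anti/andP; split=> //.
apply/ler_addgt0Pl => e e0; rewrite addr0; have e20 : 0 < e / 2 by rewrite divr_gt0.
have nA : nbhs x (U `&` ([set y | `|'D_u (fun y => 'D_v f y) x -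
      'D_u (fun y => 'D_v f y) y| <= e / 2] `&`
    [set y | `|'D_v (fun y => 'D_u f y) x - 'D_v (fun y => 'D_u f y) y| <= e / 2])).
  apply: filterI; first exact: open_nbhs_nbhs.
  by apply: filterI; [move/cvgrPdist_le: (cD u v); apply|move/cvgrPdist_le: (cD v u); apply].
have [d d0 box] := nbhs_box u v nA.
have nd t : 0 <= t <= d -> `|t| <= d by move=> /andP[t0 td]; rewrite ger0_norm.
have [|s [t [sd td E1]]] := @increment2 U f x u v d (ltW d0) _ Cf.
  by move=> s t /nd sd /nd td; have [] := box s t sd td.
have [|s' [t' [sd' td' E2]]] := @increment2 U f x v u d (ltW d0) _ Cf.
  by move=> s' t' /nd sd' /nd td'; rewrite addrCA; have [] := box t' s' td' sd'.
have E3 : 'D_u (fun y => 'D_v f y) (s *: u + (t *: v + x)) =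
  'D_v (fun y => 'D_u f y) (s' *: v + (t' *: u + x)).
  apply: (mulfI (lt0r_neq0 d0)); apply: (mulfI (lt0r_neq0 d0)).
  apply: etrans (esym E1) _; apply: etrans _ E2.
  by rewrite (addrCA (d *: v)) !opprB addrACA [RHS]addrACA (addrC (- f (d *: u + x))).
have [_ [+ _]] := box s t (nd _ sd) (nd _ td).
have [_ [_ +]] := box t' s' (nd _ td') (nd _ sd').
rewrite /= (addrCA (t' *: u)) -E3 => H2 H1.
exact: dist_le_half H1 H2.
Qed.

End Scalar.

(** * Derivatives of matrix-valued maps *)

Section Matrix.
Variable V : normedModType R.

Lemma is_derive_mxP m n (F : V -> 'M[R]_(m, n)) x v dF :
  is_derive x v F dF <-> forall i j, is_derive x v (fun y => F y i j) (dF i j).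
Proof.
split=> [[dx <-] i j|H].
  apply: DeriveDef; first by move/derivable_mxP: dx.
  by rewrite (derive_mx dx) mxE.
have dx : derivable F x v by apply/derivable_mxP => i j; have [] := H i j.
apply: DeriveDef => //; apply/matrixP => i j; rewrite (derive_mx dx) mxE.
by have [] := H i j.
Qed.

Lemma is_derive_bigsum (W : normedModType R) (I : Type) (s : seq I)
    (f : I -> V -> W) (df : I -> W) x v :
  (forall i, is_derive x v (f i) (df i)) ->
  is_derive x v (fun y => \sum_(i <- s) f i y) (\sum_(i <- s) df i).
Proof.
move=> H; elim: s => [|i s IH].
  rewrite big_nil; under eq_fun do rewrite big_nil; exact: is_derive_cst.
rewrite big_cons; under eq_fun do rewrite big_cons.
exact: is_deriveD.
Qed.

Lemma is_derive_mul (f g : V -> R) x v df dg :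
  is_derive x v f df -> is_derive x v g dg ->
  is_derive x v (fun y => f y * g y) (df * g x + f x * dg).
Proof.
move=> [hf <-] [hg <-]; apply: DeriveDef; first exact: derivableM hf hg.
rewrite [LHS](deriveM hf hg) addrC; congr (_ + _); exact: mulrC.
Qed.

Lemma is_derive_scale m n (k : V -> R) (F : V -> 'M[R]_(m, n)) x v dk dF :
  is_derive x v k dk -> is_derive x v F dF ->
  is_derive x v (fun y => k y *: F y) (dk *: F x + k x *: dF).
Proof.
move=> hk /is_derive_mxP hF; apply/is_derive_mxP => i j.
under eq_fun do rewrite mxE.
by rewrite !mxE; exact: is_derive_mul.
Qed.

Lemma is_derive_mulmx m n p (F : V -> 'M[R]_(m, n)) (A : 'M[R]_(n, p)) x v dF :
  is_derive x v F dF -> is_derive x v (fun y => F y *m A) (dF *m A).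
Proof.
move=> /is_derive_mxP hF; apply/is_derive_mxP => i j; rewrite mxE.
under eq_fun do rewrite mxE.
apply: is_derive_bigsum => k.
have hc : is_derive x v (fun _ : V => A k j) 0 by exact: is_derive_cst.
by have := is_derive_mul (hF i k) hc; rewrite mulr0 addr0.
Qed.

Lemma dotE n (a b : 'rV[R]_n) : dot a b = \sum_i a 0 i * b 0 i.
Proof. by rewrite /dot mxE; under eq_bigr do rewrite mxE. Qed.

Lemma is_derive_dot n (F G : V -> 'rV[R]_n) x v dF dG :
  is_derive x v F dF -> is_derive x v G dG ->
  is_derive x v (fun y => dot (F y) (G y)) (dot dF (G x) + dot (F x) dG).
Proof.
move=> /is_derive_mxP hF /is_derive_mxP hG.
under eq_fun do rewrite dotE.
rewrite !dotE -big_split; apply: is_derive_bigsum => i.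
exact: is_derive_mul.
Qed.

Lemma derive_mxE m n k U (F : V -> 'M[R]_(m, n)) x v i j : Ck k.+1 U F -> U x ->
  'D_v F x i j = 'D_v (fun y => F y i j) x.
Proof. by move=> CF Ux; rewrite (derive_mx (Ck_derivable (v := v) CF Ux)) mxE. Qed.

Lemma is_derive_dirD m n U (F : V -> 'M[R]_(m, n)) x u v : open U -> U x -> Ck 1 U F ->
  is_derive x (u + v) F ('D_u F x + 'D_v F x).
Proof.
move=> oU Ux CF; apply/is_derive_mxP => i j; rewrite mxE !(derive_mxE _ _ _ CF) //.
exact: derive_dirD (Ck_coord i j oU CF).
Qed.

Lemma derive_mx_sym m n U (F : V -> 'M[R]_(m, n)) x u v : open U -> U x -> Ck 2 U F ->
  'D_u (fun y => 'D_v F y) x = 'D_v (fun y => 'D_u F y) x.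
Proof.
move=> oU Ux CF; apply/matrixP => i j.
have CD w : Ck 1 U (fun y => 'D_w F y) by exact: Ck_derive CF.
apply: etrans (derive_mxE u i j (CD v) Ux) _.
apply: etrans _ (esym (derive_mxE v i j (CD u) Ux)).
have E w w' : 'D_w (fun y => 'D_w' F y i j) x =
    'D_w (fun y => 'D_w' (fun z => F z i j) y) x.
  apply: near_eq_derive; apply: filterS (open_nbhs_nbhs (conj oU Ux)) => y Uy.
  exact: derive_mxE CF Uy.
by rewrite !E; exact: derive_sym (Ck_coord i j oU CF).
Qed.

Lemma CkDmx m n k U (F G : V -> 'M[R]_(m, n)) : open U -> Ck k U F -> Ck k U G ->
  Ck k U (fun x => F x + G x).
Proof.
move=> oU CF CG; apply: Ck_mx => // i j.
under eq_fun do rewrite mxE.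
by apply: CkD => //; exact: Ck_coord.
Qed.

Lemma Ck_scale m n k U (c : V -> R) (F : V -> 'M[R]_(m, n)) : open U ->
  Ck k U c -> Ck k U F -> Ck k U (fun x => c x *: F x).
Proof.
move=> oU Cc CF; apply: Ck_mx => // i j.
under eq_fun do rewrite mxE.
by apply: CkM => //; exact: Ck_coord.
Qed.

Lemma Ck_mulmx m n p k U (F : V -> 'M[R]_(m, n)) (A : 'M[R]_(n, p)) : open U ->
  Ck k U F -> Ck k U (fun x => F x *m A).
Proof.
move=> oU CF; apply: Ck_mx => // i j.
under eq_fun do rewrite mxE.
apply: Ck_sum => // l; apply: CkM => //; first exact: Ck_coord.
exact: Ck_cst.
Qed.

Lemma Ck_dot n k U (F G : V -> 'rV[R]_n) : open U -> Ck k U F -> Ck k U G ->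
  Ck k U (fun x => dot (F x) (G x)).
Proof.
move=> oU CF CG; under eq_fun do rewrite dotE.
by apply: Ck_sum => // i; apply: CkM => //; exact: Ck_coord.
Qed.

Lemma derive0_near m n U (F : V -> 'M[R]_(m, n)) x : open U -> U x ->
  (forall y v, U y -> is_derive y v F 0) -> \forall y \near x, F y = F x.
Proof.
move=> oU Ux dF.
have /nbhs_ballP[e /= e0 sU] := open_nbhs_nbhs (conj oU Ux).
apply/nbhs_ballP; exists e => // y xy; apply/matrixP => i j.
have [||c c01] := @MVT_line V (fun z => F z i j) x (y - x) 1.
- by [].
- move=> t /andP[t0 t1].
  have /is_derive_mxP/(_ i j)[] // : is_derive (t *: (y - x) + x) (y - x) F 0.
  apply: dF; apply: sU; rewrite -ball_normE /ball_ /= opprD addrCA subrr addr0 normrN normrZ.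
  rewrite ger0_norm //; move: xy; rewrite -ball_normE /ball_ /= distrC.
  by apply: le_lt_trans; rewrite ler_piMl.
rewrite scale1r subrK mul1r => /eqP.
have /is_derive_mxP/(_ i j)[_ ->] : is_derive (c *: (y - x) + x) (y - x) F 0.
  have /andP[t0 t1] := c01.
  apply: dF; apply: sU; rewrite -ball_normE /ball_ /= opprD addrCA subrr addr0 normrN normrZ.
  rewrite ger0_norm //; move: xy; rewrite -ball_normE /ball_ /= distrC.
  by apply: le_lt_trans; rewrite ler_piMl.
by rewrite mxE subr_eq0 => /eqP.
Qed.

End Matrix.

(** * Composition with affine maps and with functions of one variable *)

Section Affine.
Variables (V V' W : normedModType R) (P L : V -> V').
Hypothesis affP : forall (h : R) u x, P (h *: u + x) = h *: L u + P x.

(** The difference quotient of [g \o P] at [x] along [u] is literally that of [g] at [P x] along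
    [L u]. With [P] inserting or extracting a block of coordinates, this is the chain rule used on
    products. *)
Lemma is_derive_affine (g : V' -> W) x u dg :
  is_derive (P x) (L u) g dg -> is_derive x u (g \o P) dg.
Proof.
move=> [dd <-].
have E : (fun h : R => h^-1 *: (((g \o P) \o shift x) (h *: u) - (g \o P) x)) =
  (fun h : R => h^-1 *: ((g \o shift (P x)) (h *: L u) - g (P x))).
  by apply/funext => h; rewrite /= affP.
by apply: DeriveDef; [rewrite /derivable E|rewrite /derive E].
Qed.

Lemma derive_affine (g : V' -> W) x u : 'D_u (g \o P) x = 'D_(L u) g (P x).
Proof.
have E : (fun h : R => h^-1 *: (((g \o P) \o shift x) (h *: u) - (g \o P) x)) =
  (fun h : R => h^-1 *: ((g \o shift (P x)) (h *: L u) - g (P x))).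
  by apply/funext => h; rewrite /= affP.
by rewrite /derive E.
Qed.

Lemma Ck_comp_affine k U (g : V' -> W) : continuous P -> Ck k U g ->
  Ck k (P @^-1` U) (g \o P).
Proof.
move=> cP; elim: k g => [|k IH] g [cg dg]; split=> //.
- by move=> x Ux; apply: continuous_comp; [exact: cP|exact: cg].
- by move=> x Ux; apply: continuous_comp; [exact: cP|exact: cg].
move=> v; have [dgv Cg] := dg (L v); split.
  by move=> x Ux; have [] := is_derive_affine (derivableP (dgv _ Ux)).
have -> : (fun x => 'D_v (g \o P) x) = (fun y => 'D_(L v) g y) \o P.
  by apply/funext => x; exact: derive_affine.
exact: IH.
Qed.

End Affine.

Section Composition.
Variables (V W : normedModType R).

Lemma is_derive_line0 (f : V -> W) x v df :
  is_derive (0 : R) 1 (fun t : R => f (t *: v + x)) df <-> is_derive x v f df.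
Proof.
split=> [[d <-]|d]; last by apply: is_derive_line; rewrite scale0r add0r.
have E : (fun h : R => h^-1 *: ((f \o shift x) (h *: v) - f x)) =
  (fun h : R => h^-1 *: (((fun t : R => f (t *: v + x)) \o shift 0) (h *: 1) -
    f (0 *: v + x))).
  by apply/funext => h /=; rewrite scale0r add0r addr0 [h *: 1]mulr1.
by apply: DeriveDef; [rewrite /derivable E|rewrite [LHS]/derive E].
Qed.

(** On the line through [x] the map is a function of one real variable, where derivability is
    differentiability; linearity of its differential gives the factor [k]. *)
Lemma is_derive_dirZ (f : V -> W) x v k df :
  is_derive x v f df -> is_derive x (k *: v) f (k *: df).
Proof.
move=> /is_derive_line0[/derivable1_diffP dl El]; apply/is_derive_line0.
pose l t := f (t *: v + x).
have -> : (fun t : R => f (t *: (k *: v) + x)) = l \o (fun t => t * k).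
  by apply/funext => t; rewrite /l /= scalerA.
apply: (@is_derive_affine R R W (fun t => t * k) (fun t => t * k)) => [h u y|].
  by rewrite mulrDl -[_ *: (u * k)]/(h * (u * k)) mulrA.
rewrite mul0r mul1r; apply: DeriveDef; first exact: diff_derivable.
rewrite deriveE // -[k in LHS]mulr1 -[k * 1]/(k *: 1) linearZ /=; congr (_ *: _).
by rewrite -El deriveE.
Qed.

End Composition.

Section ScalarComposition.
Variables (V : normedModType R).

Lemma is_derive_comp1 (f : V -> R) (g : R -> R) x v df dg :
  is_derive x v f df -> is_derive (f x) 1 g dg -> is_derive x v (g \o f) (dg * df).
Proof.
move=> /is_derive_line0[d1 <-]; rewrite -{1}[x]add0r -(scale0r v) => -[d2 <-].
apply/is_derive_line0; apply: DeriveDef; last first.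
  by have := derive1_comp d1 d2; rewrite !derive1E.
apply/derivable1_diffP; move: d1 d2 => /derivable1_diffP d1 /derivable1_diffP d2.
exact: differentiable_comp d1 d2.
Qed.

(** When the middle space is a line, every direction is a multiple of [const_mx 1] and [f] becomes a
    function of a single coordinate. This serves to change charts on curves. *)
Lemma is_derive_comp_dim1 n (f : 'rV[R]_n -> R) (g : V -> 'rV[R]_n) x v dg :
  n = 1%N -> (forall w, derivable f (g x) w) -> is_derive x v g dg ->
  is_derive x v (f \o g) ('D_dg f (g x)).
Proof.
move=> n1; subst n => df hg.
have E (y : 'rV[R]_1) : y = y 0 0 *: const_mx 1.
  by apply/matrixP => i j; rewrite !ord1 !mxE mulr1.
have hc : is_derive x v (fun y => g y 0 0) (dg 0 0).
  by move/is_derive_mxP: hg.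
have -> : f \o g = (fun t : R => f (t *: const_mx 1 + 0)) \o (fun y => g y 0 0).
  by apply/funext => y; rewrite /= addr0 -E.
have -> : 'D_dg f (g x) = 'D_(const_mx 1) f (g x) * dg 0 0.
  rewrite {1}(E dg) mulrC.
  by have [_ ->] := is_derive_dirZ (dg 0 0) (derivableP (df (const_mx 1))).
apply: is_derive_comp1 hc _; apply: is_derive_line.
rewrite addr0 -E; exact: derivableP.
Qed.

End ScalarComposition.

End Calculus.

(** * Inner products and orthonormal bases *)

Section Dot.
Variable R : realType.

Lemma dotC n (u v : 'rV[R]_n) : dot u v = dot v u.
Proof. by rewrite !dotE; apply: eq_bigr => i _; rewrite mulrC. Qed.

Lemma dotDl n (u v w : 'rV[R]_n) : dot (u + v) w = dot u w + dot v w.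
Proof. by rewrite /dot mulmxDl mxE. Qed.

Lemma dotDr n (u v w : 'rV[R]_n) : dot w (u + v) = dot w u + dot w v.
Proof. by rewrite dotC dotDl !(dotC w). Qed.

Lemma dotZl n a (u v : 'rV[R]_n) : dot (a *: u) v = a * dot u v.
Proof. by rewrite /dot -scalemxAl mxE. Qed.

Lemma dotZr n a (u v : 'rV[R]_n) : dot u (a *: v) = a * dot u v.
Proof. by rewrite dotC dotZl dotC. Qed.

Lemma dotNl n (u v : 'rV[R]_n) : dot (- u) v = - dot u v.
Proof. by rewrite -scaleN1r dotZl mulN1r. Qed.

Lemma dotBl n (u v w : 'rV[R]_n) : dot (u - v) w = dot u w - dot v w.
Proof. by rewrite dotDl dotNl. Qed.

Lemma dot0l n (u : 'rV[R]_n) : dot 0 u = 0.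
Proof. by rewrite /dot mul0mx mxE. Qed.

Lemma dot0r n (u : 'rV[R]_n) : dot u 0 = 0.
Proof. by rewrite dotC dot0l. Qed.

Lemma dot_suml n I (s : seq I) (P : pred I) (F : I -> 'rV[R]_n) u :
  dot (\sum_(i <- s | P i) F i) u = \sum_(i <- s | P i) dot (F i) u.
Proof. by rewrite /dot mulmx_suml summxE. Qed.

Lemma dot_sumr n I (s : seq I) (P : pred I) (F : I -> 'rV[R]_n) u :
  dot u (\sum_(i <- s | P i) F i) = \sum_(i <- s | P i) dot u (F i).
Proof. by rewrite dotC dot_suml; under eq_bigr do rewrite dotC. Qed.

Lemma dot_mulmxl m n (u : 'rV[R]_m) (A : 'M[R]_(m, n)) v :
  dot (u *m A) v = dot u (v *m A^T).
Proof. by rewrite /dot trmx_mul trmxK mulmxA. Qed.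

Lemma dot_mulmxr m n (u : 'rV[R]_m) (A : 'M[R]_(m, n)) v :
  dot v (u *m A) = dot (v *m A^T) u.
Proof. by rewrite dotC dot_mulmxl dotC. Qed.

Lemma dot_ge0 n (u : 'rV[R]_n) : 0 <= dot u u.
Proof. by rewrite dotE sumr_ge0 // => i _; rewrite -expr2 sqr_ge0. Qed.

Lemma dot_eq0 n (u : 'rV[R]_n) : (dot u u == 0) = (u == 0).
Proof.
apply/eqP/eqP => [|->]; last exact: dot0l.
rewrite dotE => /psumr_eq0P u0; apply/rowP => i; rewrite mxE.
apply/eqP; rewrite -sqrf_eq0 expr2; apply/eqP/u0 => // j _.
by rewrite -expr2 sqr_ge0.
Qed.

Lemma dot_gt0 n (u : 'rV[R]_n) : u != 0 -> 0 < dot u u.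
Proof. by move=> u0; rewrite lt_def dot_eq0 u0 dot_ge0. Qed.

Lemma dot_row_mx m n (a c : 'rV[R]_m) (b d : 'rV[R]_n) :
  dot (row_mx a b) (row_mx c d) = dot a c + dot b d.
Proof. by rewrite /dot tr_row_mx mul_row_col mxE. Qed.

Lemma dot_mxrow r (n : 'I_r -> nat) (F G : forall i, 'rV[R]_(n i)) :
  dot (\mxrow_i F i) (\mxrow_i G i) = \sum_i dot (F i) (G i).
Proof. by rewrite /dot tr_mxrow mul_mxrow_mxcol summxE. Qed.

Lemma linear_mulmx m n (L : 'rV[R]_m -> 'rV[R]_n) u : linear L ->
  L u = u *m \matrix_i L (delta_mx 0 i).
Proof.
move=> lL; have L0 : L 0 = 0.
  by have := lL (-1) 0 0; rewrite scaler0 addr0 scaleN1r addNr.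
rewrite mulmx_sum_row {1}(row_sum_delta u).
elim/big_ind2: _ => [//|x1 x2 y1 y2 <- <-|i _].
  by have := lL 1 x2 y2; rewrite !scale1r.
by rewrite rowK -[in LHS](addr0 (_ *: _)) lL L0 addr0.
Qed.

(** [u *m (A *m A^T) = 0] forces [dot (u *m A) (u *m A) = 0]. For a Jacobian of full rank this is
    invertibility of the Gram matrix. *)
Lemma mulmx_tr_unit m n (A : 'M[R]_(m, n)) :
  (forall u : 'rV[R]_m, u *m A = 0 -> u = 0) -> A *m A^T \in unitmx.
Proof.
move=> A0; rewrite -row_free_unit; apply: inj_row_free => u uA.
apply: A0; apply/eqP; rewrite -dot_eq0 dot_mulmxl -mulmxA uA dot0r //.
Qed.

(* Gram-Schmidt in disguise: an orthonormal family in [S] of maximal length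
   spans [S]. *)
Lemma subspace_onb N (S : set 'rV[R]_N) : S 0 ->
  (forall a u v, S u -> S v -> S (a *: u + v)) ->
  exists n (B : 'M[R]_(n, N)), B *m B^T = 1%:M /\
    forall u, S u <-> u = u *m B^T *m B.
Proof.
move=> S0 SD.
pose P n := `[< exists B : 'M[R]_(n, N), B *m B^T = 1%:M /\
  forall u, S (u *m B) >].
have P0 : exists n, P n.
  exists 0%N; apply/asboolP; exists 0; split; first by rewrite !flatmx0.
  by move=> u; rewrite mulmx0.
have Pb n : P n -> (n <= N)%N.
  move=> /asboolP[B [B1 _]].
  rewrite -(mxrank1 R n) -B1; apply: leq_trans (mxrankM_maxl _ _) _.
  exact: rank_leq_col.
have [n /asboolP[B [B1 SB]] maxn] := ex_maxnP P0 Pb.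
exists n, B; split=> // u; split=> [Su|->]; last exact: SB.
apply/eqP/negPn/negP => uB; pose w := u - u *m B^T *m B.
have wB : w *m B^T = 0.
  by rewrite /w mulmxBl -(mulmxA _ B) B1 mulmx1 subrr.
have w0 : 0 < dot w w by rewrite dot_gt0 // subr_eq0.
have Sw : S w.
  by have := SD 1 u _ Su (SB (- (u *m B^T))); rewrite scale1r mulNmx.
pose e := (Num.sqrt (dot w w))^-1 *: w.
have ee : dot e e = 1.
  rewrite dotZl dotZr mulrA -expr2 exprVn sqr_sqrtr ?ltW // mulVf //.
  by rewrite gt_eqF.
(* Stacking the normalized residual [e] on [B] gives a longer orthonormal family in [S], against
   maximality. *)
suff : P (1 + n)%N by move=> /maxn; rewrite ltnn.
apply/asboolP; exists (col_mx e B); split.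
  rewrite tr_col_mx mul_col_row B1.
  have eB : e *m B^T = 0 by rewrite /e -scalemxAl wB scaler0.
  have -> : B *m e^T = 0 by rewrite -[B]trmxK -trmx_mul eB trmx0.
  have -> : e *m e^T = 1%:M.
    by apply/matrixP => i j; rewrite !ord1 -[LHS]/(dot e e) ee mxE.
  by rewrite eB -scalar_mx_block.
move=> x; rewrite -[x]hsubmxK mul_row_col.
rewrite [lsubmx x]mx11_scalar mul_scalar_mx; apply: (SD _ e) => //.
by rewrite /e -[_ *: w]addr0; apply: SD.
Qed.

End Dot.

(** * Maps on manifolds *)

Section Manifolds.
Variables (R : realType) (M : manifold R).
Implicit Types (c d : mindex M) (p q : M).

Lemma msmoothP (W : normedModType R) (F : M -> W) :
  msmooth F <-> forall c, smooth_on (cimg (mchart c)) (F \o cpar (mchart c)).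
Proof.
have E c : cimg (mchart c) `&` [set y | [set: M] (cpar (mchart c) y)] = cimg (mchart c).
  by apply/seteqP; split=> y // [].
by split=> H c; have := H c; rewrite E.
Qed.

Lemma mdiffP (W : normedModType R) (F : M -> W) c p v : msmooth F ->
  cdom (mchart c) p ->
  is_derive (ccoord (mchart c) p) v (F \o cpar (mchart c)) (mdiff c F p v).
Proof.
move=> /msmoothP/(_ c 1%N) sF cp; apply: derivableP.
exact: (Ck_derivable sF (ccoord_img cp)).
Qed.

Lemma derive_linear m n (V : normedModType R) (U : set V) (F : V -> 'M[R]_(m, n)) x :
  open U -> U x -> Ck 1 U F -> linear (fun v => 'D_v F x).
Proof.
move=> oU Ux CF a u v.
have [_ ->] := is_derive_dirD (a *: u) v oU Ux CF.
by have [_ ->] := is_derive_dirZ a (derivableP (Ck_derivable (v := u) CF Ux)).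
Qed.

Lemma mdiff_linear m n (F : M -> 'M[R]_(m, n)) c p : msmooth F ->
  cdom (mchart c) p -> linear (mdiff c F p).
Proof.
move=> /msmoothP/(_ c 1%N) CF cp.
exact: (derive_linear (@cimg_open _ _ _ (mchart c)) (ccoord_img cp) CF).
Qed.

Lemma mdiff_jac N (h : M -> 'rV[R]_N) c p v : msmooth h ->
  cdom (mchart c) p -> mdiff c h p v = v *m jac h c p.
Proof. by move=> sh cp; exact: (linear_mulmx v (mdiff_linear sh cp)). Qed.

Lemma mdiff_cst (W : normedModType R) (w : W) c p v : mdiff c (fun _ => w) p v = 0.
Proof. exact: derive_cst. Qed.

Lemma mdiff_dot N (F G : M -> 'rV[R]_N) c p v : msmooth F -> msmooth G ->
  cdom (mchart c) p ->
  is_derive (ccoord (mchart c) p) v ((fun q => dot (F q) (G q)) \o cpar (mchart c))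
    (dot (mdiff c F p v) (G p) + dot (F p) (mdiff c G p v)).
Proof.
move=> sF sG cp; apply: is_derive_eq.
  exact: (is_derive_dot (mdiffP v sF cp) (mdiffP v sG cp)).
by rewrite /= ccoordK.
Qed.

Lemma mdiff2P N (F : M -> 'rV[R]_N) c p v w : msmooth F -> cdom (mchart c) p ->
  is_derive (ccoord (mchart c) p) v
    (fun y => 'D_w (F \o cpar (mchart c)) y) (mdiff2 c F p v w).
Proof.
move=> /msmoothP/(_ c 2%N) sF cp; apply: derivableP.
exact: (Ck_derivable (Ck_derive w sF) (ccoord_img cp)).
Qed.

(** Vanishing derivatives make [F] locally constant, so the set where [F] equals [F p] is nonempty,
    open and closed. *)
Lemma mconst m n (F : M -> 'M[R]_(m, n)) : connected [set: M] ->
  (forall c y, cimg (mchart c) y -> forall u, is_derive y u (F \o cpar (mchart c)) 0) ->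
  forall p q, F p = F q.
Proof.
move=> cM dF p q.
have loc a : \forall b \near a, F b = F a.
  have ca := mchart_atP a; set c := mchart (mchart_at a) in ca.
  have := derive0_near (@cimg_open _ _ _ c) (ccoord_img ca)
    (fun y u cy => dF (mchart_at a) y cy u).
  move=> /(ccoord_continuous ca) /= nF.
  have na : nbhs a (cdom c) by apply: open_nbhs_nbhs; split; [exact: cdom_open|].
  have na' : nbhs a (cdom c `&` (ccoord c @^-1`
     [set y | (F \o cpar c) y = (F \o cpar c) (ccoord c a)])) by exact: filterI na nF.
  by apply: filterS na' => b [cb] /=; rewrite !ccoordK.
have : [set b | F b = F p] = [set: M].
  apply: cM; first by exists p.
    exists [set b | F b = F p]; last by rewrite setTI.
    by rewrite openE => a /= ap; apply: filterS (loc a) => b /= ->.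
  exists [set b | F b = F p]; last by rewrite setTI.
  rewrite -[X in closed X]setCK; apply: open_closedC; rewrite openE => a /= ap.
  by apply: filterS (loc a) => b E bp; apply: ap; rewrite -E.
by move=> /seteqP[_ /(_ q Logic.I)] /= ->.
Qed.

Section Immersed.
Variables (N : nat) (h : M -> 'rV[R]_N).
Hypothesis imm : immersion h.
Let sh : msmooth h := imm.1.

Lemma gram_unit c p : cdom (mchart c) p -> gram h c p \in unitmx.
Proof.
have [_ inj] := imm => cp; apply: mulmx_tr_unit => u; rewrite -mdiff_jac //.
exact: inj.
Qed.

Lemma normal_part_mdiff c p v : cdom (mchart c) p ->
  normal_part h c p (mdiff c h p v) = 0.
Proof.
move=> cp; rewrite /normal_part mdiff_jac //.
by rewrite -(mulmxA v) -/(gram h c p) mulmxK ?gram_unit // subrr.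
Qed.

Lemma normal_part_eq0 c p u : cdom (mchart c) p ->
  normal_part h c p u = 0 -> exists v, u = mdiff c h p v.
Proof.
move=> cp /eqP; rewrite subr_eq0 => /eqP ->.
by eexists; rewrite mdiff_jac //.
Qed.

Lemma normal_part_dot c p u xi : cdom (mchart c) p -> normal_vector h c p xi ->
  dot (normal_part h c p u) xi = dot u xi.
Proof.
by move=> cp n_xi; rewrite dotBl -mdiff_jac // n_xi subr0.
Qed.

(** The Weingarten formula: [dot (D_w h) xi] vanishes on the whole chart domain, hence so does its
    derivative along [v]. *)
Lemma normal_mdiff (xi : M -> 'rV[R]_N) c p v w : msmooth xi ->
  (forall q, cdom (mchart c) q -> normal_vector h c q (xi q)) ->
  cdom (mchart c) p ->
  dot (mdiff2 c h p v w) (xi p) = - dot (mdiff c h p w) (mdiff c xi p v).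
Proof.
move=> sxi n_xi cp; apply/eqP; rewrite -addr_eq0; apply/eqP.
have H := is_derive_dot (mdiff2P v w imm.1 cp) (mdiffP v sxi cp).
have [_ <-] : is_derive (ccoord (mchart c) p) v
    (fun y => dot ('D_w (h \o cpar (mchart c)) y) ((xi \o cpar (mchart c)) y))
    (dot (mdiff2 c h p v w) (xi p) + dot (mdiff c h p w) (mdiff c xi p v)).
  by apply: is_derive_eq H _; rewrite /= ccoordK.
rewrite -[RHS](derive_cst (0 : R) (ccoord (mchart c) p) v).
apply: near_eq_derive.
apply: filterS (open_nbhs_nbhs (conj (@cimg_open _ _ _ (mchart c)) (ccoord_img cp))).
move=> y cy /=; have := n_xi _ (cpar_dom cy) w.
by rewrite /mdiff cparK.
Qed.

(** By [normal_mdiff] the second fundamental form in direction [xi] has matrix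
    [- jac xi *m (jac h)^T]. Once [dxi v] is written as [dh v'], the Gram matrix cancels, so shape
    operators are read off from first derivatives of normal sections. *)
Lemma shape_operatorE (xi : M -> 'rV[R]_N) c p v v' : msmooth xi ->
  (forall q, cdom (mchart c) q -> normal_vector h c q (xi q)) ->
  cdom (mchart c) p -> mdiff c xi p v = mdiff c h p v' ->
  v *m shape_operator h c p (xi p) = - v'.
Proof.
move=> sxi n_xi cp E.
have -> : shape_operator h c p (xi p) = - (jac xi c p *m (jac h c p)^T) *m invmx (gram h c p).
  rewrite /shape_operator; congr (_ *m _); apply/matrixP => i j; rewrite !mxE.
  rewrite normal_part_dot //; last exact: n_xi.
  rewrite (normal_mdiff _ _ sxi n_xi cp) dotC dotE; congr (- _).
  by apply: eq_bigr => k _; rewrite !mxE.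
rewrite mulNmx mulmxN !mulmxA -(mdiff_jac v sxi cp) E (mdiff_jac v' imm.1 cp).
by rewrite -(mulmxA v') -/(gram h c p) mulmxK ?gram_unit.
Qed.

Lemma parallel_mdiff (xi : M -> 'rV[R]_N) c p v : parallel_on h setT xi ->
  cdom (mchart c) p -> exists w, mdiff c xi p v = mdiff c h p w.
Proof.
move=> [_ /(_ c p)] H cp; apply: normal_part_eq0 => //.
exact: ((H cp Logic.I).2 v).
Qed.

Lemma parallelI (xi : M -> 'rV[R]_N) : msmooth xi ->
  (forall c p, cdom (mchart c) p -> normal_vector h c p (xi p)) ->
  (forall c p v, cdom (mchart c) p -> exists w, mdiff c xi p v = mdiff c h p w) ->
  parallel_on h setT xi.
Proof.
move=> sxi n_xi t_xi; split=> // c p cp _; split; first exact: n_xi.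
move=> v; rewrite /normal_derivative; have [w ->] := t_xi c p v cp.
exact: normal_part_mdiff.
Qed.

End Immersed.

(** [arclength_derivative2] is computed in the chart [mchart_at p], so a claim in an arbitrary chart
    [c] has to be carried over to that one. *)
Lemma mdiff_chart_dim1 n (F : M -> 'rV[R]_n) c d p v : mdim M = 1%N -> msmooth F ->
  cdom (mchart c) p -> cdom (mchart d) p ->
  mdiff c F p v = mdiff d F p (mdiff c (ccoord (mchart d)) p v).
Proof.
move=> M1 sF cp dp.
have opO : [set y | cimg (mchart c) y /\ cdom (mchart d) (cpar (mchart c) y)]
    (ccoord (mchart c) p).
  by split; [exact: ccoord_img|rewrite ccoordK].
set t := ccoord (mchart d) \o cpar (mchart c).
have dt : is_derive (ccoord (mchart c) p) v t (mdiff c (ccoord (mchart d)) p v).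
  apply: derivableP.
  exact: (Ck_derivable (@mtransition _ _ c d 1%N) opO).
have tp : t (ccoord (mchart c) p) = ccoord (mchart d) p by rewrite /t /= ccoordK.
suff H : is_derive (ccoord (mchart c) p) v ((F \o cpar (mchart d)) \o t)
    (mdiff d F p (mdiff c (ccoord (mchart d)) p v)).
  have [_ <-] := H; apply: near_eq_derive.
  apply: filterS (open_nbhs_nbhs (conj (@overlap_open _ _ c d) opO)) => y [cy dy].
  by rewrite /t /= ccoordK.
apply/is_derive_mxP => i j.
have dF w := mdiffP w sF dp.
have [_ <-] : is_derive (ccoord (mchart d) p) (mdiff c (ccoord (mchart d)) p v)
   (fun y => (F \o cpar (mchart d)) y i j) (mdiff d F p (mdiff c (ccoord (mchart d)) p v) i j).
  by move/is_derive_mxP: (dF (mdiff c (ccoord (mchart d)) p v)).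
rewrite -tp; apply: is_derive_comp_dim1 => // w; rewrite tp.
by have /is_derive_mxP/(_ i j)[] := dF w.
Qed.

(* [<f'', xi> = - <f', xi'>] for the unit speed curve, since [<f', xi> = 0]. *)
Lemma parallel_along_curve N (h xi : M -> 'rV[R]_N) c p v : mdim M = 1%N ->
  immersion h -> parallel_on h setT xi -> cdom (mchart c) p ->
  mdiff c xi p v = - dot (arclength_derivative2 h p) (xi p) *: mdiff c h p v.
Proof.
move=> M1 imm par cp; have [sh inj] := imm.
have sxi : msmooth xi := par.1.
have dp := mchart_atP p; set d := mchart_at p in dp *.
rewrite (mdiff_chart_dim1 v M1 sxi cp dp) (mdiff_chart_dim1 v M1 sh cp dp).
set w := mdiff c _ p v; set e : 'rV[R]_(mdim M) := const_mx 1.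
(* Both sides are linear in the direction, and in dimension one the single vector [e] decides. *)
have [a ->] : exists a, w = a *: e.
  rewrite /e; move: w; rewrite M1 => w; exists (w 0 0).
  by apply/matrixP => i j; rewrite !ord1 !mxE mulr1.
have lin (F : M -> 'rV[R]_N) b : msmooth F -> mdiff d F p (b *: e) = b *: mdiff d F p e.
  by move=> sF; rewrite !mdiff_jac // scalemxAl.
rewrite !lin // scalerA mulrC -scalerA; congr (_ *: _).
have [u Eu] := parallel_mdiff imm e par dp.
have [b Eb] : exists b, u = b *: e.
  rewrite /e; move: u {Eu}; rewrite M1 => u; exists (u 0 0).
  by apply/matrixP => i j; rewrite !ord1 !mxE mulr1.
rewrite {u}Eb lin // in Eu; rewrite Eu; congr (_ *: _).
set x := ccoord (mchart d) p.
pose H := h \o cpar (mchart d).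
pose De y := 'D_e H y.
have e0 : e != 0.
  rewrite /e M1; apply/eqP => /matrixP/(_ 0 0); rewrite !mxE => /eqP.
  by rewrite oner_eq0.
have De0 y : cimg (mchart d) y -> De y != 0.
  move=> dy; apply: contraNneq e0 => D0; apply/eqP.
  by apply: (inj _ _ (cpar_dom dy)); rewrite /mdiff cparK.
have dx : cimg (mchart d) x by exact: ccoord_img.
pose sp y := Num.sqrt (dot (De y) (De y)).
have sp0 y : cimg (mchart d) y -> 0 < sp y.
  by move=> dy; rewrite sqrtr_gt0 dot_gt0 // De0.
have dDe : is_derive x e De (mdiff2 d h p e e) := mdiff2P e e sh dp.
have dsp : derivable sp x e.
  have := is_derive_comp1 (is_derive_dot dDe dDe)
    (is_derive1_sqrt (dot_gt0 (De0 x dx))).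
  by case.
pose T y := (sp y)^-1 *: De y.
have dT : is_derive x e T ('D_e T x).
  apply: derivableP.
  have := is_derive_scale (derivableP (derivableV (lt0r_neq0 (sp0 x dx)) dsp)) dDe.
  by case.
have -> : arclength_derivative2 h p = (sp x)^-1 *: 'D_e T x by [].
rewrite dotZl.
have dTxi : dot ('D_e T x) (xi p) = - dot (T x) (mdiff d xi p e).
  apply/eqP; rewrite -addr_eq0; apply/eqP.
  have [_ <-] : is_derive x e (fun y => dot (T y) ((xi \o cpar (mchart d)) y))
     (dot ('D_e T x) (xi p) + dot (T x) (mdiff d xi p e)).
    apply: is_derive_eq (is_derive_dot dT (mdiffP e sxi dp)) _.
    by rewrite /= ccoordK.
  rewrite -[RHS](derive_cst (0 : R) x e); apply: near_eq_derive.
  apply: filterS (open_nbhs_nbhs (conj (@cimg_open _ _ _ (mchart d)) dx)) => y dy.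
  have [n_xi _] := par.2 _ _ (cpar_dom dy) Logic.I.
  by have := n_xi e; rewrite /mdiff cparK // => E; rewrite dotZl E mulr0.
rewrite dTxi Eu /T dotZl dotZr.
have -> : mdiff d h p e = De x by [].
have sq : sp x ^+ 2 = dot (De x) (De x) by rewrite sqr_sqrtr // dot_ge0.
rewrite -sq mulrN opprK; have := lt0r_neq0 (sp0 x dx); move: (sp x) => z z0.
by field.
Qed.

End Manifolds.

(** * Product manifolds *)

Section Products.
Variables (R : realType) (n : nat) (M : 'I_n -> manifold R).
Local Notation P := (prod_manifold M).
Implicit Types (c : mindex P) (p : P) (x : 'rV[R]_(\sum_i mdim (M i))).

Definition block i (v : 'rV[R]_(mdim P)) : 'rV[R]_(mdim (M i)) :=
  @submxrow R n (fun j => mdim (M j)) 1 v i.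

Definition inj_block i (v : 'rV[R]_(mdim (M i))) : 'rV[R]_(mdim P) :=
  \mxrow_j dfwith (fun j => 0 : 'rV[R]_(mdim (M j))) i v j.

(** The chart expression of replacing the point of one factor. It is affine in [y] with linear part
    [inj_block], as [is_derive_affine] requires, so differentials of slices are partial
    differentials. *)
Definition upd x i (y : 'rV[R]_(mdim (M i))) : 'rV[R]_(\sum_i mdim (M i)) :=
  \mxrow_j dfwith (fun j => submxrow x j : 'rV[R]_(mdim (M j))) i y j.

Lemma submxrow_upd x i (y : 'rV[R]_(mdim (M i))) j :
  submxrow (upd x y) j = dfwith (fun j => submxrow x j : 'rV[R]_(mdim (M j))) i y j.
Proof. exact: mxrowK. Qed.

Lemma block_inj i v : block i (inj_block v) = v.
Proof. by rewrite /block mxrowK dfwithin. Qed.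

Lemma block_inj_neq i j v : i != j -> block j (@inj_block i v) = 0.
Proof. by move=> ij; rewrite /block mxrowK dfwithout. Qed.

Lemma blockP u v : (forall i, block i u = block i v) -> u = v.
Proof. by move=> uv; apply/mxrowP => i; exact: uv. Qed.

Lemma block0 i : block i 0 = 0.
Proof. exact: submxrow0. Qed.

Lemma blockD i u v : block i (u + v) = block i u + block i v.
Proof. exact: submxrowD. Qed.

Lemma upd_affine x i (h : R) (u y : 'rV[R]_(mdim (M i))) :
  upd x (h *: u + y) = h *: inj_block u + upd x y.
Proof.
apply/mxrowP => j; rewrite submxrowD !submxrow_upd.
have -> : submxrow (h *: inj_block u) j = h *: block j (inj_block u).
  by apply/matrixP => a b; rewrite !mxE.
have [<-|ij] := eqVneq i j; first by rewrite block_inj !dfwithin.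
by rewrite block_inj_neq // !dfwithout // scaler0 add0r.
Qed.

Lemma upd_continuous x i : continuous (@upd x i).
Proof.
move=> y; apply: mxrow_continuous => j.
have [<-|ij] := eqVneq i j.
  rewrite [X in {for _, continuous X}](_ : _ = id); first exact: cvg_id.
  by apply/funext => s; rewrite dfwithin.
rewrite [X in {for _, continuous X}](_ : _ = fun=> submxrow x j).
  exact: cst_continuous.
by apply/funext => s; rewrite dfwithout.
Qed.

Lemma upd_block x i : upd x (block i x) = x.
Proof.
by apply/mxrowP => j; rewrite mxrowK; case: dfwithP.
Qed.

Lemma ppar_upd c x i y :
  ppar c (upd x y) = dfwith (ppar c x) i (cpar (mchart (c i)) y) :> P.
Proof.
apply: functional_extensionality_dep => j /=; rewrite {1}/ppar submxrow_upd.
have [<-|ij] := eqVneq i j; first by rewrite !dfwithin.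
by rewrite !dfwithout.
Qed.

Lemma block_ccoord c p i : block i (ccoord (mchart c) p) = ccoord (mchart (c i)) (p i).
Proof. by rewrite /block mxrowK. Qed.

Lemma slice_comp (W : normedModType R) (F : P -> W) c p i : cdom (mchart c) p ->
  (F \o dfwith p i) \o cpar (mchart (c i)) =
  (F \o cpar (mchart c)) \o @upd (ccoord (mchart c) p) i.
Proof.
move=> cp; apply/funext => y /=; rewrite ppar_upd.
by rewrite (ccoordK cp : ppar c (pcoord c p) = p).
Qed.

Lemma mdiff_slice (W : normedModType R) (F : P -> W) c p i v : cdom (mchart c) p ->
  mdiff (c i) (F \o dfwith p i) (p i) v = mdiff c F p (inj_block v).
Proof.
move=> cp; rewrite /mdiff slice_comp //.
rewrite (derive_affine (L := @inj_block i)) => [|h u x]; last exact: upd_affine.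
by rewrite -block_ccoord upd_block.
Qed.

(** Completes a chart of one factor to a product chart by the default charts of the other factors at
    [p]; slices can then be studied in every chart of their factor. *)
Definition chart_through p i (ci : mindex (M i)) : mindex P :=
  dfwith (fun j => mchart_at (p j)) i ci.

Lemma chart_throughE p i ci : @chart_through p i ci i = ci.
Proof. by rewrite /chart_through dfwithin. Qed.

Lemma chart_throughP p i ci : cdom (mchart ci) (p i) ->
  cdom (mchart (@chart_through p i ci)) p.
Proof.
move=> cp j; rewrite /chart_through.
have [ij|ij] := eqVneq i j; last by rewrite dfwithout //; exact: mchart_atP.
by case: j / ij; rewrite dfwithin.
Qed.

Lemma msmooth_slice (W : normedModType R) (F : P -> W) p i : msmooth F ->
  msmooth (F \o dfwith p i).
Proof.
move=> /msmoothP sF; apply/msmoothP => ci k.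
pose c := @chart_through p i ci; pose x := ccoord (mchart c) p.
have ppE j y : ppar c (@upd x i y) j = dfwith p i (cpar (mchart ci) y) j.
  rewrite /ppar submxrow_upd; have [ij|ij] := eqVneq i j.
    by case: j / ij; rewrite !dfwithin /c chart_throughE.
  rewrite !dfwithout // mxrowK /c /chart_through dfwithout // ccoordK //.
  exact: mchart_atP.
have -> : (F \o dfwith p i) \o cpar (mchart ci) = (F \o cpar (mchart c)) \o @upd x i.
  by apply/funext => y /=; congr F; apply: functional_extensionality_dep => j.
apply: sub_Ck (Ck_comp_affine (@upd_affine x i) (@upd_continuous x i) (sF c k)).
move=> y cy j /=; rewrite submxrow_upd.
have [ij|ij] := eqVneq i j; first by case: j / ij; rewrite dfwithin /c chart_throughE.
rewrite dfwithout // mxrowK; apply: ccoord_img.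
by rewrite /c /chart_through dfwithout //; exact: mchart_atP.
Qed.

Lemma mdiffP_proj (W : normedModType R) i (G : M i -> W) c p v : msmooth G ->
  cdom (mchart c) p ->
  is_derive (ccoord (mchart c) p) v ((fun q : P => G (q i)) \o cpar (mchart c))
    (mdiff (c i) G (p i) (block i v)).
Proof.
move=> sG cp.
have E : (fun q : P => G (q i)) \o cpar (mchart c) =
  (G \o cpar (mchart (c i))) \o (@block i) by [].
rewrite E; apply: (is_derive_affine (L := @block i)).
  by move=> h u x; exact: submxrow_linear.
by rewrite block_ccoord; exact: mdiffP.
Qed.

Lemma msmooth_proj (W : normedModType R) i (G : M i -> W) : msmooth G ->
  msmooth (fun q : P => G (q i)).
Proof.
move=> /msmoothP sG; apply/msmoothP => c k.
have := Ck_comp_linear (@submxrow_linear _ _ M i) (@submxrow_continuous _ _ M i)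
  (sG (c i) k).
by apply: sub_Ck => x /(_ i).
Qed.

Lemma smooth_proj2 i j (rho : M i -> M j -> R) c k :
  (forall (ci : mindex (M i)) (cj : mindex (M j)),
    smooth_on (cimg (mchart ci) `*` cimg (mchart cj))
      (fun z : 'rV[R]_(mdim (M i)) * 'rV[R]_(mdim (M j)) =>
         rho (cpar (mchart ci) z.1) (cpar (mchart cj) z.2))) ->
  Ck k (cimg (mchart c)) (fun x => rho (cpar (mchart c) x i) (cpar (mchart c) x j)).
Proof.
move=> srho.
pose Q x : 'rV[R]_(mdim (M i)) * 'rV[R]_(mdim (M j)) := (submxrow x i, submxrow x j).
have lQ (a : R) u v : Q (a *: u + v) = a *: Q u + Q v.
  by rewrite /Q !submxrow_linear.
have cQ : continuous Q.
  move=> x; exact: cvg_pair (@submxrow_continuous _ _ M i x) (@submxrow_continuous _ _ M j x).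
have := Ck_comp_linear lQ cQ (srho (c i) (c j) k).
by apply: sub_Ck => x cx; split; exact: cx.
Qed.

(** The coordinates in [A] are exchanged one at a time along a list of indices; the list of all
    indices turns [p] into [q]. *)
Lemma indep_coords (T : Type) (F : P -> T) (A : pred 'I_n) :
  (forall i p q, A i -> F (dfwith p i q) = F p) ->
  forall p q, (forall i, ~~ A i -> p i = q i) -> F p = F q.
Proof.
move=> FA p q pq.
have H (s : seq 'I_n) : F p = F (fun i => if (i \in s) && A i then q i else p i).
  elim: s => [|i s ->]; first by congr F; apply: functional_extensionality_dep.
  have [Ai|nAi] := boolP (A i); last first.
    congr F; apply: functional_extensionality_dep => j; rewrite inE.
    by have [->|//] := eqVneq j i; rewrite (negPf nAi) !andbF.
  rewrite -[LHS](FA i _ (q i) Ai); congr F; apply: functional_extensionality_dep => j.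
  rewrite inE; have [<-|ij] := eqVneq i j; first by rewrite dfwithin Ai.
  by rewrite dfwithout.
rewrite (H (enum 'I_n)); congr F; apply: functional_extensionality_dep => j.
by rewrite mem_enum /=; case: ifPn => // /pq.
Qed.

End Products.

(** * Partial tubes *)

Section MoreCalculus.
Variables (R : realType) (V : normedModType R).

Lemma is_derive_linear_comp m n (L : 'rV[R]_m -> 'rV[R]_n) (F : V -> 'rV[R]_m) x v dF :
  linear L -> is_derive x v F dF -> is_derive x v (fun y => L (F y)) (L dF).
Proof.
move=> lL dFx; rewrite (linear_mulmx dF lL).
under eq_fun do rewrite (linear_mulmx _ lL).
exact: is_derive_mulmx.
Qed.

Lemma Ck_linear_comp m n (L : 'rV[R]_m -> 'rV[R]_n) k (U : set V) (F : V -> 'rV[R]_m) :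
  linear L -> open U -> Ck k U F -> Ck k U (fun y => L (F y)).
Proof.
move=> lL oU CF; under eq_fun do rewrite (linear_mulmx _ lL).
exact: Ck_mulmx.
Qed.

Lemma Ck_summx m n (I : Type) (s : seq I) k (U : set V) (f : I -> V -> 'M[R]_(m, n)) :
  open U -> (forall i, Ck k U (f i)) -> Ck k U (fun x => \sum_(i <- s) f i x).
Proof.
move=> oU Cf; elim: s => [|i s IH].
  by under eq_fun do rewrite big_nil; exact: Ck_cst.
by under eq_fun do rewrite big_cons; exact: CkDmx.
Qed.

Lemma is_derive_row_mx m n (F : V -> 'rV[R]_m) (G : V -> 'rV[R]_n) x v dF dG :
  is_derive x v F dF -> is_derive x v G dG ->
  is_derive x v (fun y => row_mx (F y) (G y)) (row_mx dF dG).
Proof.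
move=> /is_derive_mxP hF /is_derive_mxP hG; apply/is_derive_mxP => i j.
case: (split_ordP j) => k ->.
  by rewrite row_mxEl; under eq_fun do rewrite row_mxEl.
by rewrite row_mxEr; under eq_fun do rewrite row_mxEr.
Qed.

Lemma is_derive_mxrow r (n : 'I_r -> nat) (F : forall i, V -> 'rV[R]_(n i)) x v
    (dF : forall i, 'rV[R]_(n i)) :
  (forall i, is_derive x v (F i) (dF i)) ->
  is_derive x v (fun y => \mxrow_i F i y) (\mxrow_i dF i).
Proof.
move=> hF; apply/is_derive_mxP => i j; rewrite mxE; under eq_fun do rewrite mxE.
by have /is_derive_mxP := hF (tagnat.sig1 j).
Qed.

Lemma Ck_row_mx m n k U (F : V -> 'rV[R]_m) (G : V -> 'rV[R]_n) : open U ->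
  Ck k U F -> Ck k U G -> Ck k U (fun y => row_mx (F y) (G y)).
Proof.
move=> oU CF CG; apply: Ck_mx => // i j; case: (split_ordP j) => l ->.
  by under eq_fun do rewrite row_mxEl; exact: Ck_coord.
by under eq_fun do rewrite row_mxEr; exact: Ck_coord.
Qed.

Lemma Ck_mxrow r (n : 'I_r -> nat) k U (F : forall i, V -> 'rV[R]_(n i)) : open U ->
  (forall i, Ck k U (F i)) -> Ck k U (fun y => \mxrow_i F i y).
Proof.
move=> oU CF; apply: Ck_mx => // i j; under eq_fun do rewrite mxE.
exact: Ck_coord.
Qed.

End MoreCalculus.

Lemma dot_rV0 (R : realType) n (u v : 'rV[R]_n) : n = 0%N -> dot u v = 0.
Proof. by move=> n0; subst n; rewrite dotE big_ord0. Qed.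

Lemma orthonormal_dot (R : realType) k r (le_kr : (k <= r)%N) (e : 'I_r -> 'rV[R]_k) :
  (forall a b : 'I_r, (a < k)%N -> (b < k)%N -> dot (e a) (e b) = (a == b)%:R) ->
  forall u v, \sum_(a < r | (a < k)%N) dot u (e a) * dot v (e a) = dot u v.
Proof.
move=> eO u v; pose Q : 'M[R]_k := \matrix_i e (widen_ord le_kr i).
have QQ : Q *m Q^T = 1%:M.
  apply/matrixP => i j; rewrite [LHS]mxE [RHS]mxE.
  have -> : i == j = (widen_ord le_kr i == widen_ord le_kr j) by [].
  rewrite -eO //= dotE; apply: eq_bigr => l _; rewrite !mxE //.
have uQ w i : (w *m Q^T) 0 i = dot w (e (widen_ord le_kr i)).
  by rewrite mxE dotE; apply: eq_bigr => l _; rewrite !mxE.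
transitivity (dot (u *m Q^T) (v *m Q^T)).
  by rewrite big_ord_narrow dotE; apply: eq_bigr => i _; rewrite !uQ.
by rewrite dot_mulmxl trmxK -mulmxA (mulmx1C QQ) mulmx1.
Qed.

Section Tube.
Variables (R : realType) (r : nat) (M : 'I_r -> manifold R) (D : tube_data M).
Local Notation k := (td_k D).
Local Notation l := (td_l D).

(** The component of [td_phitilde] in the target of [f_a]: the value at [p] of a parallel normal
    section of [f_a] that depends linearly on [y]. *)
Definition nrm a (p : M a) (y : 'rV[R]_(td_s D)) : 'rV[R]_(td_N D a) :=
  if (a < k)%N then dot (proj_k y) (td_e D a) *: ((td_R D a)^-1 *: td_f D a p)
  else if (a < l)%N then td_phi D a p (proj_a a y) else 0.

(* Minus the principal curvature of [f_a] in the direction [nrm a p y]. *)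
Definition sig a (p : M a) (y : 'rV[R]_(td_s D)) : R :=
  if (a < k)%N then (td_R D a)^-1 * dot (proj_k y) (td_e D a)
  else if (a < l)%N then
    - dot (arclength_derivative2 (td_f D a) p) (td_phi D a p (proj_a a y))
  else 0.

Lemma td_phitildeE p (y : 'rV[R]_(td_s D)) :
  td_phitilde p y = row_mx (td_iso D (proj_m y)) (\mxrow_a nrm (p a) y).
Proof. by []. Qed.

Lemma proj_k_linear b (y z : 'rV[R]_(td_s D)) :
  proj_k (b *: y + z) = b *: proj_k y + proj_k z.
Proof. by rewrite /proj_k; apply/matrixP => i j; rewrite !mxE. Qed.

Lemma proj_m_linear b (y z : 'rV[R]_(td_s D)) :
  proj_m (b *: y + z) = b *: proj_m y + proj_m z.
Proof. by rewrite /proj_m; apply/matrixP => i j; rewrite !mxE. Qed.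

Lemma proj_a_linear a b (y z : 'rV[R]_(td_s D)) :
  proj_a a (b *: y + z) = b *: proj_a a y + proj_a a z.
Proof. by rewrite /proj_a; apply/matrixP => i j; rewrite !mxE. Qed.

Lemma curve_range (a : 'I_r) : (a < k)%N = false -> (a < l)%N -> (k <= a < l)%N.
Proof. by move=> /negbT; rewrite -leqNgt => -> ->. Qed.

Lemma td_phi_lin a (p : M a) : (a < k)%N = false -> (a < l)%N -> linear (td_phi D a p).
Proof. by move=> ak al; have [/(_ p)[]] := td_phi_isometry (curve_range ak al). Qed.

Lemma nrm_linear a (p : M a) : linear (nrm p).
Proof.
move=> b y z; rewrite /nrm; case: ifPn => [ak|/negbTE ak].
  by rewrite proj_k_linear dotDl dotZl scalerDl -!scalerA.
case: ifP => [al|_]; last by rewrite scaler0 addr0.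
by rewrite proj_a_linear (td_phi_lin p ak al).
Qed.

Lemma sig_linear a (p : M a) b y z : sig p (b *: y + z) = b * sig p y + sig p z.
Proof.
rewrite /sig; case: ifPn => [ak|/negbTE ak].
  by rewrite proj_k_linear dotDl dotZl; ring.
case: ifP => [al|_]; last by rewrite mulr0 addr0.
by rewrite proj_a_linear (td_phi_lin p ak al) dotDr dotZr; ring.
Qed.

Lemma td_f_smooth a : msmooth (td_f D a).
Proof. by have [] := td_f_immersion D a. Qed.

Lemma msmooth_scale (X : manifold R) n (b : R) (F : X -> 'rV[R]_n) :
  msmooth F -> msmooth (fun p => b *: F p).
Proof.
move=> /msmoothP sF; apply/msmoothP => c j.
by apply: Ck_scale; [exact: cimg_open|exact: Ck_cst|exact: sF].
Qed.

Lemma nrm_smooth a y : msmooth (fun p : M a => nrm p y).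
Proof.
rewrite /nrm; case: (boolP (a < k)%N) => [ak|/negbTE ak].
  exact: msmooth_scale (msmooth_scale _ (@td_f_smooth a)).
case: (boolP (a < l)%N) => [al|_]; last by apply/msmoothP => c j; exact: Ck_cst.
by have [_ _ /(_ (proj_a a y))[]] := td_phi_isometry (curve_range ak al).
Qed.

(** On a sphere the section is a constant multiple of [f_a] itself; on a curve this is
    [parallel_along_curve]. Every derivative of the tube reduces to this proportionality. *)
Lemma nrm_mdiff a y c (p : M a) v : cdom (mchart c) p ->
  mdiff c (fun q => nrm q y) p v = sig p y *: mdiff c (td_f D a) p v.
Proof.
move=> cp; rewrite /nrm /sig; case: (boolP (a < k)%N) => [ak|/negbTE ak].
  have df := mdiffP v (@td_f_smooth a) cp.
  have hc (b : R) : is_derive (ccoord (mchart c) p) v (fun _ => b) 0.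
    exact: is_derive_cst.
  have [_] := is_derive_scale (hc (dot (proj_k y) (td_e D a)))
    (is_derive_scale (hc (td_R D a)^-1) df).
  rewrite /mdiff => ->.
  by rewrite !scale0r !add0r scalerA mulrC.
case: (boolP (a < l)%N) => [al|_]; last by rewrite mdiff_cst scale0r.
have [_ _ /(_ (proj_a a y)) par] := td_phi_isometry (curve_range ak al).
have M1 := td_curve (curve_range ak al).
exact: parallel_along_curve M1 (td_f_immersion D a) par cp.
Qed.

Lemma nrm_normal a y c (p : M a) : cdom (mchart c) p ->
  normal_vector (td_f D a) c p (nrm p y).
Proof.
move=> cp v; rewrite /nrm; case: ifPn => [ak|/negbTE ak].
  have [_] := mdiff_dot v (@td_f_smooth a) (@td_f_smooth a) cp.
  have -> : (fun q => dot (td_f D a q) (td_f D a q)) = fun=> td_R D a ^+ 2.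
    by apply/funext => q; exact: td_sphere.
  rewrite [in X in X -> _](derive_cst (td_R D a ^+ 2)) => /esym/eqP.
  rewrite (dotC (td_f D a p)) -mulr2n mulrn_eq0 /= => /eqP E.
  by rewrite !dotZr E !mulr0.
case: ifP => [al|_]; last by rewrite dot0r.
have [_ _ /(_ (proj_a a y)) par] := td_phi_isometry (curve_range ak al).
exact: (par.2 _ _ cp Logic.I).1.
Qed.

(** On a spherical factor the norm of [f_a] cancels [R_a], leaving the product of the
    [e_a]-coordinates; these add up by [orthonormal_dot]. By [td_n0] the blocks [proj_a] of the
    factors other than the designated curves are trivial. *)
Lemma td_phitilde_dot p (y z : 'rV[R]_(td_s D)) : dot (td_phitilde p y) (td_phitilde p z) = dot y z.
Proof.
rewrite !td_phitildeE dot_row_mx (td_isoP D).2 dot_mxrow.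
have -> : dot y z = dot (proj_k y) (proj_k z) +
   (\sum_a dot (proj_a a y) (proj_a a z) + dot (proj_m y) (proj_m z)).
  rewrite -dot_mxrow !submxrowK -dot_row_mx !hsubmxK -dot_row_mx.
  by rewrite !hsubmxK.
rewrite -(orthonormal_dot (leq_trans (td_kl D) (td_lr D)) (@td_e_orthonormal _ _ _ D)).
rewrite addrC addrA; congr (_ + _).
rewrite [X in X + _]big_mkcond -big_split /=; apply: eq_bigr => a _.
rewrite /nrm; case: ifPn => [ak|/negbTE ak].
  rewrite !dotZl !dotZr td_sphere // [dot (proj_a a y) _]dot_rV0; last first.
    by apply: td_n0; rewrite negb_and -ltnNge ak.
  have R0 : td_R D a != 0 by rewrite gt_eqF // td_R_gt0.
  by field.
case: ifPn => [al|al].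
  have [/(_ (p a))[_ ->]] := td_phi_isometry (curve_range ak al).
  by rewrite add0r.
by rewrite dot0r add0r dot_rV0 // td_n0 // negb_and al orbT.
Qed.

Lemma mdiff_ftildeP c p v : cdom (mchart c) p ->
  is_derive (ccoord (mchart c) p) v (td_ftilde D \o cpar (mchart c))
    (row_mx 0 (\mxrow_a mdiff (c a) (td_f D a) (p a) (block a v))).
Proof.
move=> cp; apply: is_derive_row_mx.
by apply: is_derive_mxrow => a; apply: mdiffP_proj => //; exact: td_f_smooth.
Qed.

Lemma td_ftilde_immersion : immersion (td_ftilde D).
Proof.
split.
  apply/msmoothP => c j; apply: Ck_row_mx; first exact: cimg_open.
    exact: Ck_cst.
  apply: Ck_mxrow; first exact: cimg_open.
  move=> a; have /msmoothP sF := @msmooth_proj R r M _ a _ (@td_f_smooth a).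
  exact: sF c j.
move=> c p cp v; rewrite /mdiff; have [_ ->] := mdiff_ftildeP v cp.
rewrite -row_mx0 => /eq_row_mx[_] E; apply: blockP => a; rewrite block0.
have [_ inj] := td_f_immersion D a; apply: (inj (c a) (p a)); first exact: cp.
by have := congr1 (fun u => submxrow u a) E; rewrite mxrowK submxrow0.
Qed.

Lemma mdiff_phitildeP (y : 'rV[R]_(td_s D)) c p v : cdom (mchart c) p ->
  is_derive (ccoord (mchart c) p) v ((fun q => td_phitilde q y) \o cpar (mchart c))
    (row_mx 0 (\mxrow_a (sig (p a) y *: mdiff (c a) (td_f D a) (p a) (block a v)))).
Proof.
move=> cp; apply: is_derive_row_mx.
apply: is_derive_mxrow => a; rewrite -nrm_mdiff; last exact: cp.
exact: mdiffP_proj (@nrm_smooth a y) cp.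
Qed.

Lemma phitilde_smooth (y : 'rV[R]_(td_s D)) : msmooth (fun q => td_phitilde q y).
Proof.
apply/msmoothP => c j; apply: Ck_row_mx; first exact: cimg_open.
  exact: Ck_cst.
apply: Ck_mxrow; first exact: cimg_open.
move=> a; have /msmoothP sF := @msmooth_proj R r M _ a _ (@nrm_smooth a y).
exact: sF c j.
Qed.

Lemma phitilde_normal (y : 'rV[R]_(td_s D)) c p : cdom (mchart c) p ->
  normal_vector (td_ftilde D) c p (td_phitilde p y).
Proof.
move=> cp v; rewrite /mdiff; have [_ ->] := mdiff_ftildeP v cp.
rewrite td_phitildeE dot_row_mx dot0l add0r dot_mxrow big1 // => a _.
exact: nrm_normal (cp a) _.
Qed.

(** The operator is the scalar [1 + sig] on each block, so membership in [Omega] becomes the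
    nonvanishing of these scalars. *)
Lemma mul_shape_operator (y : 'rV[R]_(td_s D)) c p v : cdom (mchart c) p ->
  v *m (1%:M - shape_operator (td_ftilde D) c p (td_phitilde p y)) =
  \mxrow_a ((1 + sig (p a) y) *: block a v).
Proof.
move=> cp; pose v' : 'rV[R]_(mdim (prod_manifold M)) := \mxrow_a (sig (p a) y *: block a v).
have E : mdiff c (fun q => td_phitilde q y) p v = mdiff c (td_ftilde D) p v'.
  rewrite /mdiff; have [_ ->] := mdiff_phitildeP y v cp.
  have [_ ->] := mdiff_ftildeP v' cp; congr row_mx; apply: eq_mxrow => a.
  rewrite /block mxrowK !mdiff_jac; last 4 first.
  - exact: td_f_smooth.
  - exact: cp.
  - exact: td_f_smooth.
  - exact: cp.
  by rewrite scalemxAl.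
have S := shape_operatorE td_ftilde_immersion (@phitilde_smooth y)
  (fun q => @phitilde_normal y c q) cp E.
rewrite mulmxBr mulmx1 [X in _ - X]S opprK.
apply: blockP => a; rewrite blockD {2 3}/block !mxrowK.
by rewrite scalerDl scale1r.
Qed.

Lemma OmegaP (y : 'rV[R]_(td_s D)) : (forall a (p : M a), 1 + sig p y != 0) ->
  Omega (td_ftilde D) (@td_phitilde _ _ _ D) y.
Proof.
move=> s0 c p cp; rewrite -row_free_unit; apply: inj_row_free => v.
rewrite mul_shape_operator // => /(congr1 (fun u => submxrow u _)) E.
apply: blockP => a; have := E a; rewrite mxrowK submxrow0 block0.
by move=> /eqP; rewrite scaler_eq0 (negPf (s0 _ _)) /= => /eqP.
Qed.

(** A zero of [1 + sig] at [pa] shows up as a kernel vector: [pa] is completed to a point of the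
    product, which takes nonempty factors, and block [a] holds a nonzero vector, which takes
    positive dimension. *)
Lemma Omega_neq0 (y : 'rV[R]_(td_s D)) : (forall a, (0 < mdim (M a))%N) -> (forall a, [set: M a] !=set0) ->
  Omega (td_ftilde D) (@td_phitilde _ _ _ D) y -> forall a (p : M a), 1 + sig p y != 0.
Proof.
move=> dM neM Oy a pa; have o b := projT1 (cid (neM b)).
pose p : prod_manifold M := dfwith o a pa.
have cp := mchart_atP p; set c := mchart_at p in cp.
have := Oy c p cp; rewrite -row_free_unit => /row_freeP[B AB].
apply/negP => /eqP s0.
have pE : p a = pa by rewrite /p dfwithin.
pose w : 'rV[R]_(mdim (M a)) := const_mx 1.
have w0 : w != 0.
  apply/eqP => /matrixP/(_ 0 (Ordinal (dM a))); rewrite !mxE => /eqP.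
  by rewrite oner_eq0.
have : inj_block w *m 1%:M = 0.
  rewrite -AB mulmxA mul_shape_operator //.
  have -> : \mxrow_b ((1 + sig (p b) y) *: block b (inj_block w)) = 0
      :> 'rV[R]_(mdim (prod_manifold M)).
    apply: blockP => b; rewrite block0 {1}/block mxrowK.
    have [<-|ab] := eqVneq a b; first by rewrite pE s0 scale0r.
    by rewrite block_inj_neq // scaler0.
  by rewrite mul0mx.
rewrite mulmx1 => /(congr1 (block a)); rewrite block_inj block0 => /eqP.
exact/negP.
Qed.

Lemma td_tubeE (M0 : manifold R) (f0 : M0 -> 'rV[R]_(td_s D)) p0 p : td_tube f0 p0 p =
  row_mx (td_iso D (proj_m (f0 p0 - td_shift D)))
    (\mxrow_a (td_f D a (p a) + nrm (p a) (f0 p0 - td_shift D))).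
Proof.
rewrite /td_tube /partial_tube /td_ftilde td_phitildeE add_row_mx add0r.
by rewrite -mxrowD.
Qed.

Lemma dot_td_shift (a : 'I_r) : (a < td_k D)%N ->
  dot (proj_k (td_shift D)) (td_e D a) = td_R D a.
Proof.
move=> ak; have -> : proj_k (td_shift D) =
    \sum_(b < r | (b < td_k D)%N) td_R D b *: td_e D b.
  rewrite /proj_k /td_shift raddf_sum; apply: eq_bigr => b _.
  by rewrite /= linearZ /= row_mxKl.
rewrite dot_suml (bigD1 a) //= dotZl td_e_orthonormal // eqxx mulr1.
rewrite big1 ?addr0 // => b /andP[bk ba].
by rewrite dotZl td_e_orthonormal // (negPf ba) mulr0.
Qed.

Lemma proj_a_shift (a : 'I_r) : proj_a a (td_shift D) = 0.
Proof.
have E : lsubmx (rsubmx (td_shift D)) = 0.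
  rewrite /td_shift !raddf_sum; apply: big1 => b _.
  by rewrite /= !linearZ /= row_mxKr linear0 scaler0.
by rewrite /proj_a E submxrow0.
Qed.

(** Along the tube both arguments of [nrm] vary. Expanding in the coordinates of [y] separates them
    into products of a function of the base and a function of the factor, to which the product rule
    applies; [sigE] does the same for [sig]. *)
Lemma nrmE (a : 'I_r) (q : M a) (y : 'rV[R]_(td_s D)) :
  nrm q y = \sum_j y 0 j *: nrm q (delta_mx 0 j).
Proof.
rewrite (linear_mulmx y (@nrm_linear a q)) mulmx_sum_row.
by apply: eq_bigr => j _; rewrite rowK.
Qed.

Lemma sigE (a : 'I_r) (q : M a) (y : 'rV[R]_(td_s D)) :
  sig q y = \sum_j y 0 j * sig q (delta_mx 0 j).
Proof.
have s0 : @sig a q 0 = 0.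
  by have := @sig_linear a q (-1) 0 0; rewrite scaler0 addr0 mulN1r addNr.
rewrite {1}(row_sum_delta y); elim/big_rec2: _ => [//|j x1 x2 _ <-].
exact: sig_linear.
Qed.

Lemma td_phitilde_linear p : linear (@td_phitilde _ _ _ D p).
Proof.
move=> b y z; rewrite !td_phitildeE scale_row_mx add_row_mx; congr row_mx.
  by rewrite proj_m_linear (td_isoP D).1.
apply/mxrowP => a; rewrite submxrowD mxrowK mxrowK.
have sZ (x : 'rV[R]_(\sum_a td_N D a)) : submxrow (b *: x) a = b *: submxrow x a.
  by apply/rowP => j; rewrite !mxE.
rewrite sZ mxrowK; exact: nrm_linear.
Qed.

End Tube.

(** * The metric and second fundamental form of a partial tube *)

Section Direct.
Variables (R : realType) (r : nat) (M : 'I_r.+1 -> manifold R).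
Local Notation P := (prod_manifold M).
Local Notation fac a := (M (lift ord0 a)).
Variables (D : tube_data (fun a : 'I_r => fac a)) (f0 : M ord0 -> 'rV[R]_(td_s D)).

Implicit Types (c : mindex P).
Local Notation blk i := (@block R r.+1 M i).

Let W (p0 : M ord0) := f0 p0 - td_shift D.
Let f (p : P) := td_tube f0 (p ord0) (fun a => p (lift ord0 a)).

(** On a spherical factor the summand [1] is what the shift by [R_a *: e_a] takes away from the
    quotient; on the curves the shift has no component. *)
Lemma td_rhoE (a : 'I_r) p0 (pa : fac a) :
  td_rho f0 p0 pa = 1 + @sig R r _ D a pa (W p0).
Proof.
rewrite /td_rho /sig; case: ifPn => [ak|/negbTE ak].
  have -> : dot (f0 p0) (td_es D a) = dot (proj_k (f0 p0)) (td_e D a).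
    by rewrite -[f0 p0 in LHS]hsubmxK dot_row_mx dot0r addr0.
  rewrite /W [proj_k _ in RHS]raddfB /= dotBl dot_td_shift //.
  rewrite mulrBr mulVf; first by ring.
  by rewrite gt_eqF // td_R_gt0.
case: ifP => // [al|_]; last by rewrite addr0.
have -> : proj_a a (W p0) = proj_a a (f0 p0) - proj_a a (td_shift D).
  by rewrite /W /proj_a !raddfB /= submxrowB.
by rewrite proj_a_shift subr0.
Qed.

Lemma is_derive_block i c (p : P) (v : 'rV[R]_(mdim P)) (X : normedModType R)
    (G : 'rV[R]_(mdim (M i)) -> X) dG :
  is_derive (ccoord (mchart (c i)) (p i)) (blk i v) G dG ->
  is_derive (ccoord (mchart c) p) v (fun x => G (blk i x)) dG.
Proof.
move=> dGx; apply: (is_derive_affine (P := blk i) (L := blk i)).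
  by move=> h u x; exact: submxrow_linear.
by rewrite block_ccoord.
Qed.

Lemma is_derive_nrm (a : 'I_r) c (p : P) (v : 'rV[R]_(mdim P))
    (Y : 'rV[R]_(mdim (M ord0)) -> 'rV[R]_(td_s D)) dY : cdom (mchart c) p ->
  is_derive (ccoord (mchart (c ord0)) (p ord0)) (blk ord0 v) Y dY ->
  is_derive (ccoord (mchart c) p) v
    (fun x => @nrm R r _ D a (cpar (mchart c) x (lift ord0 a)) (Y (blk ord0 x)))
    (@nrm R r _ D a (p (lift ord0 a)) dY +
     @sig R r _ D a (p (lift ord0 a)) (Y (ccoord (mchart (c ord0)) (p ord0))) *:
       mdiff (c (lift ord0 a)) (td_f D a) (p (lift ord0 a)) (blk (lift ord0 a) v)).
Proof.
move=> cp dYx.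
have -> : (fun x => @nrm R r _ D a (cpar (mchart c) x (lift ord0 a)) (Y (blk ord0 x))) =
  (fun x => \sum_j (Y (blk ord0 x)) 0 j *:
     @nrm R r _ D a (cpar (mchart c) x (lift ord0 a)) (delta_mx 0 j)).
  by apply/funext => x; exact: nrmE.
rewrite (nrmE _ dY) (sigE _ (Y _)) scaler_suml -big_split.
apply: is_derive_bigsum => j.
have /is_derive_mxP/(_ 0 j) dYj := is_derive_block (c := c) (p := p) dYx.
have sN := @nrm_smooth R r _ D a (delta_mx 0 j).
have := @mdiffP_proj R r.+1 M _ (lift ord0 a) _ c p v sN cp.
have -> := @nrm_mdiff R r _ D a (delta_mx 0 j) _ _ (blk (lift ord0 a) v) (cp (lift ord0 a)).
move=> /(is_derive_scale dYj); rewrite /= scalerA => H; apply: is_derive_eq H _.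
have pE : ppar c (pcoord c p) = p := ccoordK cp.
by rewrite pE -(block_ccoord c p ord0).
Qed.

Hypothesis f0_imm : immersion f0.

Lemma W_mdiffP (c0 : mindex (M ord0)) p0 v : cdom (mchart c0) p0 ->
  is_derive (ccoord (mchart c0) p0) v (W \o cpar (mchart c0)) (mdiff c0 f0 p0 v).
Proof.
move=> cp; rewrite -[mdiff _ _ _ _]subr0; apply: is_deriveB.
exact: mdiffP f0_imm.1 cp.
Qed.

Lemma td_tube_mdiffP c (p : P) (v : 'rV[R]_(mdim P)) : cdom (mchart c) p ->
  is_derive (ccoord (mchart c) p) v (f \o cpar (mchart c))
    (td_phitilde (fun a => p (lift ord0 a)) (mdiff (c ord0) f0 (p ord0) (blk ord0 v)) +
     row_mx 0 (\mxrow_a ((1 + @sig R r _ D a (p (lift ord0 a)) (W (p ord0))) *: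
       mdiff (c (lift ord0 a)) (td_f D a) (p (lift ord0 a)) (blk (lift ord0 a) v)))).
Proof.
move=> cp; have dW := W_mdiffP (blk ord0 v) (cp ord0).
rewrite td_phitildeE add_row_mx addr0 -mxrowD.
have -> : f \o cpar (mchart c) = fun x =>
    row_mx (td_iso D (proj_m (W (cpar (mchart (c ord0)) (blk ord0 x)))))
      (\mxrow_a (td_f D a (cpar (mchart c) x (lift ord0 a)) +
         @nrm R r _ D a (cpar (mchart c) x (lift ord0 a))
           ((W \o cpar (mchart (c ord0))) (blk ord0 x)))).
  by apply/funext => x; rewrite /f /= td_tubeE.
apply: is_derive_row_mx.
  apply: is_derive_linear_comp; first exact: (td_isoP D).1.
  apply: is_derive_linear_comp; first exact: proj_m_linear.
  exact: is_derive_block dW.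
apply: is_derive_mxrow => a.
have dF := @mdiffP_proj R r.+1 M _ (lift ord0 a) _ c p v (@td_f_smooth _ _ _ D a) cp.
apply: is_derive_eq (is_deriveD dF (is_derive_nrm a cp dW)) _.
have pE : cpar (mchart (c ord0)) (ccoord (mchart (c ord0)) (p ord0)) = p ord0.
  exact: ccoordK (cp ord0).
by rewrite /= pE scalerDl scale1r addrCA.
Qed.

Lemma mdiff_td_tube c (p : P) (v : 'rV[R]_(mdim P)) : cdom (mchart c) p ->
  mdiff c f p v =
    td_phitilde (fun a => p (lift ord0 a)) (mdiff (c ord0) f0 (p ord0) (blk ord0 v)) +
     row_mx 0 (\mxrow_a ((1 + @sig R r _ D a (p (lift ord0 a)) (W (p ord0))) *:
       mdiff (c (lift ord0 a)) (td_f D a) (p (lift ord0 a)) (blk (lift ord0 a) v))).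
Proof. by move=> cp; rewrite /mdiff; have [_ ->] := td_tube_mdiffP v cp. Qed.

Lemma td_phitilde_perp c (p : P) (v : forall a, 'rV[R]_(mdim (fac a)))
    (y : 'rV[R]_(td_s D)) (s : 'I_r -> R) : cdom (mchart c) p ->
  dot (td_phitilde (fun a => p (lift ord0 a)) y)
    (row_mx 0 (\mxrow_a (s a *: mdiff (c (lift ord0 a)) (td_f D a) (p (lift ord0 a)) (v a)))) = 0.
Proof.
move=> cp; rewrite td_phitildeE dot_row_mx dot0r add0r dot_mxrow big1 // => a _.
have N := @nrm_normal R r _ D a y _ _ (cp (lift ord0 a)).
by rewrite dotZr dotC N mulr0.
Qed.

Lemma dot_mdiff_td_tube c (p : P) (v w : 'rV[R]_(mdim P)) : cdom (mchart c) p ->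
  dot (mdiff c f p v) (mdiff c f p w) =
  dot (mdiff (c ord0) f0 (p ord0) (blk ord0 v)) (mdiff (c ord0) f0 (p ord0) (blk ord0 w)) +
  \sum_a (1 + @sig R r _ D a (p (lift ord0 a)) (W (p ord0))) ^+ 2 *
    dot (mdiff (c (lift ord0 a)) (td_f D a) (p (lift ord0 a)) (blk (lift ord0 a) v))
        (mdiff (c (lift ord0 a)) (td_f D a) (p (lift ord0 a)) (blk (lift ord0 a) w)).
Proof.
move=> cp; rewrite !mdiff_td_tube // dotDl !dotDr td_phitilde_dot.
rewrite (td_phitilde_perp _ _ _ cp) addr0 [X in _ + (X + _)]dotC (td_phitilde_perp _ _ _ cp).
rewrite add0r dot_row_mx dot0l add0r dot_mxrow; congr (_ + _).
by apply: eq_bigr => a _; rewrite dotZl dotZr mulrA expr2.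
Qed.

Lemma Ck_nrm_block (a : 'I_r) c k :
  Ck k (cimg (mchart c)) (fun x => @nrm R r _ D a (cpar (mchart c) x (lift ord0 a))
     (W (cpar (mchart c) x ord0))).
Proof.
have -> : (fun x => @nrm R r _ D a (cpar (mchart c) x (lift ord0 a)) (W (cpar (mchart c) x ord0))) =
  (fun x => \sum_j (W (cpar (mchart c) x ord0)) 0 j *:
     @nrm R r _ D a (cpar (mchart c) x (lift ord0 a)) (delta_mx 0 j)).
  by apply/funext => x; exact: nrmE.
apply: Ck_summx => [|j]; first exact: cimg_open.
apply: Ck_scale; first exact: cimg_open.
  apply: (Ck_coord 0 j); first exact: cimg_open.
  apply: CkDmx; [exact: cimg_open| |exact: Ck_cst].
  have /msmoothP sf0 := @msmooth_proj R r.+1 M _ ord0 _ f0_imm.1.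
  exact: sf0 c k.
have /msmoothP sN := @msmooth_proj R r.+1 M _ (lift ord0 a) _
  (@nrm_smooth R r _ D a (delta_mx 0 j)).
exact: sN c k.
Qed.

Lemma td_tube_smooth : msmooth f.
Proof.
apply/msmoothP => c k.
have -> : f \o cpar (mchart c) = fun x =>
    row_mx (td_iso D (proj_m (W (cpar (mchart c) x ord0))))
      (\mxrow_a (td_f D a (cpar (mchart c) x (lift ord0 a)) +
         @nrm R r _ D a (cpar (mchart c) x (lift ord0 a)) (W (cpar (mchart c) x ord0)))).
  by apply/funext => x; rewrite /f /= td_tubeE.
apply: Ck_row_mx; first exact: cimg_open.
  apply: Ck_linear_comp; [exact: (td_isoP D).1|exact: cimg_open|].
  apply: Ck_linear_comp; [exact: proj_m_linear|exact: cimg_open|].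
  apply: CkDmx; [exact: cimg_open| |exact: Ck_cst].
  have /msmoothP sf0 := @msmooth_proj R r.+1 M _ ord0 _ f0_imm.1.
  exact: sf0 c k.
apply: Ck_mxrow => [|a]; first exact: cimg_open.
apply: CkDmx; [exact: cimg_open| |exact: Ck_nrm_block].
have /msmoothP sF := @msmooth_proj R r.+1 M _ (lift ord0 a) _ (@td_f_smooth _ _ _ D a).
exact: sF c k.
Qed.

Hypothesis rho0 : forall a (pa : fac a) p0, 1 + @sig R r _ D a pa (W p0) != 0.

(** The squared length of [df v] is a sum of nonnegative terms, one for each block of [v], with
    nonzero coefficients. *)
Lemma td_tube_immersion : immersion f.
Proof.
split; first exact: td_tube_smooth.
move=> c p cp v fv0.
have sq a : 0 <= (1 + @sig R r _ D a (p (lift ord0 a)) (W (p ord0))) ^+ 2 *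
    dot (mdiff (c (lift ord0 a)) (td_f D a) (p (lift ord0 a)) (blk (lift ord0 a) v))
        (mdiff (c (lift ord0 a)) (td_f D a) (p (lift ord0 a)) (blk (lift ord0 a) v)).
  by rewrite mulr_ge0 ?sqr_ge0 ?dot_ge0.
have := dot_mdiff_td_tube v v cp; rewrite fv0 dot0l => /esym/eqP.
rewrite paddr_eq0; last 2 first.
- exact: dot_ge0.
- by apply: sumr_ge0 => a _.
rewrite dot_eq0 psumr_eq0 // => /andP[/eqP v0 /allP va].
apply: blockP => i; rewrite block0; have [j ->|->] := unliftP ord0 i; last first.
  exact: f0_imm.2 (cp ord0) _ v0.
have := va j (mem_index_enum j); rewrite /= mulf_eq0 expf_eq0 /= (negPf (rho0 _ _)) /=.
rewrite dot_eq0 => /eqP; apply: (td_f_immersion D j).2; exact: cp.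
Qed.

(** The preimage has zero base block and the other blocks divided by [1 + sig]. Mixed second
    derivatives of the tube have this form, hence are tangent. *)
Lemma td_tube_tangent c (p : P) (s : 'I_r -> R) (w : 'rV[R]_(mdim P)) : cdom (mchart c) p ->
  exists u, row_mx 0 (\mxrow_a (s a *:
    mdiff (c (lift ord0 a)) (td_f D a) (p (lift ord0 a)) (blk (lift ord0 a) w))) =
  mdiff c f p u.
Proof.
move=> cp; pose t i := if unlift ord0 i is Some a then
  s a / (1 + @sig R r _ D a (p (lift ord0 a)) (W (p ord0))) else 0.
exists (\mxrow_i (t i *: block i w)); rewrite mdiff_td_tube //.
have bE i : blk i (\mxrow_i (t i *: block i w)) = t i *: block i w by exact: mxrowK.
rewrite bE {1}/t unlift_none scale0r.
have -> : mdiff (c ord0) f0 (p ord0) 0 = 0 by exact: derive0.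
have -> : td_phitilde (fun a => p (lift ord0 a)) (0 : 'rV[R]_(td_s D)) = 0.
  apply/eqP; rewrite -dot_eq0 td_phitilde_dot dot0l //.
rewrite add0r; apply: (congr1 (row_mx 0)); apply: eq_mxrow => a.
rewrite bE {1}/t liftK !mdiff_jac; last 4 first.
- exact: td_f_smooth.
- exact: cp.
- exact: td_f_smooth.
- exact: cp.
by rewrite -scalemxAl scalerA mulrC divfK.
Qed.

Let D0 c (w : 'rV[R]_(mdim P)) (y : 'rV[R]_(mdim (M ord0))) : 'rV[R]_(td_s D) :=
  'D_(blk ord0 w) (f0 \o cpar (mchart (c ord0))) y.

Let Df c (w : 'rV[R]_(mdim P)) (a : 'I_r) (y : 'rV[R]_(mdim (fac a))) :=
  'D_(blk (lift ord0 a) w) (td_f D a \o cpar (mchart (c (lift ord0 a)))) y.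

Lemma derive_td_tube c (w : 'rV[R]_(mdim P)) (x : 'rV[R]_(mdim P)) :
  cimg (mchart c) x -> 'D_w (f \o cpar (mchart c)) x =
    row_mx (td_iso D (proj_m (D0 c w (blk ord0 x))))
      (\mxrow_a (@nrm R r _ D a (cpar (mchart c) x (lift ord0 a)) (D0 c w (blk ord0 x)) +
         (1 + @sig R r _ D a (cpar (mchart c) x (lift ord0 a))
           ((W \o cpar (mchart (c ord0))) (blk ord0 x))) *:
         Df c w (blk (lift ord0 a) x))).
Proof.
move=> cx; have := mdiff_td_tube w (cpar_dom cx).
rewrite {1}/mdiff cparK // => ->.
rewrite td_phitildeE add_row_mx addr0 -mxrowD /mdiff.
have E i : ccoord (mchart (c i)) (cpar (mchart c) x i) = blk i x.
  by rewrite -(block_ccoord c (cpar (mchart c) x) i) (cparK cx).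
rewrite E; apply: (congr1 (row_mx _)); apply: eq_mxrow => a; by rewrite E.
Qed.

Lemma mdiff2_td_tube c (p : P) (v w dF : _) : cdom (mchart c) p ->
  is_derive (ccoord (mchart c) p) v (fun x : 'rV[R]_(mdim P) =>
    row_mx (td_iso D (proj_m (D0 c w (blk ord0 x))))
      (\mxrow_a (@nrm R r _ D a (cpar (mchart c) x (lift ord0 a)) (D0 c w (blk ord0 x)) +
         (1 + @sig R r _ D a (cpar (mchart c) x (lift ord0 a))
           ((W \o cpar (mchart (c ord0))) (blk ord0 x))) *:
         Df c w (blk (lift ord0 a) x)))) dF ->
  mdiff2 c f p v w = dF.
Proof.
move=> cp [_ <-]; apply: near_eq_derive.
apply: filterS (open_nbhs_nbhs (conj (@cimg_open _ _ _ (mchart c)) (ccoord_img cp))).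
by move=> x cx; exact: derive_td_tube.
Qed.

(** For [w] in the base, the first derivative is the parallel section with parameter [df_0 w]. This
    parameter stays fixed while [v] moves only the factors, so [nrm_mdiff] gives the second
    derivative. *)
Lemma mdiff2_td_tube_v0 c (p : P) (v w : 'rV[R]_(mdim P)) : cdom (mchart c) p ->
  blk ord0 v = 0 -> (forall a : 'I_r, blk (lift ord0 a) w = 0) ->
  mdiff2 c f p v w = row_mx 0 (\mxrow_a
    (@sig R r _ D a (p (lift ord0 a)) (mdiff (c ord0) f0 (p ord0) (blk ord0 w)) *:
     mdiff (c (lift ord0 a)) (td_f D a) (p (lift ord0 a)) (blk (lift ord0 a) v))).
Proof.
move=> cp v0 w0; apply: mdiff2_td_tube => //.
have dY : is_derive (ccoord (mchart (c ord0)) (p ord0)) (blk ord0 v) (D0 c w) 0.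
  by rewrite v0; exact: is_derive0.
apply: is_derive_row_mx.
  have L0 : td_iso D (proj_m (0 : 'rV[R]_(td_s D))) = 0.
    by rewrite (linear_mulmx _ (td_isoP D).1) /proj_m !raddf0 mul0mx.
  rewrite -L0; apply: is_derive_linear_comp; first exact: (td_isoP D).1.
  apply: is_derive_linear_comp; first exact: proj_m_linear.
  exact: is_derive_block dY.
apply: is_derive_mxrow => a.
have -> : (fun x : 'rV[R]_(mdim P) => @nrm R r _ D a (cpar (mchart c) x (lift ord0 a)) (D0 c w (blk ord0 x)) +
   (1 + @sig R r _ D a (cpar (mchart c) x (lift ord0 a)) ((W \o cpar (mchart (c ord0))) (blk ord0 x))) *:
   Df c w (blk (lift ord0 a) x)) =
   (fun x => @nrm R r _ D a (cpar (mchart c) x (lift ord0 a)) (D0 c w (blk ord0 x))).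
  apply/funext => x; rewrite /Df w0.
  by rewrite (_ : 'D_0 _ _ = 0) ?scaler0 ?addr0 //; exact: derive0.
apply: is_derive_eq (is_derive_nrm a cp dY) _.
rewrite (nrmE _ 0) big1 ?add0r // => j _; by rewrite mxE scale0r.
Qed.

(** For [w] in the factors, the first derivative has blocks [(1 + sig) *: df_a w]. Where [w] has a
    component [v] has none, so only the parameter of [sig] moves, and [sig] is linear in it. *)
Lemma mdiff2_td_tube_w0 c (p : P) (v w : 'rV[R]_(mdim P)) : cdom (mchart c) p ->
  blk ord0 w = 0 ->
  (forall a : 'I_r, blk (lift ord0 a) w = 0 \/ blk (lift ord0 a) v = 0) ->
  mdiff2 c f p v w = row_mx 0 (\mxrow_a
    (@sig R r _ D a (p (lift ord0 a)) (mdiff (c ord0) f0 (p ord0) (blk ord0 v)) *: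
     mdiff (c (lift ord0 a)) (td_f D a) (p (lift ord0 a)) (blk (lift ord0 a) w))).
Proof.
move=> cp w0 vw0; apply: mdiff2_td_tube => //.
have D00 x : D0 c w x = 0 by rewrite /D0 w0; exact: derive0.
have L0 : td_iso D (proj_m (0 : 'rV[R]_(td_s D))) = 0.
  by rewrite (linear_mulmx _ (td_isoP D).1) /proj_m !raddf0 mul0mx.
apply: is_derive_row_mx.
  rewrite (_ : (fun _ => _) = fun=> 0); first exact: is_derive_cst.
  by apply/funext => x; rewrite D00 L0.
apply: is_derive_mxrow => a.
have -> : (fun x : 'rV[R]_(mdim P) => @nrm R r _ D a (cpar (mchart c) x (lift ord0 a)) (D0 c w (blk ord0 x)) +
   (1 + @sig R r _ D a (cpar (mchart c) x (lift ord0 a)) ((W \o cpar (mchart (c ord0))) (blk ord0 x))) *: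
   Df c w (blk (lift ord0 a) x)) =
   (fun x => (1 + \sum_j ((W \o cpar (mchart (c ord0))) (blk ord0 x)) 0 j *
     @sig R r _ D a (cpar (mchart (c (lift ord0 a))) (blk (lift ord0 a) x)) (delta_mx 0 j)) *:
   Df c w (blk (lift ord0 a) x)).
  apply/funext => x; rewrite D00 (nrmE _ 0) big1 ?add0r => [|j _]; last first.
    by rewrite mxE scale0r.
  by rewrite (@sigE R r _ D a (cpar (mchart c) x (lift ord0 a))).
have [wa0|va0] := vw0 a.
  have D0w x : Df c w x = 0 :> 'rV[R]_(td_N D a) by rewrite /Df wa0; exact: derive0.
  rewrite (_ : (fun _ => _) = fun=> 0); last first.
    by apply/funext => x; rewrite D0w scaler0.
  have -> : mdiff (c (lift ord0 a)) (td_f D a) (p (lift ord0 a)) (blk (lift ord0 a) w) = 0.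
    by rewrite wa0; exact: derive0.
  by rewrite scaler0; exact: is_derive_cst.
have dW := W_mdiffP (blk ord0 v) (cp ord0).
have cst0 (X : normedModType R) (G : 'rV[R]_(mdim (fac a)) -> X) :
    is_derive (ccoord (mchart c) p) v (fun x => G (blk (lift ord0 a) x)) 0.
  by apply: is_derive_block; rewrite va0; exact: is_derive0.
have dWj j := (is_derive_mxP _ _ _ _).1 (is_derive_block (c := c) (p := p) dW) 0 j.
have dS : is_derive (ccoord (mchart c) p) v (fun x : 'rV[R]_(mdim P) =>
    1 + \sum_j ((W \o cpar (mchart (c ord0))) (blk ord0 x)) 0 j *
     @sig R r _ D a (cpar (mchart (c (lift ord0 a))) (blk (lift ord0 a) x)) (delta_mx 0 j))
  (@sig R r _ D a (p (lift ord0 a)) (mdiff (c ord0) f0 (p ord0) (blk ord0 v))).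
  rewrite -[sig _ _]add0r; apply: is_deriveD.
  rewrite sigE; apply: is_derive_bigsum => j.
  have := is_derive_mul (dWj j) (cst0 _ (fun y =>
    @sig R r _ D a (cpar (mchart (c (lift ord0 a))) y) (delta_mx 0 j))).
  rewrite mulr0 addr0 block_ccoord.
  by rewrite (_ : cpar (mchart (c (lift ord0 a))) _ = p (lift ord0 a)) // ccoordK //; exact: cp.
have := is_derive_scale dS (cst0 _ (fun y => Df c w y)).
rewrite scaler0 addr0 block_ccoord; exact.
Qed.

Lemma td_tube_adapted : adapted f.
Proof.
move=> i j ij c p cp v w vi wj; rewrite /second_fundamental_form.
suff [u ->] : exists u, mdiff2 c f p v w = mdiff c f p u.
  exact: (normal_part_mdiff td_tube_immersion _ cp).
have v0 a : a != i -> blk a v = 0 by exact: vi.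
have w0 a : a != j -> blk a w = 0 by exact: wj.
have [j0|j0] := eqVneq j ord0.
  rewrite mdiff2_td_tube_v0 //.
  - exact: td_tube_tangent.
  - by apply: v0; rewrite eq_sym -j0.
  - by move=> a; apply: w0; rewrite j0 eq_sym neq_lift.
rewrite mdiff2_td_tube_w0 //.
- exact: td_tube_tangent.
- by apply: w0; rewrite eq_sym.
- move=> a; have [aj|aj] := eqVneq (lift ord0 a) j; last by left; exact: w0.
  by right; apply: v0; rewrite aj eq_sym.
Qed.

(** On a curve [sig] involves a chart chosen separately at every point, which hides its smoothness.
    By [nrm_mdiff] it is also the quotient of [dot (d nrm e) (df_a e)] by [dot (df_a e) (df_a e)] in
    any fixed chart. *)
Lemma sig_chart_smooth (a : 'I_r) (ca : mindex (fac a)) y k :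
  Ck k (cimg (mchart ca)) (fun x => @sig R r _ D a (cpar (mchart ca) x) y).
Proof.
rewrite /sig; case: (boolP (a < _)%N) => [_|ak]; first exact: Ck_cst.
case: (boolP (a < _)%N) => [al|_]; last exact: Ck_cst.
have a1 := td_curve (curve_range (negbTE ak) al).
pose e : 'rV[R]_(mdim (fac a)) := const_mx 1.
have e0 : e != 0.
  rewrite /e a1; apply/eqP => /matrixP/(_ 0 0); rewrite !mxE => /eqP.
  by rewrite oner_eq0.
pose N q := @nrm R r _ D a q y.
have [sf inj] := td_f_immersion D a.
have /msmoothP sN := @nrm_smooth R r _ D a y.
have CF j : Ck j (cimg (mchart ca)) (fun x => 'D_e (td_f D a \o cpar (mchart ca)) x).
  by move/msmoothP: sf => /(_ ca j.+1); exact: Ck_derive.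
have CN j : Ck j (cimg (mchart ca)) (fun x => 'D_e (N \o cpar (mchart ca)) x).
  by apply: Ck_derive; exact: sN.
have nz x : cimg (mchart ca) x -> dot ('D_e (td_f D a \o cpar (mchart ca)) x)
    ('D_e (td_f D a \o cpar (mchart ca)) x) != 0.
  move=> cx; rewrite dot_eq0; apply: contraNneq e0 => E; apply/eqP.
  by apply: (inj _ _ (cpar_dom cx)); rewrite /mdiff cparK.
apply: (@eq_Ck _ _ _ _ _ (fun x =>
  (dot ('D_e (N \o cpar (mchart ca)) x) ('D_e (td_f D a \o cpar (mchart ca)) x)) *
  (dot ('D_e (td_f D a \o cpar (mchart ca)) x) ('D_e (td_f D a \o cpar (mchart ca)) x))^-1)).
- exact: cimg_open.
- move=> x cx; have := @nrm_mdiff R r _ D a y _ _ e (cpar_dom cx).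
  rewrite /mdiff cparK // => ->; rewrite dotZl mulfK; last exact: nz.
  by rewrite /sig (negbTE ak) al.
- apply: CkM; first exact: cimg_open.
    by apply: Ck_dot => //; exact: cimg_open.
  apply: CkV => //; first exact: cimg_open.
  by apply: Ck_dot => //; exact: cimg_open.
Qed.

Lemma td_rho_smooth (a : 'I_r) (c0 : mindex (M ord0)) (ca : mindex (fac a)) k :
  Ck k (cimg (mchart c0) `*` cimg (mchart ca))
   (fun z : 'rV[R]_(mdim (M ord0)) * 'rV[R]_(mdim (fac a)) =>
      td_rho f0 (cpar (mchart c0) z.1) (cpar (mchart ca) z.2)).
Proof.
have oU : open (cimg (mchart c0) `*` cimg (mchart ca)).
  rewrite openE => -[x y] [/= cx cy]; exists (cimg (mchart c0), cimg (mchart ca)) => //.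
  by split; apply: open_nbhs_nbhs; split=> //; exact: cimg_open.
have -> : (fun z : 'rV[R]_(mdim (M ord0)) * 'rV[R]_(mdim (fac a)) =>
      td_rho f0 (cpar (mchart c0) z.1) (cpar (mchart ca) z.2)) =
  (fun z => 1 + \sum_j (W (cpar (mchart c0) z.1)) 0 j *
     @sig R r _ D a (cpar (mchart ca) z.2) (delta_mx 0 j)).
  by apply/funext => z; rewrite td_rhoE sigE.
apply: CkD => //; first exact: Ck_cst.
apply: Ck_sum => // j; apply: CkM => //.
  have C0 : Ck k (cimg (mchart c0)) (fun x => (W (cpar (mchart c0) x)) 0 j).
    apply: (Ck_coord 0 j); first exact: cimg_open.
    apply: CkDmx; [exact: cimg_open| |exact: Ck_cst].
    by have /msmoothP := f0_imm.1; exact.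
  have c1 : continuous (@fst 'rV[R]_(mdim (M ord0)) 'rV[R]_(mdim (fac a))).
    by move=> z; exact: cvg_fst.
  have := Ck_comp_linear (P := @fst 'rV[R]_(mdim (M ord0)) 'rV[R]_(mdim (fac a)))
    (fun _ _ _ => erefl) c1 C0.
  by apply: sub_Ck => z [].
have c2 : continuous (@snd 'rV[R]_(mdim (M ord0)) 'rV[R]_(mdim (fac a))).
  by move=> z; exact: cvg_snd.
have := Ck_comp_linear (P := @snd 'rV[R]_(mdim (M ord0)) 'rV[R]_(mdim (fac a)))
    (fun _ _ _ => erefl) c2 (@sig_chart_smooth a ca (delta_mx 0 j) k).
by apply: sub_Ck => z [].
Qed.

(** Only squares of warping functions enter the metric, so a single statement covers [td_rho] and
    its absolute value. *)
Lemma td_tube_quasi_warped (rho : forall a, M ord0 -> fac a -> R) :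
  (forall a, warping_function (@rho a)) ->
  (forall a p0 pa, @rho a p0 pa ^+ 2 = td_rho f0 p0 pa ^+ 2) ->
  is_quasi_warped (induced_metric f) (induced_metric f0)
    (fun a => induced_metric (td_f D a)) rho.
Proof.
move=> wrho rhoE; split=> // c p cp v w.
rewrite /induced_metric dot_mdiff_td_tube // /quasi_warped_metric; congr (_ + _).
by apply: eq_bigr => a _; rewrite rhoE td_rhoE.
Qed.

End Direct.

Lemma warping_function_norm (R : realType) (M0 M1 : manifold R) (rho : M0 -> M1 -> R) :
  (forall p0 p1, rho p0 p1 != 0) ->
  (forall (c0 : mindex M0) (c1 : mindex M1) k,
    Ck k (cimg (mchart c0) `*` cimg (mchart c1))
      (fun z : 'rV[R]_(mdim M0) * 'rV[R]_(mdim M1) =>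
         rho (cpar (mchart c0) z.1) (cpar (mchart c1) z.2))) ->
  warping_function (fun p0 p1 => `|rho p0 p1|).
Proof.
move=> rho0 srho; split=> [p0 p1|c0 c1 k]; first by rewrite normr_gt0.
apply: Ck_norm => //.
rewrite openE => -[x y] [/= cx cy]; exists (cimg (mchart c0), cimg (mchart c1)) => //.
by split; apply: open_nbhs_nbhs; split=> //; exact: cimg_open.
Qed.

(** Nonsingularity of [I - A] excludes the value [0] of [td_rho] but leaves its sign open, hence the
    two forms of the conclusion. *)
Lemma partial_tube_quasi_warped (R : realType) (r : nat) (M : 'I_r.+1 -> manifold R)
  (M_nonempty : forall i, [set: M i] !=set0)
  (M_dim_gt0 : forall a : 'I_r, (0 < mdim (M (lift ord0 a)))%N)
  (D : tube_data (fun a : 'I_r => M (lift ord0 a))) (f0 : M ord0 -> 'rV[R]_(td_s D)) :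
  admissible_f0 f0 ->
  let f (p : prod_manifold M) :=
    td_tube f0 (p ord0) (fun a => p (lift ord0 a)) in
  let G := induced_metric f in
  let g0 := induced_metric f0 in
  let g a := induced_metric (td_f D a) in
  let rho := td_rho f0 in
  [/\ immersion f,
      is_quasi_warped G g0 g (fun a p0 pa => `|rho a p0 pa|),
      (forall a p0 pa, 0 < rho a p0 pa) -> is_quasi_warped G g0 g rho
    & adapted f].
Proof.
move=> [f0_imm OmW] f G g0 g rho.
have rho0 (a : 'I_r) (pa : M (lift ord0 a)) p0 :
    1 + @sig R r _ D a pa (f0 p0 - td_shift D) != 0.
  exact: Omega_neq0 (OmW p0) a pa.
have rhon0 a p0 pa : rho a p0 pa != 0 by rewrite /rho td_rhoE.
have srho a c0 ca k := td_rho_smooth f0_imm (a := a) c0 ca k.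
split.
- exact: td_tube_immersion.
- apply: td_tube_quasi_warped => // a.
    exact: warping_function_norm.
  by move=> p0 pa; rewrite real_normK // num_real.
- move=> rho_gt0; apply: td_tube_quasi_warped => // a.
  by split=> [|c0 ca k]; [exact: rho_gt0|exact: srho].
- exact: td_tube_adapted.
Qed.

(** * Parallel normal sections *)

Section SmoothMaps.
Variables (R : realType) (M : manifold R) (n : nat).
Implicit Types (F G : M -> 'rV[R]_n) (c : mindex M).

Lemma msmooth_cst (a : 'rV[R]_n) : msmooth (fun _ : M => a).
Proof. by apply/msmoothP => c k; exact: Ck_cst. Qed.

Lemma msmooth_lin (a : R) F G : msmooth F -> msmooth G -> msmooth (fun p => a *: F p + G p).
Proof.
move=> /msmoothP sF /msmoothP sG; apply/msmoothP => c k.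
apply: CkDmx; [exact: cimg_open| |exact: sG].
by apply: Ck_scale; [exact: cimg_open|exact: Ck_cst|exact: sF].
Qed.

Lemma mdiff_lin (a : R) F G c p v : msmooth F -> msmooth G -> cdom (mchart c) p ->
  mdiff c (fun p => a *: F p + G p) p v = a *: mdiff c F p v + mdiff c G p v.
Proof.
move=> sF sG cp; rewrite /mdiff.
have H := is_deriveD (is_derive_scale (is_derive_cst a (ccoord (mchart c) p) v)
  (mdiffP v sF cp)) (mdiffP v sG cp).
by have [_] := H; rewrite scale0r add0r => <-.
Qed.

Lemma msmooth_mulmx m F (A : 'M[R]_(n, m)) : msmooth F -> msmooth (fun p => F p *m A).
Proof.
by move=> /msmoothP sF; apply/msmoothP => c k; apply: Ck_mulmx; [exact: cimg_open|exact: sF].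
Qed.

Lemma mdiff_mulmx m F (A : 'M[R]_(n, m)) c p v : msmooth F -> cdom (mchart c) p ->
  mdiff c (fun p => F p *m A) p v = mdiff c F p v *m A.
Proof.
by move=> sF cp; rewrite {1}/mdiff; have [_ ->] := is_derive_mulmx A (mdiffP v sF cp).
Qed.

Lemma mconst_mdiff F : connected [set: M] -> msmooth F ->
  (forall c p v, cdom (mchart c) p -> mdiff c F p v = 0) -> forall p q, F p = F q.
Proof.
move=> cM sF dF; apply: mconst => // c y cy u.
have cp := cpar_dom cy; rewrite -(dF c _ u cp) -{1}(cparK cy).
exact: mdiffP.
Qed.

Lemma mconst_real (F : M -> R) : connected [set: M] ->
  (forall c y, cimg (mchart c) y -> forall u, is_derive y u (F \o cpar (mchart c)) 0) ->
  forall p q, F p = F q.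
Proof.
move=> cM dF p q.
have /matrixP/(_ 0 0) : (const_mx (F p) : 'M[R]_(1, 1)) = const_mx (F q).
  apply: (@mconst R M 1 1 (fun p => const_mx (F p)) cM) => c y cy u.
  apply/is_derive_mxP => i j; rewrite mxE.
  rewrite (_ : (fun _ => _) = F \o cpar (mchart c)); first exact: dF.
  by apply/funext => x /=; rewrite mxE.
by rewrite !mxE.
Qed.

End SmoothMaps.

Section ParallelSections.
Variables (R : realType) (M : manifold R) (n : nat) (h : M -> 'rV[R]_n).
Hypothesis imm : immersion h.
Hypothesis connM : connected [set: M].
Implicit Types (s t : M -> 'rV[R]_n).

Lemma parallel_normal s c p v : parallel_on h setT s -> cdom (mchart c) p ->
  dot (mdiff c h p v) (s p) = 0.
Proof. by move=> ps cp; exact: (ps.2 _ _ cp Logic.I).1. Qed.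

Lemma parallel0 : parallel_on h setT (fun _ => 0).
Proof.
apply: (parallelI imm) => [|c p cp v|c p v cp]; first exact: msmooth_cst.
  by rewrite dot0r.
by exists 0; rewrite mdiff_cst; exact/esym/derive0.
Qed.

Lemma parallel_lin (a : R) s t : parallel_on h setT s -> parallel_on h setT t ->
  parallel_on h setT (fun p => a *: s p + t p).
Proof.
move=> ps pt; apply: (parallelI imm) => [|c p cp v|c p v cp].
- exact: msmooth_lin ps.1 pt.1.
- by rewrite dotDr dotZr !(parallel_normal _ _ cp) // mulr0 addr0.
have [u Eu] := parallel_mdiff imm v ps cp; have [w Ew] := parallel_mdiff imm v pt cp.
exists (a *: u + w); rewrite (mdiff_lin _ _ ps.1 pt.1 cp) Eu Ew.
by rewrite (mdiff_linear imm.1 cp).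
Qed.

(** The derivatives of parallel sections are tangent and the sections normal, so both terms of the
    product rule vanish. *)
Lemma parallel_dot s t p q : parallel_on h setT s -> parallel_on h setT t ->
  dot (s p) (t p) = dot (s q) (t q).
Proof.
move=> ps pt; apply: (mconst_real (F := fun p => dot (s p) (t p))) => // c y cy v.
have cp := cpar_dom cy; have := mdiff_dot v ps.1 pt.1 cp; rewrite cparK //.
have [u ->] := parallel_mdiff imm v ps cp; have [w ->] := parallel_mdiff imm v pt cp.
by rewrite (dotC (s _)) !(parallel_normal _ _ cp) // addr0.
Qed.

(* A parallel normal section is determined by its value at [o], and the
   possible values form a subspace; [C] is an orthonormal basis of it. *)
Lemma maximal_flat_subbundle (o : M) :
  exists (m : nat) (E : M -> 'M[R]_n) (phi : M -> 'rV[R]_m -> 'rV[R]_n) (C : 'M[R]_(m, n)),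
  [/\ flat_parallel_subbundle h m E, parallel_bundle_isometry h E phi
    & forall s, parallel_on h setT s -> forall p, s p = phi p (s o *m C^T)].
Proof.
pose S : set 'rV[R]_n := [set x | exists s, parallel_on h setT s /\ s o = x].
have S0 : S 0 by exists (fun _ => 0); split; first exact: parallel0.
have SD a u v : S u -> S v -> S (a *: u + v).
  move=> [s [ps <-]] [t [pt <-]]; exists (fun p => a *: s p + t p).
  by split; first exact: parallel_lin.
have [m [C [C1 SC]]] := subspace_onb S0 SD.
have Sj j : S (row j C).
  by apply: (SC (row j C)).2; rewrite rowE -(mulmxA (delta_mx 0 j)) C1 mulmx1.
pose s j := projT1 (cid (Sj j)).
have ps j : parallel_on h setT (s j) by rewrite /s; case: cid => ? [].
have so j : s j o = row j C by rewrite /s; case: cid => ? [].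
pose Z p := \matrix_j s j p.
(* Inner products of parallel sections are constant, so orthonormality at [o] persists at every
   point. *)
have ZZ p : Z p *m (Z p)^T = 1%:M.
  rewrite -C1; apply/matrixP => i j.
  transitivity (dot (s i p) (s j p)).
    by rewrite dotE mxE; apply: eq_bigr => k _; rewrite !mxE.
  rewrite (parallel_dot p o (ps i) (ps j)) !so dotE mxE.
  by apply: eq_bigr => k _; rewrite !mxE.
have Eqp p y : y *m Z p = \sum_j y 0 j *: s j p.
  by rewrite mulmx_sum_row; apply: eq_bigr => j _; rewrite rowK.
have pZ y : parallel_on h setT (fun p => y *m Z p).
  rewrite (_ : (fun _ => _) = fun p => \sum_j y 0 j *: s j p); last exact/funext.
  elim: (index_enum _) => [|j l IH].
    rewrite (_ : (fun _ => _) = fun=> 0); first exact: parallel0.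
    by apply/funext => p; rewrite big_nil.
  rewrite (_ : (fun _ => _) = fun p => y 0 j *: s j p + \sum_(j <- l) y 0 j *: s j p).
    exact (parallel_lin (y 0 j) (ps j) IH).
  by apply/funext => p; rewrite big_cons.
(* [<<Z p>>] is a square matrix with the row space of [Z p], the format in which subbundles are
   encoded. *)
exists m, (fun p => <<Z p>>%MS), (fun p y => y *m Z p), C; split.
- move=> p; exists setT, s; split; [exact: openT|by []|exact ps|].
  move=> q _; split; last exact: genmxE.
  rewrite mxrank_gen; apply/eqP; rewrite -/(row_free _).
  by apply/row_freeP; exists (Z q)^T.
- split=> [p|p u|y]; last exact: pZ.
    split=> [a u v|u v]; first by rewrite mulmxDl scalemxAl.
    by rewrite dot_mulmxl -mulmxA ZZ mulmx1.
  rewrite genmxE; split=> [/submxP[y ->]|[y <-]]; first by exists y.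
  exact: submxMl.
(* The difference from the section with the same value at [o] is parallel, hence of constant norm,
   and it vanishes at [o]. *)
move=> t pt p; pose d q := -1 *: (t o *m C^T *m Z q) + t q.
have pd : parallel_on h setT d by exact (parallel_lin (-1) (pZ (t o *m C^T)) pt).
have ZoC : Z o = C by apply/row_matrixP => j; rewrite rowK so.
have d0 : d o = 0.
  have E : t o = t o *m C^T *m C by apply: (SC (t o)).1; exists t.
  by rewrite /d ZoC -E scaleN1r addNr.
have := parallel_dot p o pd pd; rewrite d0 dot0l => /eqP; rewrite dot_eq0 /d.
by rewrite scaleN1r addrC subr_eq0 => /eqP.
Qed.

End ParallelSections.

(** * Families of immersions of one factor *)

(* The shapes a family [X] of maps of a factor [M1], parametrized by [M0], can
   take in a partial tube: [ff_kind] is [0] for a spherical factor, [1] for a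
   curve moved along its parallel normal sections, and [2] for a fixed map.
   Fields irrelevant to the kind are arbitrary, except that [ff_n] is [0]. *)
Record factor_form (R : realType) (M0 M1 : manifold R) (n : nat)
    (X : M0 -> M1 -> 'rV[R]_n) := FactorForm {
  ff_kind : nat;
  ff_f : M1 -> 'rV[R]_n;
  ff_z : 'rV[R]_n;
  ff_R : R;
  ff_L : M0 -> R;
  ff_n : nat;
  ff_E : M1 -> 'M[R]_n;
  ff_phi : M1 -> 'rV[R]_ff_n -> 'rV[R]_n;
  ff_y : M0 -> 'rV[R]_ff_n;
  ff_imm : immersion ff_f;
  ff_L_smooth : forall c k, Ck k (cimg (mchart c)) (ff_L \o cpar (mchart c));
  ff_y_smooth : msmooth ff_y;
  ff_sphere : ff_kind = 0%N -> 0 < ff_R /\ forall p, dot (ff_f p) (ff_f p) = ff_R ^+ 2;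
  ff_curve : ff_kind = 1%N -> [/\ mdim M1 = 1%N, flat_parallel_subbundle ff_f ff_n ff_E
     & parallel_bundle_isometry ff_f ff_E ff_phi];
  ff_n0 : ff_kind != 1%N -> ff_n = 0%N;
  ff_eq : forall p0 p1, X p0 p1 = ff_z +
    (if ff_kind == 0%N then ff_L p0 *: ff_f p1
     else if ff_kind == 1%N then ff_f p1 + ff_phi p1 (ff_y p0)
     else ff_f p1) }.

Section OneFactor.
Variables (R : realType) (M0 M1 : manifold R) (n : nat).
Variables (X : M0 -> M1 -> 'rV[R]_n) (lam : M0 -> M1 -> R) (o0 : M0) (o1 : M1).
Let h := X o0.
Hypothesis conn0 : connected [set: M0].
Hypothesis conn1 : connected [set: M1].
Hypothesis dim1 : (0 < mdim M1)%N.
Hypothesis X_smooth0 : forall p1, msmooth (fun p0 => X p0 p1).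
Hypothesis X_smooth1 : forall p0, msmooth (X p0).
Hypothesis lam_smooth0 : forall p1 c k, Ck k (cimg (mchart c)) (fun y => lam (cpar (mchart c) y) p1).
Hypothesis lam_smooth1 : forall p0 c k, Ck k (cimg (mchart c)) (fun y => lam p0 (cpar (mchart c) y)).
Hypothesis X_mdiff : forall p0 c p1 v, cdom (mchart c) p1 ->
  mdiff c (X p0) p1 v = lam p0 p1 *: mdiff c h p1 v.
Hypothesis X_perp : forall c0 p0 u c1 p1 v, cdom (mchart c0) p0 -> cdom (mchart c1) p1 ->
  dot (mdiff c0 (fun q => X q p1) p0 u) (mdiff c1 h p1 v) = 0.
Hypothesis h_imm : immersion h.
Hypothesis h_full : forall y, (forall c p v, cdom (mchart c) p -> dot y (mdiff c h p v) = 0) ->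
  y = 0.

(** By [X_perp] the product of [X q p1] with a tangent vector of [h] is constant in [q]; compare
    [q = p0] with [q = o0]. *)
Lemma eta_perp p0 c p1 v : cdom (mchart c) p1 ->
  dot (X p0 p1 - h p1) (mdiff c h p1 v) = 0.
Proof.
move=> cp; rewrite dotBl; apply/eqP; rewrite subr_eq0; apply/eqP.
apply: (mconst_real (F := fun q => dot (X q p1) (mdiff c h p1 v)) conn0) => c0 y cy u.
have cp0 := cpar_dom cy.
have H := is_derive_dot (mdiffP u (X_smooth0 p1) cp0)
  (is_derive_cst (mdiff c h p1 v) (ccoord (mchart c0) (cpar (mchart c0) y)) u).
by have := H; rewrite dot0r addr0 X_perp // cparK.
Qed.

Lemma dim1_form : mdim M1 = 1%N -> inhabited (factor_form X).
Proof.
move=> M11.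
have [m [E [phi [C [flatE isoE parE]]]]] := maximal_flat_subbundle h_imm conn1 o1.
have sh := h_imm.1.
have eta_lin p0 : (fun p1 => -1 *: h p1 + X p0 p1) = (fun p1 => X p0 p1 - h p1).
  by apply/funext => p; rewrite scaleN1r addrC.
have par p0 : parallel_on h setT (fun p1 => X p0 p1 - h p1).
  rewrite -eta_lin; apply: (parallelI h_imm).
  - exact: msmooth_lin.
  - move=> c p cp v; rewrite scaleN1r addrC dotC; exact: eta_perp.
  - move=> c p v cp; exists ((lam p0 p - 1) *: v).
    rewrite mdiff_lin // X_mdiff // !mdiff_jac // -scalemxAl scaleN1r scalerBl scale1r.
    exact: addrC.
(* A parallel section is recorded by its value at [o1] in the basis [C], which makes smoothness in
   [p0] immediate. *)
pose y p0 := (X p0 o1 - h o1) *m C^T.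
split; apply: (@FactorForm R M0 M1 n X 1 h 0 0 (fun _ => 0) m E phi y).
- exact: h_imm.
- by move=> c k; exact: Ck_cst.
- apply: msmooth_mulmx; rewrite (_ : (fun _ => _) = fun p0 => 1 *: X p0 o1 + - h o1).
    by apply: msmooth_lin => //; exact: msmooth_cst.
  by apply/funext => p; rewrite scale1r.
- by [].
- by [].
- by [].
move=> p0 p1; rewrite add0r /= -(parE _ (par p0) p1) addrCA subrr addr0 //.
Qed.

(** Differentiating [dX = lam *: dh] once more and using symmetry of the second derivatives of both
    [X p0] and [h] gives [dlam(v) *: w = dlam(w) *: v] for all [v] and [w]. *)
Lemma derive_lam0 p0 c x u : (1 < mdim M1)%N -> cimg (mchart c) x ->
  'D_u (fun y => lam p0 (cpar (mchart c) y)) x = 0.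
Proof.
move=> d2 cx; pose H := h \o cpar (mchart c); pose Y := X p0 \o cpar (mchart c).
pose l y := lam p0 (cpar (mchart c) y).
have oU := @cimg_open _ _ _ (mchart c).
have DY v y : cimg (mchart c) y -> 'D_v Y y = l y *: 'D_v H y.
  by move=> cy; have := X_mdiff p0 v (cpar_dom cy); rewrite /mdiff cparK.
have CH : Ck 2 (cimg (mchart c)) H by move/msmoothP: h_imm.1 => /(_ c 2%N).
have CY : Ck 2 (cimg (mchart c)) Y by move/msmoothP: (X_smooth1 p0) => /(_ c 2%N).
have dl v : is_derive x v l ('D_v l x).
  by apply: derivableP; exact: (Ck_derivable (lam_smooth1 p0 c 1) cx).
have dDH v w : is_derive x v (fun y => 'D_w H y) ('D_v (fun y => 'D_w H y) x).
  apply: derivableP.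
  have CD : Ck 1 (cimg (mchart c)) (fun y => 'D_w H y) by exact: Ck_derive.
  exact: (Ck_derivable CD cx).
have DD v w : 'D_v (fun y => 'D_w Y y) x =
    'D_v l x *: 'D_w H x + l x *: 'D_v (fun y => 'D_w H y) x.
  have [_ <-] := is_derive_scale (dl v) (dDH v w).
  apply: near_eq_derive; apply: filterS (open_nbhs_nbhs (conj oU cx)) => y.
  exact: DY.
have sym v w : 'D_v l x *: 'D_w H x = 'D_w l x *: 'D_v H x.
  have E1 := derive_mx_sym v w oU cx CY; have E2 := derive_mx_sym v w oU cx CH.
  have aux (a b d e : 'rV[R]_n) : a + d = b + e -> d = e -> a = b.
    by move=> ab de; move: ab; rewrite de; exact: addIr.
  exact (aux _ _ _ _ (etrans (esym (DD v w)) (etrans E1 (DD w v)))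
    (congr1 (fun a => l x *: a) E2)).
have lin v w : 'D_v l x *: w = 'D_w l x *: v.
  apply/eqP; rewrite -subr_eq0; apply/eqP.
  apply: (h_imm.2 _ _ (cpar_dom cx)).
  rewrite mdiff_jac ?h_imm.1 //; last exact: cpar_dom; last exact: h_imm.1.
  have J w' : 'D_w' H x = w' *m jac h c (cpar (mchart c) x).
    rewrite -(mdiff_jac _ h_imm.1 (cpar_dom cx)) /mdiff cparK //.
  by rewrite mulmxBl -!scalemxAl -!J sym subrr.
(* Otherwise every [w] would be a multiple of [u], which two distinct basis vectors cannot both
   be. *)
apply/eqP/negPn/negP => u0.
have span w : w = ('D_w l x / 'D_u l x) *: u.
  by rewrite mulrC -scalerA -lin scalerA mulVf ?scale1r.
pose i0 : 'I_(mdim M1) := Ordinal dim1; pose i1 : 'I_(mdim M1) := Ordinal d2.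
have S0 := span (delta_mx 0 i0); have S1 := span (delta_mx 0 i1).
move: S0 S1; set a := _ / _; set b := _ / _ => S0 S1.
have /rowP/(_ i0) := S0; rewrite !mxE !eqxx /= => E00.
have /rowP/(_ i0) := S1; rewrite !mxE /= => E10.
have /rowP/(_ i1) := S1; rewrite !mxE !eqxx /= => E11.
have u00 : u 0 i0 != 0.
  by apply/eqP => E; move: E00; rewrite E mulr0 => /eqP; rewrite oner_eq0.
have b0 : b = 0.
  by move/esym/eqP: E10; rewrite mulf_eq0 (negPf u00) orbF => /eqP.
by move/eqP: E11; rewrite b0 mul0r oner_eq0.
Qed.

Lemma dim2_form : (1 < mdim M1)%N -> inhabited (factor_form X).
Proof.
move=> d2; have sh := h_imm.1.
pose L p0 := lam p0 o1.
have lamE p0 p1 : lam p0 p1 = L p0.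
  apply: (mconst_real (F := lam p0) conn1) => c y cy u.
  rewrite -(derive_lam0 p0 u d2 cy); apply: derivableP.
  exact: (Ck_derivable (lam_smooth1 p0 c 1) cy).
pose kap p0 := X p0 o1 - L p0 *: h o1.
have XE p0 p1 : X p0 p1 = L p0 *: h p1 + kap p0.
  have E : - L p0 *: h p1 + X p0 p1 = - L p0 *: h o1 + X p0 o1.
    apply: (mconst_mdiff (F := fun p => - L p0 *: h p + X p0 p) conn1).
      exact: msmooth_lin sh (X_smooth1 p0).
    move=> c p v cp; rewrite (mdiff_lin _ _ sh (X_smooth1 p0) cp) (X_mdiff p0 v cp).
    by rewrite lamE scaleNr addNr.
  by rewrite /kap [X p0 o1 - _]addrC -scaleNr -E scaleNr addrA subrr add0r.
have kap_perp p0 c p v : cdom (mchart c) p ->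
    dot ((L p0 - 1) *: h p + kap p0) (mdiff c h p v) = 0.
  move=> cp; rewrite -(eta_perp p0 v cp) XE; congr dot.
  by rewrite scalerBl scale1r addrAC.
have [Lne|L1] := pselect (exists p0, L p0 != 1).
  (* By [kap_perp] the vector [(L p - 1) *: h q + kap p] is normal to [h]. It equals
     [(L p - 1) *: (h q - z)] for this [z], so [h - z] is normal and has constant norm. *)
  have [p Lp] := Lne; pose z := - ((L p - 1)^-1 *: kap p).
  have Lp1 : L p - 1 != 0 by rewrite subr_eq0.
  pose k q := h q - z.
  have k_lin : k = fun q => 1 *: h q + - z by apply/funext => q; rewrite scale1r.
  have sk : msmooth k by rewrite k_lin; apply: msmooth_lin => //; exact: msmooth_cst.
  have dk c q v : cdom (mchart c) q -> mdiff c k q v = mdiff c h q v.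
    move=> cq; rewrite k_lin mdiff_lin //; last exact: msmooth_cst.
    by rewrite scale1r mdiff_cst addr0.
  have k_perp c q v : cdom (mchart c) q -> dot (k q) (mdiff c h q v) = 0.
    move=> cq; have := kap_perp p c q v cq.
    have -> : (L p - 1) *: h q + kap p = (L p - 1) *: k q.
      by rewrite /k /z opprK scalerDr scalerA mulfV // scale1r.
    by rewrite dotZl => /eqP; rewrite mulf_eq0 (negPf Lp1) /= => /eqP.
  have k_const q : dot (k q) (k q) = dot (k o1) (k o1).
    apply: (mconst_real (F := fun x => dot (k x) (k x)) conn1) => c y cy v.
    have cq := cpar_dom cy; have := mdiff_dot v sk sk cq.
    rewrite (dk _ _ _ cq) (dotC (mdiff _ _ _ _)) (k_perp _ _ _ cq) addr0 cparK //.
  (* Radius zero would make [h] constant, while [h] is an immersion in positive dimension. *)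
  have k1 : 0 < dot (k o1) (k o1).
    rewrite lt_def dot_ge0 andbT; apply/eqP => k0.
    have kz x : k x = 0 by apply/eqP; rewrite -dot_eq0 k_const k0.
    have c1 := mchart_atP o1.
    have e0 : (const_mx 1 : 'rV[R]_(mdim M1)) = 0.
      apply: (h_imm.2 _ _ c1); rewrite -dk //.
      by rewrite (_ : k = fun=> 0) ?mdiff_cst //; exact/funext.
    have /matrixP/(_ 0 (Ordinal dim1)) := e0; rewrite !mxE => /eqP.
    by rewrite oner_eq0.
  (* The center found from the single [p] serves all [q]: the difference of the two sides is
     orthogonal to every tangent vector of [h], hence zero by [h_full]. *)
  have kapE q : kap q = (1 - L q) *: z.
    apply/eqP; rewrite -subr_eq0; apply/eqP; apply: h_full => c x v cx.
    have -> : kap q - (1 - L q) *: z = ((L q - 1) *: h x + kap q) - (L q - 1) *: k x.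
      by apply/rowP => i; rewrite !mxE; ring.
    by rewrite dotBl kap_perp // dotZl k_perp // mulr0 subr0.
  (* [L q *: h + (1 - L q) *: z] is [z + L q *: (h - z)], a homothety with center [z]. *)
  split; apply: (@FactorForm R M0 M1 n X 0 k z (Num.sqrt (dot (k o1) (k o1))) L 0
    (fun _ => 0) (fun _ _ => 0) (fun _ => 0)).
  - by split=> [|c q cq v]; [exact: sk|rewrite dk //; exact: h_imm.2].
  - by move=> c j; exact: lam_smooth0.
  - exact: msmooth_cst.
  - by move=> _; rewrite sqrtr_gt0; split=> // q; rewrite sqr_sqrtr ?ltW.
  - by [].
  - by [].
  move=> q x /=; rewrite XE kapE /k scalerBr scalerBl scale1r addrCA.
  by congr (_ + _); rewrite addrC.
have {}L1 p0 : L p0 = 1.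
  by apply/eqP/negPn/negP => Lp; apply: L1; exists p0.
split; apply: (@FactorForm R M0 M1 n X 2 h 0 0 (fun _ => 0) 0
    (fun _ => 0) (fun _ _ => 0) (fun _ => 0)) => //.
- by move=> c k; exact: Ck_cst.
- exact: msmooth_cst.
move=> q x; rewrite /= add0r XE L1 scale1r (_ : kap q = 0) ?addr0 //.
apply: h_full => c p v cp; rewrite -[RHS](kap_perp q c p v cp) L1 subrr scale0r add0r //.
Qed.

Lemma one_factor : inhabited (factor_form X).
Proof.
have [d1|d1] := leqP (mdim M1) 1; last exact: dim2_form.
by apply: dim1_form; apply/eqP; rewrite eqn_leq d1 dim1.
Qed.

End OneFactor.

(** * Quasi-warped immersions *)

Lemma riemannian0 (R : realType) (X : manifold R) (gX : metric X) c (p : X) v : riemannian gX ->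
  cdom (mchart c) p -> gX c p 0 v = 0 /\ gX c p v 0 = 0.
Proof.
move=> [lin _ _ _] cp; have [sc sym] := lin c p cp.
have E : gX c p 0 v = 0.
  by have := sc v (-1) 0 0; rewrite scaler0 addr0 mulN1r addNr.
by split=> //; rewrite sym.
Qed.

(** Here [t p q s] stands for the product of [D_p D_q f] with [D_s f], and [d p q s] for the
    derivative along [p] of the metric on [q], [s]. *)
Lemma koszul (R : comRingType) (I : Type) (t d : I -> I -> I -> R) u v w :
  (forall p q s, t p q s = t q p s) ->
  (forall p q s, d p q s = t p q s + t p s q) ->
  2 * t u v w = d u v w + d v u w - d w u v.
Proof. by move=> ts dE; rewrite !dE (ts v u) (ts w u) (ts w v); ring. Qed.

Section QuasiWarpedImmersion.
Variables (R : realType) (r : nat) (M : 'I_r.+1 -> manifold R).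
Local Notation P := (prod_manifold M).
Local Notation fac a := (M (lift ord0 a)).
Local Notation blk i := (@block R r.+1 M i).
Variables (N : nat) (g0 : metric (M ord0)) (g : forall a : 'I_r, metric (fac a)).
Variables (rho : forall a : 'I_r, M ord0 -> fac a -> R) (f : P -> 'rV[R]_N).
Hypothesis riem0 : riemannian g0.
Hypothesis riem : forall a, riemannian (@g a).
Hypothesis f_imm : immersion f.
Hypothesis f_qw : is_quasi_warped (induced_metric f) g0 (@g) (@rho).
Hypothesis f_adapted : adapted f.
Implicit Types (c : mindex P).

Definition supported i (v : 'rV[R]_(mdim P)) := forall j, j != i -> blk j v = 0.

Lemma f_metric c (p : P) v w : cdom (mchart c) p ->
  dot (mdiff c f p v) (mdiff c f p w) =
  g0 (c ord0) (p ord0) (blk ord0 v) (blk ord0 w) +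
    \sum_(a < r) rho (p ord0) (p (lift ord0 a)) ^+ 2 *
      g (c (lift ord0 a)) (p (lift ord0 a)) (blk (lift ord0 a) v) (blk (lift ord0 a) w).
Proof. by move=> cp; exact: f_qw.2 _ _ cp v w. Qed.

Lemma f_metric_neq c (p : P) i j v w : cdom (mchart c) p -> i != j ->
  supported i v -> supported j w -> dot (mdiff c f p v) (mdiff c f p w) = 0.
Proof.
move=> cp ij vi wj.
have z l : blk l v = 0 \/ blk l w = 0.
  have [->|li] := eqVneq l i; last by left; exact: vi.
  by right; apply: wj.
rewrite f_metric // big1 ?addr0.
  have E0 (u : 'rV[R]_(mdim (M ord0))) := riemannian0 u riem0 (cp ord0).
  by case: (z ord0) => ->; rewrite ?(E0 _).1 ?(E0 _).2.
move=> a _; have E0 (u : 'rV[R]_(mdim (fac a))) := riemannian0 u (riem a) (cp (lift ord0 a)).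
by case: (z (lift ord0 a)) => ->; rewrite ?(E0 _).1 ?(E0 _).2 mulr0.
Qed.

Lemma f_metric_base c (p : P) v w : cdom (mchart c) p -> supported ord0 v ->
  dot (mdiff c f p v) (mdiff c f p w) = g0 (c ord0) (p ord0) (blk ord0 v) (blk ord0 w).
Proof.
move=> cp v0; rewrite f_metric // big1 ?addr0 // => a _.
have [E1 _] := riemannian0 (blk (lift ord0 a) w) (riem a) (cp (lift ord0 a)).
by rewrite v0 ?E1 ?mulr0 // eq_sym neq_lift.
Qed.

Lemma f_metric_fac a c (p : P) v w : cdom (mchart c) p -> supported (lift ord0 a) v ->
  dot (mdiff c f p v) (mdiff c f p w) = rho (p ord0) (p (lift ord0 a)) ^+ 2 *
      g (c (lift ord0 a)) (p (lift ord0 a)) (blk (lift ord0 a) v) (blk (lift ord0 a) w).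
Proof.
move=> cp va; rewrite f_metric // (bigD1 a) //= big1 ?addr0.
  have [E1 _] := riemannian0 (blk ord0 w) riem0 (cp ord0).
  by rewrite va ?neq_lift // E1 add0r.
move=> b ba; have [E1 _] := riemannian0 (blk (lift ord0 b) w) (riem b) (cp (lift ord0 b)).
by rewrite va ?E1 ?mulr0 // (inj_eq (@lift_inj _ ord0)).
Qed.

Section Chart.
Variable c : mindex P.
Let F := f \o cpar (mchart c).
Let U := cimg (mchart c).
Let wf a (x : 'rV[R]_(mdim P)) := rho (cpar (mchart c) x ord0) (cpar (mchart c) x (lift ord0 a)) : R.

Lemma chart_open : open U. Proof. exact: cimg_open. Qed.

Lemma mdiff_cpar x v : U x -> mdiff c f (cpar (mchart c) x) v = 'D_v F x.
Proof. by move=> Ux; rewrite /mdiff cparK. Qed.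

Lemma Ck_chart k : Ck k U F.
Proof. by move/msmoothP: f_imm.1 => /(_ c k). Qed.

Lemma wf_gt0 a x : 0 < wf a x.
Proof. exact: (f_qw.1 a).1. Qed.

Lemma Ck_wf a k : Ck k U (wf a).
Proof.
apply: (@smooth_proj2 R r.+1 M ord0 (lift ord0 a) (@rho a)) => ci cj.
exact: (f_qw.1 a).2.
Qed.

Lemma is_derive_wf a x u : U x -> is_derive x u (wf a) ('D_u (wf a) x).
Proof. by move=> Ux; apply: derivableP; exact: (Ck_derivable (Ck_wf a 1) Ux). Qed.

Lemma derive_wf0 a x u i : U x -> supported i u -> i != ord0 -> i != lift ord0 a ->
  'D_u (wf a) x = 0.
Proof.
move=> Ux ui i0 ia.
pose Q (y : 'rV[R]_(mdim P)) : 'rV[R]_(mdim (M ord0)) * 'rV[R]_(mdim (fac a)) :=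
  (blk ord0 y, blk (lift ord0 a) y).
have aQ (h : R) v y : Q (h *: v + y) = h *: Q v + Q y.
  by rewrite /Q /block !submxrow_linear.
have Qu : Q u = 0 by rewrite /Q !ui // eq_sym.
have := derive_affine aQ (fun z => rho (cpar (mchart (c ord0)) z.1)
  (cpar (mchart (c (lift ord0 a))) z.2)) x u.
rewrite Qu => E; apply: etrans E _; exact: derive0.
Qed.

Let G v w x := dot ('D_v F x) ('D_w F x).

Lemma is_derive_G x u v w : U x ->
  is_derive x u (G v w) (dot ('D_u (fun y => 'D_v F y) x) ('D_w F x) +
     dot ('D_v F x) ('D_u (fun y => 'D_w F y) x)).
Proof.
move=> Ux; have CD z : Ck 1 U (fun y => 'D_z F y) by exact: Ck_derive (Ck_chart 2).
apply: is_derive_dot; apply: derivableP.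
  exact: (Ck_derivable (CD v) Ux).
exact: (Ck_derivable (CD w) Ux).
Qed.

Lemma G_neq x i j v w : U x -> i != j -> supported i v -> supported j w -> G v w x = 0.
Proof.
move=> Ux ij vi wj; rewrite /G -!mdiff_cpar //.
exact: f_metric_neq (cpar_dom Ux) ij vi wj.
Qed.

Lemma derive_near_eq (X : normedModType R) (A B : 'rV[R]_(mdim P) -> X) x u : U x ->
  (forall y, U y -> A y = B y) -> 'D_u A x = 'D_u B x.
Proof.
move=> Ux AB; apply: near_eq_derive.
by apply: filterS (open_nbhs_nbhs (conj chart_open Ux)) => y; exact: AB.
Qed.

Lemma derive_G_neq x i j u v w : U x -> i != j -> supported i v -> supported j w ->
  'D_u (G v w) x = 0.
Proof.
move=> Ux ij vi wj; rewrite (@derive_near_eq _ _ (fun=> 0) _ _ Ux); last first.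
  by move=> y Uy; exact: G_neq Uy ij vi wj.
exact: derive_cst.
Qed.

Lemma is_derive_const_dir i (X : normedModType R) (A : 'rV[R]_(mdim (M i)) -> X) x u :
  blk i u = 0 -> is_derive x u (fun y => A (blk i y)) 0.
Proof.
move=> ui; apply: (is_derive_affine (P := blk i) (L := blk i)).
  by move=> h w y; exact: submxrow_linear.
by rewrite ui; exact: is_derive0.
Qed.

Lemma derive_G_base x i u v w : U x -> i != ord0 -> supported i u ->
  supported ord0 v -> 'D_u (G v w) x = 0.
Proof.
move=> Ux i0 ui v0; rewrite (@derive_near_eq _ _ (fun y =>
  g0 (c ord0) (cpar (mchart (c ord0)) (blk ord0 y)) (blk ord0 v) (blk ord0 w)) _ _ Ux).
  have H := is_derive_const_dir (i := ord0) (fun y =>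
    g0 (c ord0) (cpar (mchart (c ord0)) y) (blk ord0 v) (blk ord0 w)) x (u := u).
  by have [|_ ->] := H; first by apply: ui; rewrite eq_sym.
move=> y Uy; rewrite /G -!mdiff_cpar // f_metric_base //; exact: cpar_dom.
Qed.

Lemma derive_G_fac a x i u v w : U x -> i != lift ord0 a -> supported i u ->
  supported (lift ord0 a) v ->
  'D_u (G v w) x = 2 * ('D_u (wf a) x / wf a x) * G v w x.
Proof.
move=> Ux ia ui va.
pose B y := g (c (lift ord0 a)) (cpar (mchart (c (lift ord0 a))) y)
  (blk (lift ord0 a) v) (blk (lift ord0 a) w).
have GE y : U y -> G v w y = wf a y * wf a y * B (blk (lift ord0 a) y).
  move=> Uy; rewrite /G -!mdiff_cpar // (f_metric_fac w (cpar_dom Uy) va) expr2 //.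
rewrite (derive_near_eq u Ux GE) GE //.
have dB : is_derive x u (fun y => B (blk (lift ord0 a) y)) 0.
  by apply: is_derive_const_dir; apply: ui; rewrite eq_sym.
have dw := is_derive_wf a u Ux.
have [_ ->] := is_derive_mul (is_derive_mul dw dw) dB.
have w0 : wf a x != 0 by rewrite gt_eqF // wf_gt0.
by field.
Qed.

Lemma supported_sum (w : 'rV[R]_(mdim P)) : w = \sum_i inj_block (blk i w).
Proof.
apply: blockP => j; rewrite {2}/block submxrow_sum (bigD1 j) //=.
rewrite -/(blk j (inj_block (blk j w))) block_inj big1 ?addr0 // => i ij.
by rewrite -/(blk j (inj_block (blk i w))) block_inj_neq.
Qed.

Lemma supported_inj i v : supported i (@inj_block R r.+1 M i v).
Proof. by move=> j ji; rewrite block_inj_neq // eq_sym. Qed.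

(** The difference of the two sides is tangent because [f] is adapted, so it vanishes once it is
    orthogonal to all [D_w f]; by linearity [w] may be taken in a single factor. *)
Lemma mixed_derivative a i x u v : U x -> i != lift ord0 a ->
  supported i u -> supported (lift ord0 a) v ->
  'D_u (fun y => 'D_v F y) x = ('D_u (wf a) x / wf a x) *: 'D_v F x.
Proof.
move=> Ux ia ui va; apply/eqP; rewrite -subr_eq0; apply/eqP.
set H := _ - _.
have Uc := cpar_dom Ux.
have [t Ht] : exists t, H = 'D_t F x.
  have [s Es] : exists s, 'D_u (fun y => 'D_v F y) x = mdiff c f (cpar (mchart c) x) s.
    apply: (normal_part_eq0 f_imm Uc).
    have := f_adapted ia Uc ui va.
    by rewrite /second_fundamental_form /mdiff2 cparK.
  exists (s - ('D_u (wf a) x / wf a x) *: v).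
  rewrite -(mdiff_cpar (s - _) Ux) /H Es -(mdiff_cpar v Ux) !(mdiff_jac _ f_imm.1 Uc).
  by rewrite mulmxBl -scalemxAl.
suff Hw w : dot H ('D_w F x) = 0.
  by apply/eqP; rewrite -dot_eq0 {2}Ht Hw.
pose t3 (p q s : 'rV[R]_(mdim P)) := dot ('D_p (fun y => 'D_q F y) x) ('D_s F x).
have t_sym p q s : t3 p q s = t3 q p s.
  exact: (congr1 (fun z => dot z _) (derive_mx_sym p q chart_open Ux (Ck_chart 2))).
have t_G p q s : 'D_p (G q s) x = t3 p q s + t3 p s q.
  have [_ E] := is_derive_G p q s Ux; apply: etrans E _.
  exact: (congr1 (fun z => _ + z) (dotC _ _)).
have christoffel w' : 2 * dot ('D_u (fun y => 'D_v F y) x) ('D_w' F x) =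
    'D_u (G v w') x + 'D_v (G u w') x - 'D_w' (G u v) x.
  exact: (@koszul R _ t3 (fun p q s => 'D_p (G q s) x) u v w' t_sym t_G).
have Hk k w' : supported k w' -> dot H ('D_w' F x) = 0.
  move=> wk; rewrite /H dotBl dotZl -/(G v w' x).
  suff E : 2 * dot ('D_u (fun y => 'D_v F y) x) ('D_w' F x) =
      2 * ('D_u (wf a) x / wf a x) * G v w' x.
    have n2 : (2 : R) != 0 by rewrite pnatr_eq0.
    by move: E; rewrite -mulrA => /(mulfI n2) ->; rewrite subrr.
  apply: etrans (christoffel w') _.
  have aux (r1 r2 r3 r4 : R) : r1 = r4 -> r2 = 0 -> r3 = 0 -> r1 + r2 - r3 = r4.
    by move=> -> -> ->; rewrite addr0 subr0.
  apply: aux; [exact: (derive_G_fac w' Ux ia ui va)| |exact: (derive_G_neq w' Ux ia ui va)].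
  (* The second Koszul term remains. For [k != i] the product [G u w'] vanishes identically; for
     [k = i] it is the metric on factor [i], which does not vary along the different factor [a]. *)
  have [ki|ki] := eqVneq k i; last first.
    have ik : i != k by rewrite eq_sym.
    exact: (derive_G_neq v Ux ik ui wk).
  have ai : lift ord0 a != i by rewrite eq_sym.
  have a0 : lift ord0 a != ord0 by rewrite eq_sym neq_lift.
  have [b ib|i0] := unliftP ord0 i; last first.
    by apply: (derive_G_base w' Ux a0 va); rewrite -i0.
  have ub : supported (lift ord0 b) u by rewrite -ib.
  have ab : lift ord0 a != lift ord0 b by rewrite -ib.
  have E0 := derive_wf0 Ux va a0 ab.
  by apply: etrans (derive_G_fac w' Ux ab va ub) _; rewrite E0 mul0r mulr0 mul0r.
rewrite -(mdiff_cpar w Ux) (mdiff_jac _ f_imm.1 Uc) (supported_sum w).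
rewrite mulmx_suml dot_sumr big1 // => k _.
rewrite -(mdiff_jac _ f_imm.1 Uc) (mdiff_cpar _ Ux).
exact: Hk (supported_inj _).
Qed.

(** The coefficient in [mixed_derivative] is the logarithmic derivative of [rho_a], and division by
    [rho_a] cancels it. *)
Lemma is_derive_normalized a i x u v : U x -> i != lift ord0 a ->
  supported i u -> supported (lift ord0 a) v ->
  is_derive x u (fun y => (wf a y)^-1 *: 'D_v F y) 0.
Proof.
move=> Ux ia ui va.
have w0 : wf a x != 0 by rewrite gt_eqF // wf_gt0.
have CD : Ck 1 U (fun y => 'D_v F y) by exact: Ck_derive (Ck_chart 2).
have dD : is_derive x u (fun y => 'D_v F y) (('D_u (wf a) x / wf a x) *: 'D_v F x).
  rewrite -(mixed_derivative Ux ia ui va); apply: derivableP.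
  exact: (Ck_derivable CD Ux).
have dV : is_derive x u (fun y => (wf a y)^-1) (- (wf a x) ^-2 * 'D_u (wf a) x).
  have [dw _] := is_derive_wf a u Ux.
  by apply: DeriveDef; [exact: derivableV|rewrite deriveV].
have := is_derive_scale dV dD.
rewrite scalerA -scalerDl (_ : _ + _ = 0) ?scale0r //.
by field.
Qed.

End Chart.
End QuasiWarpedImmersion.

(** * Slices of a quasi-warped immersion *)

Section DfWith.
Variables (I : eqType) (T : I -> Type).
Implicit Types p : forall i, T i.

Lemma dfwith_dfwith p i x y : dfwith (dfwith p i x) i y = dfwith p i y.
Proof.
apply: functional_extensionality_dep => j; have [<-|ij] := eqVneq i j.
  by rewrite !dfwithin.
by rewrite !dfwithout.
Qed.

Lemma dfwith_id p i : dfwith p i (p i) = p.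
Proof. by apply: functional_extensionality_dep => j; case: dfwithP. Qed.

Lemma dfwithC p i j x y : i != j ->
  dfwith (dfwith p i x) j y = dfwith (dfwith p j y) i x.
Proof.
move=> ij; apply: functional_extensionality_dep => l.
have [<-|il] := eqVneq i l; first by rewrite dfwithin dfwithout 1?eq_sym // dfwithin.
rewrite [RHS]dfwithout //; have [<-|jl] := eqVneq j l; first by rewrite !dfwithin.
by rewrite !dfwithout.
Qed.

End DfWith.

Lemma mulf_eq0r (F : fieldType) (x y : F) : x != 0 -> x * y = 0 -> y = 0.
Proof. by move=> x0 /eqP; rewrite mulf_eq0 (negPf x0) => /eqP. Qed.

Section ConverseSlices.
Variables (R : realType) (r : nat) (M : 'I_r.+1 -> manifold R).
Local Notation P := (prod_manifold M).
Local Notation fac a := (M (lift ord0 a)).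
Local Notation blk i := (@block R r.+1 M i).
Variables (N : nat) (g0 : metric (M ord0)) (g : forall a : 'I_r, metric (fac a)).
Variables (rho : forall a : 'I_r, M ord0 -> fac a -> R) (f : P -> 'rV[R]_N).
Hypothesis riem0 : riemannian g0.
Hypothesis riem : forall a, riemannian (@g a).
Hypothesis f_imm : immersion f.
Hypothesis f_qw : is_quasi_warped (induced_metric f) g0 (@g) (@rho).
Hypothesis f_adapted : adapted f.
Hypothesis connM : forall i, connected [set: M i].

Lemma chart_through2 (p : P) i j (ci : mindex (M i)) (cj : mindex (M j)) : i != j ->
  cdom (mchart ci) (p i) -> cdom (mchart cj) (p j) ->
  exists c : mindex P, [/\ c i = ci, c j = cj & cdom (mchart c) p].
Proof.
move=> ij cpi cpj.
exists (dfwith (@chart_through _ _ M p i ci) j cj).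
have Ej : dfwith (@chart_through _ _ M p i ci) j cj j = cj by rewrite dfwithin.
have Ei : dfwith (@chart_through _ _ M p i ci) j cj i = ci.
  by rewrite dfwithout 1?eq_sym // chart_throughE.
split=> // l; have [jl|jl] := eqVneq j l; first by case: l / jl; rewrite Ej.
by rewrite dfwithout //; exact: (chart_throughP cpi).
Qed.

Lemma slice_perp (p : P) i j (ci : mindex (M i)) (cj : mindex (M j)) u v : i != j ->
  cdom (mchart ci) (p i) -> cdom (mchart cj) (p j) ->
  dot (mdiff ci (f \o dfwith p i) (p i) u) (mdiff cj (f \o dfwith p j) (p j) v) = 0.
Proof.
move=> ij cpi cpj; have [c [Ei Ej cp]] := chart_through2 ij cpi cpj.
subst ci cj; rewrite !(mdiff_slice _ _ cp).
exact: (f_metric_neq riem0 riem f_qw cp ij (supported_inj _) (supported_inj _)).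
Qed.

Lemma slice_immersion (p : P) i : immersion (f \o dfwith p i).
Proof.
split; first exact: msmooth_slice f_imm.1.
move=> ci q cq v; pose p' : P := dfwith p i q.
have p'i : p' i = q by rewrite /p' dfwithin.
have cp' : cdom (mchart ci) (p' i) by rewrite p'i.
have cP := chart_throughP cp'.
have -> : f \o dfwith p i = f \o dfwith p' i.
  by apply/funext => x /=; rewrite /p' dfwith_dfwith.
move: (cP) => /(mdiff_slice f v); rewrite chart_throughE p'i => -> /(f_imm.2 _ _ cP) E.
by rewrite -(block_inj v) E block0.
Qed.

Definition normalized_diff (a : 'I_r) (ca : mindex (fac a)) v (p : P) : 'rV[R]_N :=
  (rho (p ord0) (p (lift ord0 a)))^-1 *:
    mdiff ca (f \o dfwith p (lift ord0 a)) (p (lift ord0 a)) v.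

(** [mconst] on the connected factor [M i]: at each of its points a product chart extends the given
    charts of the factors [i] and [a], and [is_derive_normalized] applies there. *)
Lemma normalized_diff_step (a : 'I_r) (ca : mindex (fac a)) v (p : P) i (q : M i) :
  i != lift ord0 a -> cdom (mchart ca) (p (lift ord0 a)) ->
  normalized_diff ca v (dfwith p i q) = normalized_diff ca v p.
Proof.
move=> ia ca_p.
pose K (x : M i) := normalized_diff ca v (dfwith p i x).
have KE : K (p i) = normalized_diff ca v p by rewrite /K dfwith_id.
apply: etrans KE; rewrite -/(K q).
apply: mconst => [|ci y cy u]; first exact: connM.
pose p' : P := dfwith p i (cpar (mchart ci) y).
have p'i : p' i = cpar (mchart ci) y by rewrite /p' dfwithin.
have ci_p' : cdom (mchart ci) (p' i) by rewrite p'i; exact: cpar_dom.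
have ca_p' : cdom (mchart ca) (p' (lift ord0 a)) by rewrite /p' dfwithout.
have [c [Ei Ea cp]] := chart_through2 ia ci_p' ca_p'.
subst ci ca; pose x := ccoord (mchart c) p'.
have xi : blk i x = y by rewrite block_ccoord p'i cparK.
have Ux : cimg (mchart c) x by exact: ccoord_img.
have H := is_derive_normalized riem0 riem f_imm f_qw f_adapted Ux ia
  (@supported_inj R r M i u) (@supported_inj R r M (lift ord0 a) v).
have E : upd x y = x by rewrite -xi upd_block.
rewrite -E in H; have {}H := is_derive_affine (@upd_affine R r.+1 M x i) H.
apply: near_eq_is_derive H.
apply: filterS (open_nbhs_nbhs (conj (@cimg_open _ _ _ (mchart (c i))) cy)) => z cz.
have cu : cimg (mchart c) (upd x z).
  move=> j /=; rewrite submxrow_upd; have [ij|ij] := eqVneq i j.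
    by case: j / ij; rewrite dfwithin.
  by rewrite dfwithout //; exact: Ux.
have pE : cpar (mchart c) (upd x z) = dfwith p i (cpar (mchart (c i)) z).
  apply: etrans (ppar_upd c x z) _.
  by rewrite (ccoordK cp : ppar c x = p') /p' dfwith_dfwith.
rewrite /= /K /normalized_diff -pE; congr (_ *: _).
rewrite -(mdiff_cpar f _ cu).
exact/esym/mdiff_slice/cpar_dom.
Qed.

Lemma normalized_diff_const (a : 'I_r) (ca : mindex (fac a)) v (p q : P) :
  cdom (mchart ca) (p (lift ord0 a)) -> p (lift ord0 a) = q (lift ord0 a) ->
  normalized_diff ca v p = normalized_diff ca v q.
Proof.
move=> ca_p pq.
(* [indep_coords] takes a function on the whole product, so the value is [0] where factor [a] is
   outside the chart domain, a condition unaffected by the other coordinates. *)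
pose F (p : P) := if pselect (cdom (mchart ca) (p (lift ord0 a))) is left _
  then normalized_diff ca v p else 0.
have FE (x : P) : cdom (mchart ca) (x (lift ord0 a)) -> F x = normalized_diff ca v x.
  by rewrite /F; case: pselect.
have F0 (x : P) : ~ cdom (mchart ca) (x (lift ord0 a)) -> F x = 0.
  by rewrite /F; case: pselect.
have ca_q : cdom (mchart ca) (q (lift ord0 a)) by rewrite -pq.
rewrite -(FE _ ca_p) -(FE _ ca_q).
apply: (indep_coords (A := [pred i | i != lift ord0 a])) => [i x y /= ia|i /negPn/eqP ->] //.
have E : (dfwith x i y) (lift ord0 a) = x (lift ord0 a) by rewrite dfwithout.
have [cx|ncx] := pselect (cdom (mchart ca) (x (lift ord0 a))).
  have cx' : cdom (mchart ca) ((dfwith x i y) (lift ord0 a)) by rewrite E.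
  by rewrite (FE _ cx') (FE _ cx); exact: normalized_diff_step.
have ncx' : ~ cdom (mchart ca) ((dfwith x i y) (lift ord0 a)) by rewrite E.
by rewrite (F0 _ ncx') (F0 _ ncx).
Qed.

Variable o : P.

(** The function [lam_a], normalized to [1] at the base coordinate of [o]. *)
Definition warp (a : 'I_r) p0 pa := rho p0 pa / @rho a (o ord0) pa.

Lemma warp_gt0 (a : 'I_r) p0 pa : 0 < @warp a p0 pa.
Proof. by rewrite divr_gt0 //; exact: (f_qw.1 a).1. Qed.

Lemma warp_neq0 (a : 'I_r) p0 pa : @warp a p0 pa != 0.
Proof. by rewrite gt_eqF // warp_gt0. Qed.

Lemma slice_mdiff (a : 'I_r) (ca : mindex (fac a)) v (p : P) : cdom (mchart ca) (p (lift ord0 a)) ->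
  mdiff ca (f \o dfwith p (lift ord0 a)) (p (lift ord0 a)) v =
  warp (p ord0) (p (lift ord0 a)) *:
    mdiff ca (f \o dfwith o (lift ord0 a)) (p (lift ord0 a)) v.
Proof.
move=> ca_p; pose q : P := dfwith o (lift ord0 a) (p (lift ord0 a)).
have qa : q (lift ord0 a) = p (lift ord0 a) by rewrite /q dfwithin.
have q0 : q ord0 = o ord0 by rewrite /q dfwithout // eq_sym neq_lift.
have := normalized_diff_const v ca_p (esym qa).
rewrite /normalized_diff qa q0.
have -> : f \o dfwith q (lift ord0 a) = f \o dfwith o (lift ord0 a).
  by apply/funext => x /=; rewrite /q dfwith_dfwith.
have r0 : rho (p ord0) (p (lift ord0 a)) != 0 by rewrite gt_eqF //; exact: (f_qw.1 a).1.
have aux (x y : R) (u w : 'rV[R]_N) : x != 0 -> x^-1 *: u = y^-1 *: w -> u = (x / y) *: w.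
  by move=> x0 uw; rewrite -scalerA -uw scalerA mulfV // scale1r.
exact: aux r0.
Qed.

(** At the point of the product with coordinates [pa] and [pb], tangent vectors to the factors [a]
    and [b] are orthogonal. By [slice_mdiff] they are nonzero multiples of the two vectors here,
    which live at different points. *)
Lemma slice_fac_perp (a b : 'I_r) (ca : mindex (fac a)) (cb : mindex (fac b)) pa pb u v : a != b ->
  cdom (mchart ca) pa -> cdom (mchart cb) pb ->
  dot (mdiff ca (f \o dfwith o (lift ord0 a)) pa u)
      (mdiff cb (f \o dfwith o (lift ord0 b)) pb v) = 0.
Proof.
move=> ab ca_p cb_p.
have lab : lift ord0 a != lift ord0 b by rewrite (inj_eq (@lift_inj _ ord0)).
pose p : P := dfwith (dfwith o (lift ord0 a) pa) (lift ord0 b) pb.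
have pbE : p (lift ord0 b) = pb by rewrite /p dfwithin.
have paE : p (lift ord0 a) = pa by rewrite /p dfwithout 1?eq_sym // dfwithin.
have cap : cdom (mchart ca) (p (lift ord0 a)) by rewrite paE.
have cbp : cdom (mchart cb) (p (lift ord0 b)) by rewrite pbE.
have := slice_perp u v lab cap cbp; rewrite (slice_mdiff _ cap) (slice_mdiff _ cbp).
rewrite dotZl dotZr paE pbE.
by move=> /(mulf_eq0r (warp_neq0 _ _)) /(mulf_eq0r (warp_neq0 _ _)).
Qed.

Lemma slice_base_perp (p : P) (a : 'I_r) (c0 : mindex (M ord0)) (ca : mindex (fac a)) u v :
  cdom (mchart c0) (p ord0) -> cdom (mchart ca) (p (lift ord0 a)) ->
  dot (mdiff c0 (f \o dfwith p ord0) (p ord0) u)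
      (mdiff ca (f \o dfwith o (lift ord0 a)) (p (lift ord0 a)) v) = 0.
Proof.
move=> c0p cap; have := slice_perp u v (neq_lift ord0 a) c0p cap.
by rewrite (slice_mdiff _ cap) dotZr => /(mulf_eq0r (warp_neq0 _ _)).
Qed.

Lemma warp_smooth1 (a : 'I_r) p0 (ca : mindex (fac a)) k :
  Ck k (cimg (mchart ca)) (fun y => warp p0 (cpar (mchart ca) y)).
Proof.
have S q : Ck k (cimg (mchart ca)) (fun y => @rho a q (cpar (mchart ca) y)).
  have cq := mchart_atP q; set cq' := mchart_at q in cq.
  pose Q (y : 'rV[R]_(mdim (fac a))) : 'rV[R]_(mdim (M ord0)) * 'rV[R]_(mdim (fac a)) :=
    (ccoord (mchart cq') q, y).
  have aQ (h : R) v y : Q (h *: v + y) = h *: (0, v) + Q y.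
    by rewrite /Q; congr pair; rewrite /= scaler0 add0r.
  have cQ : continuous Q.
    move=> y; have c1 : {for y, continuous (fun _ : 'rV[R]_(mdim (fac a)) => ccoord (mchart cq') q)}.
      exact: cst_continuous.
    have c2 : {for y, continuous (fun z : 'rV[R]_(mdim (fac a)) => z)} by exact: cvg_id.
    exact: cvg_pair c1 c2.
  have := Ck_comp_affine aQ cQ ((f_qw.1 a).2 cq' ca k).
  rewrite /Q /comp /= ccoordK //; apply: sub_Ck => y cy; split=> //=.
  exact: ccoord_img.
apply: CkM; [exact: cimg_open|exact: S|].
apply: CkV; [exact: cimg_open| |exact: S].
by move=> y _; rewrite gt_eqF //; exact: (f_qw.1 a).1.
Qed.

Lemma warp_smooth0 (a : 'I_r) pa (c0 : mindex (M ord0)) k :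
  Ck k (cimg (mchart c0)) (fun y => @warp a (cpar (mchart c0) y) pa).
Proof.
apply: CkM; [exact: cimg_open| |exact: Ck_cst].
have cq := mchart_atP pa; set cq' := mchart_at pa in cq.
pose Q (y : 'rV[R]_(mdim (M ord0))) : 'rV[R]_(mdim (M ord0)) * 'rV[R]_(mdim (fac a)) :=
  (y, ccoord (mchart cq') pa).
have aQ (h : R) v y : Q (h *: v + y) = h *: (v, 0) + Q y.
  by rewrite /Q; congr pair; rewrite /= scaler0 add0r.
have cQ : continuous Q.
  move=> y; have c1 : {for y, continuous (fun _ : 'rV[R]_(mdim (M ord0)) => ccoord (mchart cq') pa)}.
    exact: cst_continuous.
  have c2 : {for y, continuous (fun z : 'rV[R]_(mdim (M ord0)) => z)} by exact: cvg_id.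
  exact: cvg_pair c2 c1.
have := Ck_comp_affine aQ cQ ((f_qw.1 a).2 c0 cq' k).
rewrite /Q /comp /= ccoordK //; apply: sub_Ck => y cy; split=> //=.
exact: ccoord_img.
Qed.

End ConverseSlices.

(** * Splitting the ambient space *)

Section TangentSpans.
Variables (R : realType) (X : manifold R) (N : nat) (h : X -> 'rV[R]_N).

Lemma tangent_onb : exists n (B : 'M[R]_(n, N)),
  [/\ B *m B^T = 1%:M,
      forall c p v, cdom (mchart c) p -> mdiff c h p v *m B^T *m B = mdiff c h p v
    & forall x, (forall c p v, cdom (mchart c) p -> dot x (mdiff c h p v) = 0) ->
      x *m B^T = 0].
Proof.
pose perp x := forall c p v, cdom (mchart c) p -> dot x (mdiff c h p v) = 0.
(* The span of all tangent vectors, written as their biorthogonal, which is visibly closed under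
   linear combinations. *)
pose S : set 'rV[R]_N := [set x | forall y, perp y -> dot x y = 0].
have S0 : S 0 by move=> y _; rewrite dot0l.
have SD a u v : S u -> S v -> S (a *: u + v).
  by move=> Su Sv y py; rewrite dotDl dotZl Su // Sv // mulr0 addr0.
have [n [B [B1 SB]]] := subspace_onb S0 SD.
exists n, B; split=> // [c p v cp|x px].
  by apply/esym/(SB _).1 => y py; rewrite dotC py.
have SBu u : S (u *m B) by apply/(SB _).2; rewrite -(mulmxA u) B1 mulmx1.
apply/eqP; rewrite -dot_eq0; apply/eqP.
by have := SBu (x *m B^T) x px; rewrite dot_mulmxl.
Qed.

End TangentSpans.

Section ConverseFactors.
Variables (R : realType) (r : nat) (M : 'I_r.+1 -> manifold R).
Local Notation P := (prod_manifold M).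
Local Notation fac a := (M (lift ord0 a)).
Variables (N : nat) (g0 : metric (M ord0)) (g : forall a : 'I_r, metric (fac a)).
Variables (rho : forall a : 'I_r, M ord0 -> fac a -> R) (f : P -> 'rV[R]_N).
Hypothesis riem0 : riemannian g0.
Hypothesis riem : forall a, riemannian (@g a).
Hypothesis f_imm : immersion f.
Hypothesis f_qw : is_quasi_warped (induced_metric f) g0 (@g) (@rho).
Hypothesis f_adapted : adapted f.
Hypothesis connM : forall i, connected [set: M i].
Hypothesis dimM : forall a : 'I_r, (0 < mdim (fac a))%N.
Variable o : P.
Variables (n : 'I_r -> nat) (B : forall a : 'I_r, 'M[R]_(n a, N)).
Local Notation h a := (f \o dfwith o (lift ord0 a)).
Hypothesis B1 : forall a, B a *m (B a)^T = 1%:M.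
Hypothesis B_id : forall (a : 'I_r) (c : mindex (fac a)) p v, cdom (mchart c) p ->
  mdiff c (h a) p v *m (B a)^T *m B a = mdiff c (h a) p v.
Hypothesis B_perp : forall (a : 'I_r) x,
  (forall (c : mindex (fac a)) p v, cdom (mchart c) p -> dot x (mdiff c (h a) p v) = 0) ->
  x *m (B a)^T = 0.

Lemma mdiff_B0 (a b : 'I_r) (c : mindex (fac b)) p v : a != b -> cdom (mchart c) p ->
  mdiff c (h b) p v *m (B a)^T = 0.
Proof.
move=> ab cp; apply: B_perp => ca pa u cpa.
by rewrite dotC; exact: (slice_fac_perp riem0 riem f_imm f_qw f_adapted connM o _ _ ab cpa cp).
Qed.

Lemma B_orthogonal (a b : 'I_r) : a != b -> B a *m (B b)^T = 0.
Proof.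
move=> ab; apply/row_matrixP => j; rewrite row_mul row0 rowE.
apply: B_perp => c p v cp; rewrite dot_mulmxl mdiff_B0 ?dot0r //.
Qed.

(** [C] kills the differentials of the slices through [o], and by [slice_mdiff] those of every other
    slice along the same factor, which are proportional to them. *)
Lemma f_indep m (C : 'M[R]_(N, m)) (A : pred 'I_r) :
  (forall b, A b -> forall (c : mindex (fac b)) p v, cdom (mchart c) p ->
     mdiff c (h b) p v *m C = 0) ->
  forall p q : P, p ord0 = q ord0 ->
    (forall b, ~~ A b -> p (lift ord0 b) = q (lift ord0 b)) -> f p *m C = f q *m C.
Proof.
move=> AC p q pq0 pq.
pose A' i := if unlift ord0 i is Some b then A b else false.
apply: (indep_coords (F := fun p : P => f p *m C) (A := A')) => [i x y|i].
  rewrite /A'; case: (unliftP ord0 i) y => [b ->|//] y Ab.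
  pose K (z : fac b) := (f \o dfwith x (lift ord0 b)) z *m C.
  have KE : K (x (lift ord0 b)) = f x *m C by rewrite /K /= dfwith_id.
  apply: (etrans _ KE); rewrite -/(K y).
  have sx : msmooth (f \o dfwith x (lift ord0 b)) by exact: msmooth_slice f_imm.1.
  apply: mconst_mdiff => [||c z v cz]; [exact: connM|exact: msmooth_mulmx|].
  rewrite /K (mdiff_mulmx _ _ sx cz).
  pose x' : P := dfwith x (lift ord0 b) z.
  have x'b : x' (lift ord0 b) = z by rewrite /x' dfwithin.
  have cx' : cdom (mchart c) (x' (lift ord0 b)) by rewrite x'b.
  have -> : f \o dfwith x (lift ord0 b) = f \o dfwith x' (lift ord0 b).
    by apply/funext => w /=; rewrite /x' dfwith_dfwith.
  have := slice_mdiff riem0 riem f_imm f_qw f_adapted connM o v cx'.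
  by rewrite x'b => ->; rewrite -scalemxAl (AC b Ab) // scaler0.
rewrite /A'; case: unliftP => [b ->|-> _]; [exact: pq|exact: pq0].
Qed.

(** The coordinates of [f] in the span of the tangent spaces of the slice [a]. The remaining factors
    are frozen at [o], a choice that [f_component] shows to be immaterial. *)
Definition component (a : 'I_r) p0 (pa : fac a) :=
  f (dfwith (dfwith o ord0 p0) (lift ord0 a) pa) *m (B a)^T.

Lemma f_component p a : f p *m (B a)^T = component (p ord0) (p (lift ord0 a)).
Proof.
apply: (f_indep (A := [pred b | b != a])) => [b /= ba c q v cq||b /= /negPn/eqP ->].
- by apply: mdiff_B0 => //; rewrite eq_sym.
- by rewrite dfwithout 1?eq_sym ?neq_lift // dfwithin.
- by rewrite dfwithin.
Qed.

Lemma component_mdiff (a : 'I_r) p0 (c : mindex (fac a)) pa v : cdom (mchart c) pa ->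
  mdiff c (@component a p0) pa v = @warp R r M rho o a p0 pa *: (mdiff c (h a) pa v *m (B a)^T).
Proof.
move=> cp; pose x : P := dfwith (dfwith o ord0 p0) (lift ord0 a) pa.
have xa : x (lift ord0 a) = pa by rewrite /x dfwithin.
have x0 : x ord0 = p0 by rewrite /x dfwithout 1?eq_sym ?neq_lift // dfwithin.
have cx : cdom (mchart c) (x (lift ord0 a)) by rewrite xa.
have -> : @component a p0 = fun z => (f \o dfwith x (lift ord0 a)) z *m (B a)^T.
  by apply/funext => z; rewrite /component /x /= dfwith_dfwith.
rewrite mdiff_mulmx //; last exact: msmooth_slice f_imm.1.
have := slice_mdiff riem0 riem f_imm f_qw f_adapted connM o v cx.
by rewrite xa x0 => ->; rewrite -scalemxAl.
Qed.

Lemma component_base (a : 'I_r) : @component a (o ord0) = fun z => h a z *m (B a)^T.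
Proof. by apply/funext => z; rewrite /component dfwith_id. Qed.

Lemma component_base_mdiff (a : 'I_r) (c : mindex (fac a)) pa v : cdom (mchart c) pa ->
  mdiff c (@component a (o ord0)) pa v = mdiff c (h a) pa v *m (B a)^T.
Proof.
move=> cp; rewrite component_base mdiff_mulmx //.
exact: msmooth_slice f_imm.1.
Qed.

Lemma component_smooth1 (a : 'I_r) p0 : msmooth (@component a p0).
Proof.
have S := @msmooth_slice R r.+1 M _ f (dfwith o ord0 p0) (lift ord0 a) f_imm.1.
exact: (@msmooth_mulmx _ _ _ _ _ (B a)^T S).
Qed.

Lemma component_slice0 (a : 'I_r) pa : (fun p0 => @component a p0 pa) =
  fun z => (f \o dfwith (dfwith o (lift ord0 a) pa) ord0) z *m (B a)^T.
Proof.
by apply/funext => z; rewrite /component dfwithC // neq_lift.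
Qed.

Lemma component_immersion (a : 'I_r) p0 : immersion (@component a p0).
Proof.
split; first exact: component_smooth1.
move=> c pa cp v; rewrite component_mdiff // => /eqP.
have w0 := warp_neq0 f_qw o p0 pa.
rewrite scaler_eq0 (negPf w0) /= => /eqP E.
apply: ((slice_immersion f_imm o (lift ord0 a)).2 _ _ cp).
by rewrite -(B_id v cp) E mul0mx.
Qed.

Lemma component_form (a : 'I_r) : inhabited (factor_form (@component a)).
Proof.
apply: (@one_factor R _ _ _ _ (@warp R r M rho o a) (o ord0) (o (lift ord0 a))).
- exact: connM.
- exact: connM.
- exact: dimM.
- move=> pa; rewrite component_slice0; apply: msmooth_mulmx; exact: msmooth_slice f_imm.1.
- move=> p0; exact: component_smooth1.
- by move=> pa c k; exact: (warp_smooth0 f_qw).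
- by move=> p0 c k; exact: (warp_smooth1 f_qw).
- by move=> p0 c pa v cp; rewrite component_mdiff // component_base_mdiff.
- move=> c0 p0 u c pa v cp0 cp; rewrite component_base_mdiff // component_slice0.
  rewrite mdiff_mulmx //; last exact: msmooth_slice f_imm.1.
  rewrite dot_mulmxl trmxK (B_id v cp).
  pose x : P := dfwith (dfwith o (lift ord0 a) pa) ord0 p0.
  have x0 : x ord0 = p0 by rewrite /x dfwithin.
  have xa : x (lift ord0 a) = pa by rewrite /x dfwithout ?neq_lift // dfwithin.
  have cx0 : cdom (mchart c0) (x ord0) by rewrite x0.
  have cxa : cdom (mchart c) (x (lift ord0 a)) by rewrite xa.
  have := slice_base_perp riem0 riem f_imm f_qw f_adapted connM o u v cx0 cxa.
  rewrite x0 xa (_ : f \o dfwith x ord0 = f \o dfwith (dfwith o (lift ord0 a) pa) ord0) //.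
  by apply/funext => z /=; rewrite /x dfwith_dfwith.
- exact: component_immersion.
(* Fullness: [y *m B a] is orthogonal to the tangent vectors of the slice, so by [B_perp] its
   coordinates in [B a], which are [y], vanish. *)
move=> y yp; rewrite -[y]mulmx1 -(B1 a) mulmxA; apply: B_perp => c p v cp.
by rewrite dot_mulmxl -component_base_mdiff //; exact: yp.
Qed.

End ConverseFactors.

(** * Assembling the tube data *)

(** [tube_data] expects the spheres first and the curves next, while the factors come with their
    kinds in any order. *)
Lemma sorting_perm r (kd : 'I_r -> nat) :
  exists s : {perm 'I_r}, forall a b : 'I_r, (a <= b)%N -> (kd (s a) <= kd (s b))%N.
Proof.
pose le a b := (kd a <= kd b)%N; pose t := sort le (enum 'I_r).
have st : size t = r by rewrite size_sort size_enum_ord.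
have ut : uniq t by rewrite sort_uniq enum_uniq.
have lt_t (i : 'I_r) : (i < size t)%N by rewrite st.
have t_inj : injective (fun i : 'I_r => nth i t i).
  move=> i j E; apply/val_inj/eqP; rewrite -(nth_uniq i (lt_t i) (lt_t j) ut).
  by rewrite E (set_nth_default j) ?lt_t.
exists (perm t_inj) => a b ab; rewrite !permE /= (set_nth_default a b) ?lt_t //.
have tot : total le by move=> x y; exact: leq_total.
have tr : transitive le by move=> x y z; exact: leq_trans.
have rf : reflexive le by move=> x; exact: leqnn.
apply: (sorted_leq_nth tr rf a (sort_sorted tot _)) => //; by rewrite inE st.
Qed.

(** An initial segment of ['I_r] is determined by its size; after sorting, this yields the bounds
    [k] and [l]. *)
Lemma downset_card r (A : pred 'I_r) :
  (forall a b : 'I_r, (a <= b)%N -> A b -> A a) -> forall a : 'I_r, (a < #|A|)%N = A a.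
Proof.
move=> dA a; have card_lt (c : nat) : (c <= r)%N -> #|[pred i : 'I_r | (i < c)%N]| = c.
  move=> cr; rewrite -sum1_card (eq_bigl (fun i : 'I_r => (i < c)%N)) //.
  by rewrite (big_ord_narrow cr) sum1_card card_ord.
apply/idP/idP => [aA|Aa].
  apply/negPn/negP => nAa; move: aA; rewrite ltnNge => /negP; apply.
  rewrite -[X in (_ <= X)%N](card_lt a (ltnW (ltn_ord a))).
  apply: subset_leq_card; apply/fintype.subsetP => b Ab; rewrite inE ltnNge.
  by apply: contra nAa => ab; exact: dA Ab.
rewrite -[X in (X <= _)%N](card_lt a.+1 (ltn_ord a)).
apply: subset_leq_card; apply/fintype.subsetP => b; rewrite inE ltnS => ba.
exact: dA Aa.
Qed.

(** * Orthonormal frames of the ambient space *)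

Section OrthonormalFamily.
Variables (R : realType) (r N m : nat) (n : 'I_r -> nat).
Variables (B : forall a, 'M[R]_(n a, N)) (B0 : 'M[R]_(m, N)).
Hypothesis B1 : forall a, B a *m (B a)^T = 1%:M.
Hypothesis B_perp : forall a b, a != b -> B a *m (B b)^T = 0.
Hypothesis B01 : B0 *m B0^T = 1%:M.
Hypothesis B0P : forall x : 'rV[R]_N, (forall a, x *m (B a)^T = 0) <-> x = x *m B0^T *m B0.

Definition frame : 'M[R]_(m + \sum_a n a, N) := col_mx B0 (\mxcol_a B a).

Lemma mul_frame y0 (y : forall a, 'rV[R]_(n a)) :
  row_mx y0 (\mxrow_a y a) *m frame = y0 *m B0 + \sum_a y a *m B a.
Proof. by rewrite mul_row_col mul_mxrow_mxcol. Qed.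

Lemma B_B0 a : B a *m B0^T = 0.
Proof.
have E : B0 *m (B a)^T = 0.
  apply/row_matrixP => j; rewrite row_mul row0 rowE.
  apply: (B0P (delta_mx 0 j *m B0)).2 => //.
  by rewrite -(mulmxA (delta_mx 0 j)) B01 mulmx1.
by rewrite -[B a]trmxK -trmx_mul E trmx0.
Qed.

Lemma frame_isometry (y z : 'rV[R]_(m + \sum_a n a)) :
  dot (y *m frame) (z *m frame) = dot y z.
Proof.
rewrite -[y]hsubmxK -[z]hsubmxK -(submxrowK (rsubmx y)) -(submxrowK (rsubmx z)).
rewrite !mul_frame dot_row_mx dot_mxrow.
move: (lsubmx y) (lsubmx z) (submxrow (rsubmx y)) (submxrow (rsubmx z)) => y0 z0 ya za.
have BB0 a (u : 'rV[R]_(n a)) (v : 'rV[R]_m) : dot (u *m B a) (v *m B0) = 0.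
  by rewrite dot_mulmxr -mulmxA B_B0 mulmx0 dot0l.
have z1 : dot (y0 *m B0) (\sum_a za a *m B a) = 0.
  by rewrite dot_sumr; apply: big1 => a _; rewrite dotC.
have z2 : dot (\sum_a ya a *m B a) (z0 *m B0) = 0.
  by rewrite dot_suml; apply: big1 => a _.
rewrite dotDl !dotDr z1 z2 addr0 add0r.
rewrite dot_mulmxl -(mulmxA z0) B01 mulmx1; congr (_ + _).
rewrite dot_suml; apply: eq_bigr => a _; rewrite dot_sumr (bigD1 a) //=.
rewrite dot_mulmxl -mulmxA B1 mulmx1 big1 ?addr0 // => b ba.
by rewrite dot_mulmxl -mulmxA (B_perp ba) mulmx0 dot0r.
Qed.

(** Subtracting the components in the [B a] leaves a vector of the complement, which [B0] reproduces
    by [B0P]. *)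
Lemma frame_complete (x : 'rV[R]_N) : x = x *m B0^T *m B0 + \sum_a x *m (B a)^T *m B a.
Proof.
pose x' := x - \sum_a x *m (B a)^T *m B a.
have x'B a : x' *m (B a)^T = 0.
  rewrite mulmxBl mulmx_suml (bigD1 a) //= -[_ *m B a *m _]mulmxA B1 mulmx1.
  rewrite big1 ?addr0 ?subrr // => b ba.
  by rewrite -(mulmxA (x *m (B b)^T)) (B_perp ba) mulmx0.
have x'0 : x' *m B0^T = x *m B0^T.
  rewrite mulmxBl mulmx_suml big1 ?subr0 // => a _.
  by rewrite -(mulmxA (x *m (B a)^T)) B_B0 mulmx0.
by rewrite -x'0 -((B0P x').1 x'B) /x' subrK.
Qed.

Lemma frame_dim : (m + \sum_a n a)%N = N.
Proof.
apply/eqP; rewrite eqn_leq; apply/andP; split.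
  have /eqP <- : row_free frame.
    apply: inj_row_free => y yQ; apply/eqP; rewrite -dot_eq0 -frame_isometry yQ dot0l //.
  exact: rank_leq_col.
suff /eqP <- : row_full frame by exact: rank_leq_row.
rewrite -sub1mx; apply/row_subP => i; apply/submxP.
exists (row_mx (row i 1%:M *m B0^T) (\mxrow_a (row i 1%:M *m (B a)^T))).
by rewrite mul_frame -frame_complete.
Qed.

End OrthonormalFamily.

(** * The tube recovered from the forms of its factors *)

Section Assembly.
Variables (R : realType) (r : nat) (M : 'I_r.+1 -> manifold R).
Local Notation P := (prod_manifold M).
Local Notation fac a := (M (lift ord0 a)).
Variables (N : nat) (f : P -> 'rV[R]_N) (o : P).
Hypothesis f_imm : immersion f.
Hypothesis dimM : forall a : 'I_r, (0 < mdim (fac a))%N.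
Variables (n : 'I_r -> nat) (B : forall a : 'I_r, 'M[R]_(n a, N)).
Hypothesis B1 : forall a, B a *m (B a)^T = 1%:M.
Hypothesis B_perp : forall a b, a != b -> B a *m (B b)^T = 0.
Variable X : forall a : 'I_r, M ord0 -> fac a -> 'rV[R]_(n a).
Hypothesis XE : forall (p : P) a, f p *m (B a)^T = X (p ord0) (p (lift ord0 a)).
Hypothesis X_imm : forall (a : 'I_r) p0, immersion (@X a p0).
Variable F : forall a : 'I_r, factor_form (@X a).
Variables (s : {perm 'I_r}) (k l : nat).
Hypothesis kl : (k <= l)%N.
Hypothesis lr : (l <= r)%N.
Hypothesis kP : forall a : 'I_r, (a < k)%N = (ff_kind (F (s a)) == 0%N).
Hypothesis lP : forall a : 'I_r, (k <= a < l)%N = (ff_kind (F (s a)) == 1%N).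
Variables (m : nat) (B0 : 'M[R]_(m, N)).
Hypothesis B01 : B0 *m B0^T = 1%:M.
Hypothesis B0P : forall x : 'rV[R]_N,
  (forall a, x *m (B (s a))^T = 0) <-> x = x *m B0^T *m B0.
Hypothesis f_B0 : forall p q : P, p ord0 = q ord0 -> f p *m B0^T = f q *m B0^T.

Definition unit_row (a : 'I_r) : 'rV[R]_k := \row_i ((i : nat) == a)%:R.

Lemma dot_unit_row (a : 'I_r) (ak : (a < k)%N) (v : 'rV[R]_k) :
  dot v (unit_row a) = v 0 (Ordinal ak).
Proof.
rewrite dotE (bigD1 (Ordinal ak)) //= mxE eqxx mulr1 big1 ?addr0 // => i ia.
by rewrite mxE -[(i : nat) == a]/(i == Ordinal ak) (negPf ia) mulr0.
Qed.

Lemma assembled_R_gt0 (a : 'I_r) : (a < k)%N -> 0 < ff_R (F (s a)).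
Proof. by rewrite kP => /eqP /ff_sphere []. Qed.

Lemma assembled_sphere (a : 'I_r) : (a < k)%N -> forall p : fac (s a),
  dot (ff_f (F (s a)) p) (ff_f (F (s a)) p) = ff_R (F (s a)) ^+ 2.
Proof. by rewrite kP => /eqP /ff_sphere []. Qed.

Lemma assembled_curve (a : 'I_r) : (k <= a < l)%N -> mdim (fac (s a)) = 1%N.
Proof. by rewrite lP => /eqP /ff_curve []. Qed.

Lemma unit_row_orthonormal (a b : 'I_r) : (a < k)%N -> (b < k)%N ->
  dot (unit_row a) (unit_row b) = (a == b)%:R.
Proof. by move=> ak bk; rewrite dot_unit_row mxE eq_sym. Qed.

Lemma assembled_n0 (a : 'I_r) : ~~ (k <= a < l)%N -> ff_n (F (s a)) = 0%N.
Proof. by rewrite lP; exact: ff_n0. Qed.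

Lemma assembled_E (a : 'I_r) : (k <= a < l)%N ->
  flat_parallel_subbundle (ff_f (F (s a))) (ff_n (F (s a))) (@ff_E _ _ _ _ _ (F (s a))).
Proof. by rewrite lP => /eqP /ff_curve []. Qed.

Lemma assembled_phi (a : 'I_r) : (k <= a < l)%N ->
  parallel_bundle_isometry (ff_f (F (s a))) (@ff_E _ _ _ _ _ (F (s a))) (@ff_phi _ _ _ _ _ (F (s a))).
Proof. by rewrite lP => /eqP /ff_curve []. Qed.

Lemma id_isometry : linear_isometry (fun y : 'rV[R]_m => y).
Proof. by []. Qed.

Definition assembled_tube : tube_data (fun a => fac (s a)) :=
  @TubeData R r (fun a => fac (s a)) k l m kl lr (fun a => n (s a))
    (fun a => ff_f (F (s a))) (fun a => ff_imm (F (s a))) (fun a => ff_R (F (s a)))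
    assembled_R_gt0 assembled_sphere assembled_curve unit_row unit_row_orthonormal
    (fun a => ff_n (F (s a))) assembled_n0 (fun a => @ff_E _ _ _ _ _ (F (s a)))
    (fun a => @ff_phi _ _ _ _ _ (F (s a))) assembled_E assembled_phi
    (fun y => y) id_isometry.

Local Notation D := assembled_tube.

(** The [e_a]-coordinate is [R_a * L], so that division by [R_a] returns the homothety factor [L].
    The last block is the component of [f] in the complement of all the spans, which by [f_B0]
    depends on the base alone. *)
Definition assembled_f0 (p0 : M ord0) : 'rV[R]_(td_s D) :=
  row_mx (\row_(i < k) (ff_R (F (s (widen_ord (leq_trans kl lr) i))) *
                        ff_L (F (s (widen_ord (leq_trans kl lr) i))) p0))
    (row_mx (\mxrow_a ff_y (F (s a)) p0 : 'rV[R]_(\sum_a td_n D a))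
       (f (dfwith o ord0 p0) *m B0^T)).

Local Notation W p0 := (assembled_f0 p0 - td_shift D).

(** On a sphere the coefficient of [f_a] is [1 + (R_a * L - R_a) / R_a = L]; the tube thus gives
    back the component up to the translation [ff_z]. *)
Lemma assembled_block (a : 'I_r) p0 (pa : fac (s a)) :
  td_f D a pa + @nrm R r _ D a pa (W p0) = X p0 pa - ff_z (F (s a)).
Proof.
rewrite (ff_eq (F (s a)) p0 pa) [ff_z _ + _]addrC addrK.
rewrite /nrm /= -kP; case: ifPn => [ak|ak].
  have -> : proj_k (W p0) = proj_k (assembled_f0 p0) - proj_k (td_shift D).
    by rewrite /proj_k raddfB.
  have T := @dot_td_shift R r _ D a ak; rewrite /= in T.
  rewrite dotBl T /= {1}/proj_k /assembled_f0 row_mxKl dot_unit_row mxE.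
  have -> : widen_ord (leq_trans kl lr) (Ordinal ak) = a by apply: val_inj.
  have R0 : ff_R (F (s a)) != 0 by rewrite gt_eqF // assembled_R_gt0.
  rewrite scalerA -[X in X + _]scale1r -scalerDl; congr (_ *: _).
  by field.
have -> : (a < l)%N = (ff_kind (F (s a)) == 1%N).
  by rewrite -lP [(k <= a)%N]leqNgt ak.
case: ifPn => // _; last by rewrite addr0.
congr (_ + ff_phi _ _).
have -> : proj_a a (W p0) = proj_a a (assembled_f0 p0) - proj_a a (td_shift D).
  by rewrite /proj_a !raddfB /= submxrowB.
by rewrite proj_a_shift subr0 /proj_a /assembled_f0 row_mxKr row_mxKl mxrowK.
Qed.

Lemma assembled_m p0 : proj_m (W p0) = f (dfwith o ord0 p0) *m B0^T.
Proof.
have -> : proj_m (W p0) = proj_m (assembled_f0 p0) - proj_m (td_shift D).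
  by rewrite /proj_m !raddfB.
have -> : proj_m (td_shift D) = 0.
  rewrite /proj_m /td_shift !raddf_sum; apply: big1 => b _.
  by rewrite /= !linearZ /= row_mxKr linear0 scaler0.
by rewrite subr0 /proj_m /assembled_f0 !row_mxKr.
Qed.

Lemma assembled_tubeE p0 (p : prod_manifold (fun a => fac (s a))) :
  td_tube assembled_f0 p0 p =
  row_mx (f (dfwith o ord0 p0) *m B0^T) (\mxrow_a (X p0 (p a) - ff_z (F (s a)))).
Proof.
rewrite td_tubeE assembled_m; apply: (congr1 (row_mx _)); apply: eq_mxrow => a.
exact: assembled_block.
Qed.

Definition assembled_T (y : 'rV[R]_(td_dim D)) : 'rV[R]_N :=
  y *m frame (fun a => B (s a)) B0.

Definition assembled_b : 'rV[R]_N := \sum_a ff_z (F (s a)) *m B (s a).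

Lemma Bs_perp a b : a != b -> B (s a) *m (B (s b))^T = 0.
Proof. by move=> ab; apply: B_perp; rewrite (inj_eq perm_inj). Qed.

Lemma assembled_T_isometry : linear_isometry assembled_T.
Proof.
split=> [a u v|u v]; first by rewrite /assembled_T mulmxDl scalemxAl.
exact: frame_isometry (fun a => B1 (s a)) Bs_perp B01 B0P u v.
Qed.

Lemma assembled_dim : td_dim D = N.
Proof. exact: frame_dim (fun a => B1 (s a)) Bs_perp B01 B0P. Qed.

Lemma assembledE (p : P) :
  f p = assembled_T (td_tube assembled_f0 (p ord0) (fun a => p (lift ord0 (s a)))) + assembled_b.
Proof.
rewrite assembled_tubeE /assembled_T mul_frame.
rewrite {1}(frame_complete (fun a => B1 (s a)) Bs_perp B01 B0P (f p)).
have -> : f p *m B0^T = f (dfwith o ord0 (p ord0)) *m B0^T.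
  by apply: f_B0; rewrite dfwithin.
rewrite -addrA; congr (_ + _); rewrite /assembled_b -big_split; apply: eq_bigr => a _ /=.
by rewrite XE mulmxBl subrK.
Qed.

Lemma assembled_f0_smooth : msmooth assembled_f0.
Proof.
apply/msmoothP => c j; apply: Ck_row_mx; first exact: cimg_open.
  apply: Ck_mx => [|i i']; first exact: cimg_open.
  under eq_fun do rewrite mxE.
  apply: CkM; [exact: cimg_open|exact: Ck_cst|].
  exact: (ff_L_smooth (F (s (widen_ord (leq_trans kl lr) i'))) c j).
apply: Ck_row_mx; first exact: cimg_open.
  apply: Ck_mxrow => [|a]; first exact: cimg_open.
  have /msmoothP sy := ff_y_smooth (F (s a)).
  exact: sy c j.
apply: Ck_mulmx; first exact: cimg_open.
have /msmoothP sf := @msmooth_slice R r.+1 M _ f o ord0 f_imm.1.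
exact: sf c j.
Qed.

(** On the base slice through [o], [f] is an affine function of [assembled_f0], so a kernel vector
    of the differential of the latter is one for the slice, which is an immersion. *)
Lemma assembled_f0_immersion : immersion assembled_f0.
Proof.
split; first exact: assembled_f0_smooth.
move=> c p0 cp v dv.
pose pt : prod_manifold (fun a => fac (s a)) := fun a => o (lift ord0 (s a)).
apply: ((slice_immersion f_imm o ord0).2 _ _ cp).
have fE : f \o dfwith o ord0 = fun q =>
    assembled_T (td_ftilde D pt + td_phitilde pt (assembled_f0 q - td_shift D)) + assembled_b.
  apply/funext => q; rewrite /= assembledE dfwithin.
  have -> : (fun a => dfwith o ord0 q (lift ord0 (s a))) = pt.
    apply: functional_extensionality_dep => a.
    by rewrite dfwithout // neq_lift.
  by [].
have dW : is_derive (ccoord (mchart c) p0) v (assembled_f0 \o cpar (mchart c)) 0.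
  by rewrite -dv; exact: mdiffP assembled_f0_smooth cp.
have dW' : is_derive (ccoord (mchart c) p0) v
    (fun y => (assembled_f0 \o cpar (mchart c)) y - td_shift D) 0.
  by rewrite -[X in is_derive _ _ _ X](subr0 (0 : 'rV[R]_(td_s D))); exact: is_deriveB.
have dP := is_derive_linear_comp (td_phitilde_linear pt) dW'.
have dS : is_derive (ccoord (mchart c) p0) v
   (fun y => td_ftilde D pt + td_phitilde pt ((assembled_f0 \o cpar (mchart c)) y - td_shift D))
   (0 + td_phitilde pt (0 : 'rV[R]_(td_s D))) by exact: is_deriveD.
have dT := is_derive_linear_comp assembled_T_isometry.1 dS.
have dF : is_derive (ccoord (mchart c) p0) v ((f \o dfwith o ord0) \o cpar (mchart c))
   (assembled_T (0 + td_phitilde pt (0 : 'rV[R]_(td_s D))) + 0).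
  by rewrite fE; exact: is_deriveD.
rewrite /mdiff; have [_ ->] := dF.
apply/eqP; rewrite addr0 add0r -dot_eq0 assembled_T_isometry.2 td_phitilde_dot dot0l //.
Qed.

(** The differential of the component [X p0] is [(1 + sig) *: df_a], so a zero of [1 + sig] would
    contradict [X_imm]. *)
Lemma assembled_admissible : admissible_f0 assembled_f0.
Proof.
split; first exact: assembled_f0_immersion.
move=> p0; apply: OmegaP => a pa; apply/eqP => s0.
have cp := mchart_atP pa; set c := mchart_at pa in cp.
have sF := @td_f_smooth R r _ D a.
have sN := @nrm_smooth R r _ D a (W p0).
pose v : 'rV[R]_(mdim (fac (s a))) := const_mx 1.
have : v != 0.
  apply/eqP => /matrixP/(_ 0 (Ordinal (dimM (s a)))); rewrite !mxE => /eqP.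
  by rewrite oner_eq0.
move/eqP; apply; apply: ((@X_imm (s a) p0).2 c pa cp v).
have XD : @X (s a) p0 = fun q => 1 *: td_f D a q + (@nrm R r _ D a q (W p0) + ff_z (F (s a))).
  by apply/funext => q; rewrite scale1r addrA assembled_block subrK.
have sNz : msmooth (fun q => @nrm R r _ D a q (W p0) + ff_z (F (s a))).
  rewrite (_ : (fun _ => _) = fun q => 1 *: @nrm R r _ D a q (W p0) + ff_z (F (s a))).
    by apply: msmooth_lin => //; exact: msmooth_cst.
  by apply/funext => q; rewrite scale1r.
rewrite XD (mdiff_lin 1 _ sF sNz cp).
have -> : mdiff c (fun q => @nrm R r _ D a q (W p0) + ff_z (F (s a))) pa v =
    @sig R r _ D a pa (W p0) *: mdiff c (td_f D a) pa v.
  rewrite -(@nrm_mdiff R r _ D a (W p0) _ _ v cp).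
  rewrite (_ : (fun q => _ + _) = fun q => 1 *: @nrm R r _ D a q (W p0) + ff_z (F (s a))).
    by rewrite (mdiff_lin 1 v sN (msmooth_cst _) cp) scale1r mdiff_cst addr0.
  by apply/funext => q; rewrite scale1r.
by rewrite -scalerDl s0 scale0r.
Qed.

End Assembly.

Lemma quasi_warped_partial_tube (R : realType) (r : nat) (M : 'I_r.+1 -> manifold R)
  (M_nonempty : forall i, [set: M i] !=set0)
  (M_dim_gt0 : forall a : 'I_r, (0 < mdim (M (lift ord0 a)))%N)
  (connM : forall i, connected [set: M i])
  (N : nat) (g0 : metric (M ord0)) (g : forall a : 'I_r, metric (M (lift ord0 a)))
  (rho : forall a : 'I_r, M ord0 -> M (lift ord0 a) -> R)
  (f : prod_manifold M -> 'rV[R]_N) :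
  riemannian g0 -> (forall a, riemannian (@g a)) -> immersion f ->
  is_quasi_warped (induced_metric f) g0 (@g) (@rho) -> adapted f ->
  exists (s : {perm 'I_r})
    (D : tube_data (fun a : 'I_r => M (lift ord0 (s a))))
    (f0 : M ord0 -> 'rV[R]_(td_s D))
    (T : 'rV[R]_(td_dim D) -> 'rV[R]_N) (b : 'rV[R]_N),
    [/\ admissible_f0 f0, td_dim D = N, linear_isometry T
      & forall p : prod_manifold M,
          f p = T (td_tube f0 (p ord0) (fun a => p (lift ord0 (s a)))) + b].
Proof.
move=> riem0 riem f_imm f_qw f_adapted.
pose o : prod_manifold M := fun i => projT1 (cid (M_nonempty i)).
pose h a := f \o dfwith o (lift ord0 a).
pose n a := projT1 (cid (tangent_onb (h a))).
pose B a : 'M[R]_(n a, N) := projT1 (cid (projT2 (cid (tangent_onb (h a))))).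
have BP a := projT2 (cid (projT2 (cid (tangent_onb (h a))))).
have B1 a : B a *m (B a)^T = 1%:M.
  by case: (BP a) => H _ _; exact H.
have B_id a : forall (c : mindex (M (lift ord0 a))) p v, cdom (mchart c) p ->
    mdiff c (h a) p v *m (B a)^T *m B a = mdiff c (h a) p v.
  by case: (BP a) => _ H _; exact H.
have B_perp a : forall x, (forall (c : mindex (M (lift ord0 a))) p v, cdom (mchart c) p ->
    dot x (mdiff c (h a) p v) = 0) -> x *m (B a)^T = 0.
  by case: (BP a) => _ _ H; exact H.
have B_orth a b : a != b -> B a *m (B b)^T = 0.
  exact: (B_orthogonal riem0 riem f_imm f_qw f_adapted connM B_perp).
have exF a : exists F : factor_form (@component R r M N f o n B a), True.
  have [F] := component_form riem0 riem f_imm f_qw f_adapted connM M_dim_gt0 B1 B_id B_perp a.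
  by exists F.
pose F a := projT1 (cid (exF a)).
(* Every kind above [1] denotes a fixed map; all of them are merged into [2] for sorting. *)
pose kd a := if ff_kind (F a) == 0%N then 0%N else if ff_kind (F a) == 1%N then 1%N else 2%N.
have [s s_mono] := sorting_perm kd.
pose k := #|[pred a | kd (s a) == 0%N]|; pose l := #|[pred a | (kd (s a) <= 1)%N]|.
have kE (a : 'I_r) : (a < k)%N = (kd (s a) == 0%N).
  apply: (downset_card (A := [pred a | kd (s a) == 0%N])) => x y xy /= /eqP E.
  by rewrite -leqn0 -E; exact: s_mono.
have lE (a : 'I_r) : (a < l)%N = (kd (s a) <= 1)%N.
  apply: (downset_card (A := [pred a | (kd (s a) <= 1)%N])) => x y xy /=.
  exact: leq_trans (s_mono _ _ xy).
have kl : (k <= l)%N.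
  by apply: subset_leq_card; apply/fintype.subsetP => a; rewrite !inE => /eqP ->.
have lr : (l <= r)%N by rewrite -[X in (_ <= X)%N](card_ord r); exact: max_card.
have kP (a : 'I_r) : (a < k)%N = (ff_kind (F (s a)) == 0%N).
  by rewrite kE /kd; case: ifP => // _; case: ifP.
have lP (a : 'I_r) : (k <= a < l)%N = (ff_kind (F (s a)) == 1%N).
  rewrite [(k <= a)%N]leqNgt kE lE /kd; case: ifPn => [/eqP -> //|_].
  by case: ifP.
(* The complement of all the spans, which becomes the [R^m] part of the tube. *)
pose S : set 'rV[R]_N := [set x | forall a, x *m (B (s a))^T = 0].
have S0 : S 0 by move=> a; rewrite mul0mx.
have SD c u v : S u -> S v -> S (c *: u + v).
  by move=> Su Sv a; rewrite mulmxDl -scalemxAl Su Sv scaler0 addr0.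
have [m [B0 [B01 B0P]]] := subspace_onb S0 SD.
have B_B0s a : B a *m B0^T = 0.
  by rewrite -(permKV s a); exact: (B_B0 (B := fun a => B (s a)) B01 B0P).
have f_B0 (p q : prod_manifold M) : p ord0 = q ord0 -> f p *m B0^T = f q *m B0^T.
  move=> pq; apply: (f_indep riem0 riem f_imm f_qw f_adapted connM (o := o) (A := predT)) => //.
  move=> b _ c x v cx; rewrite -(B_id b c x v cx) -(mulmxA (_ *m _)) B_B0s mulmx0 //.
have XE (p : prod_manifold M) a : f p *m (B a)^T =
    @component R r M N f o n B a (p ord0) (p (lift ord0 a)).
  exact: (f_component riem0 riem f_imm f_qw f_adapted connM B_perp).
have X_imm a p0 : immersion (@component R r M N f o n B a p0).
  exact: (component_immersion riem0 riem f_imm f_qw f_adapted connM B_id).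
exists s, (assembled_tube kl lr kP lP m), (assembled_f0 f o kl lr kP lP B0).
exists (assembled_T (kl := kl) (lr := lr) (kP := kP) (lP := lP) B B0), (assembled_b B F s).
split.
- exact: assembled_admissible.
- exact: (assembled_dim B1 B_orth kl lr kP lP B01 B0P).
- exact: (assembled_T_isometry B1 B_orth kl lr kP lP B01 B0P).
- move=> p; exact: assembledE.
Qed.

Unset Implicit Arguments.
Set Strict Implicit.

Theorem theorem32 (R : realType) (r : nat) (M : 'I_r.+1 -> manifold R)
  (r_gt0 : (0 < r)%N)
  (M_nonempty : forall i, [set: M i] !=set0)
  (M_dim_gt0 : forall a : 'I_r, (0 < mdim (M (lift ord0 a)))%N) :
  (forall (D : tube_data (fun a : 'I_r => M (lift ord0 a)))
      (f0 : M ord0 -> 'rV[R]_(td_s D)),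
    admissible_f0 f0 ->
    let f (p : prod_manifold M) :=
      td_tube f0 (p ord0) (fun a => p (lift ord0 a)) in
    let G := induced_metric f in
    let g0 := induced_metric f0 in
    let g a := induced_metric (td_f D a) in
    let rho := td_rho f0 in
    [/\ immersion f,
        is_quasi_warped G g0 g (fun a p0 pa => `|rho a p0 pa|),
        (forall a p0 pa, 0 < rho a p0 pa) -> is_quasi_warped G g0 g rho
      & adapted f])
  /\
  ((forall i, connected [set: M i]) ->
   forall (N : nat) (g0 : metric (M ord0))
      (g : forall a : 'I_r, metric (M (lift ord0 a)))
      (rho : forall a : 'I_r, M ord0 -> M (lift ord0 a) -> R)
      (f : prod_manifold M -> 'rV[R]_N),
    riemannian g0 -> (forall a, riemannian (g a)) ->
    immersion f ->
    is_quasi_warped (induced_metric f) g0 g rho ->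
    adapted f ->
    exists (s : {perm 'I_r})
      (D : tube_data (fun a : 'I_r => M (lift ord0 (s a))))
      (f0 : M ord0 -> 'rV[R]_(td_s D))
      (T : 'rV[R]_(td_dim D) -> 'rV[R]_N) (b : 'rV[R]_N),
      [/\ admissible_f0 f0,
          td_dim D = N,
          linear_isometry T
        & forall p : prod_manifold M,
            f p = T (td_tube f0 (p ord0) (fun a => p (lift ord0 (s a)))) + b]).
Proof.
split=> [D f0|connM N g0 g rho f]; first exact: partial_tube_quasi_warped.
exact: quasi_warped_partial_tube.
Qed.
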